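(* Let $\mathbb X=(X,\tau,\mathsf d,\mathfrak m)$ be an extended metric-topological measure space and assume that $g:X\to[0,\infty]$ is a $\mathcal T_q$-weak upper gradient of an $\mathfrak m$-measurable function $f:X\to\mathbb R$. Then for $\mathcal T_q$-a.e. arc $\gamma\in\mathrm{RA}(X)$ the function $f$ is strictly Sobolev along $\gamma$, and the corresponding absolutely continuous function $f_\gamma:[0,1]\to\mathbb R$ satisfies $$\Big|\frac{d}{dt}f_\gamma\Big|\le\ell(\gamma)\,g\circ R_\gamma\quad\text{a.e. in }[0,1],\qquad f_\gamma(i)=f(R_\gamma(i)),\quad i\in\{0,1\}.$$
   Context: Setting. $p\in(1,\infty)$ is fixed and $q=p/(p-1)$. An extended distance on $X$ is a symmetric map $\mathsf d:X\times X\to[0,\infty]$ satisfying the triangle inequality, with $\mathsf d(x,y)=0$ iff $x=y$. For a Hausdorff space $(X,\tau)$, $\mathrm{Lip}_b(X,\tau,\mathsf d)$ is the set of bounded $\tau$-continuous real functions that are $\mathsf d$-Lipschitz, $\mathrm{Lip}_{b,1}(X,\tau,\mathsf d)$ the subset of those with $|f(x)-f(y)|\le\mathsf d(x,y)$. $(X,\tau,\mathsf d)$ is an extended metric-topological (e.m.t.) space if $\tau$ is the initial topology generated by $\mathrm{Lip}_b(X,\tau,\mathsf d)$ and $\mathsf d(x,y)=\sup_{f\in\mathrm{Lip}_{b,1}(X,\tau,\mathsf d)}|f(x)-f(y)|$ for all $x,y$. $\mathcal M_+(Y)$ is the set of finite nonnegative Radon measures on a Hausdorff space $Y$ (Borel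 measures with $\mu(B)=\sup\{\mu(K):K\subset B\text{ compact}\}$). An extended metric-topological measure space is $\mathbb X=(X,\tau,\mathsf d,\mathfrak m)$ with $(X,\tau,\mathsf d)$ an e.m.t. space and $\mathfrak m\in\mathcal M_+(X)$. Rectifiable arcs. On $C([0,1];(X,\tau))$ (compact-open topology) set $\gamma\sim\gamma'$ if $\gamma\circ\sigma=\gamma'\circ\sigma'$ for some continuous nondecreasing surjective $\sigma,\sigma':[0,1]\to[0,1]$. $\ell(\gamma)=\sup\{\sum_j\mathsf d(\gamma(t_j),\gamma(t_{j-1})):t_0<\dots<t_N\text{ in }[0,1]\}$. $\mathrm{RA}(X)$ is the set of equivalence classes of curves of finite length, with the quotient topology. Each $\gamma\in\mathrm{RA}(X)$ has a unique constant-speed ($\ell(\gamma)$-Lipschitz, with $\mathsf d$-variation $\ell(\gamma)t$ on $[0,t]$) representative $R_\gamma:[0,1]\to X$; $\gamma_i=\mathsf e_i(\gamma)=R_\gamma(i)$, $i=0,1$, and $\int_\gamma f=\ell(\gamma)\int_0^1f(R_\gamma(s))\,ds$. Weak upper gradients. For $\pi\in\mathcal M_+(\mathrm{RA}(X))$, $\mathrm{Bar}_q(\pi)=\|h\|_{L^q}$ if there is $h\in L^q(X,\mathfrak m)$ with $\int\int_\gamma f\,d\pi(\gamma)=\int_Xfh\,d\mathfrak m$ for all bounded Borel $f$, and $+\infty$ otherwise. $\mathcal T_q$ is the set of $\pi\in\mathcal M_+(\mathrm{RA}(X))$ with $\mathrm{Bar}_q(\pi)<\infty$ and $(\mathsf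 e_i)_\sharp\pi=h_i\mathfrak m$, $h_i\in L^q(X,\mathfrak m)$, $i=0,1$. A property holds $\mathcal T_q$-a.e. if for every $\pi\in\mathcal T_q$ the exceptional set of arcs is contained in a $\pi$-negligible Borel set. An $\mathfrak m$-measurable $g:X\to[0,\infty]$ is a $\mathcal T_q$-weak upper gradient of $f:X\to\mathbb R$ if $|f(\gamma_1)-f(\gamma_0)|\le\int_\gamma g<\infty$ for $\mathcal T_q$-a.e. $\gamma\in\mathrm{RA}(X)$. A map $f:X\to\mathbb R$ is strictly Sobolev along $\gamma$ if $f\circ R_\gamma$ coincides a.e. in $[0,1]$ and at the points $0,1$ with an absolutely continuous map $f_\gamma:[0,1]\to\mathbb R$. *)

(* Defs.v *)
From HB Require Import structures.
From mathcomp Require Import all_boot all_order all_algebra.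
From mathcomp Require Import all_classical all_reals all_analysis.
From mathcomp Require Import measurable_realfun ring lra.

Set Implicit Arguments.
Unset Strict Implicit.
Unset Printing Implicit Defensive.
Import Order.TTheory GRing.Theory Num.Theory.
Import numFieldNormedType.Exports.

Local Open Scope classical_set_scope.
Local Open Scope ring_scope.

Record extended_distance (R : realType) (X : Type) := ExtendedDistance {
  edist :> X -> X -> \bar R ;
  edist_ge0 : forall x y, (0 <= edist x y)%E ;
  edist_sym : forall x y, edist x y = edist y x ;
  edist_triangle : forall x y z, (edist x z <= edist x y + edist y z)%E ;
  edist_eq0 : forall x y, edist x y = 0%E <-> x = y }.

Definition Lip_b (R : realType) (X : topologicalType)
    (d : extended_distance R X) : set (X -> R) :=
  [set f | [/\ continuous f,
    exists M : R, forall x, `|f x| <= M &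
    exists2 L : R, 0 <= L &
      forall x y, (`|f x - f y|%:E <= L%:E * d x y)%E]].

Definition Lip_b1 (R : realType) (X : topologicalType)
    (d : extended_distance R X) : set (X -> R) :=
  [set f | Lip_b d f /\ forall x y, (`|f x - f y|%:E <= d x y)%E].

Record emt_space (R : realType) (X : topologicalType)
    (d : extended_distance R X) : Prop := {
  emt_hausdorff : hausdorff_space X ;
  emt_initial : forall A : set X, open A <->
    @open (sup_topology (fun f : Lip_b d =>
      Topological.class (initial_topology (set_val f)))) A ;
  emt_dist : forall x y,
    d x y = ereal_sup [set `|f x - f y|%:E | f in Lip_b1 d] }.

Notation borel X := (g_sigma_algebraType (@open X)).

Definition radon (R : realType) (Y : ptopologicalType)
    (mu : {finite_measure set (borel Y) -> \bar R}) : Prop :=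
  forall B : set (borel Y), measurable B ->
    mu B = ereal_sup [set mu K | K in [set K : set Y | compact K /\ K `<=` B]].

(* Measurability with respect to the mu-completion of the sigma-algebra. *)
Definition ae_measurable d d' (R : realType) (Y : measurableType d)
    (Z : measurableType d') (mu : {measure set Y -> \bar R}) (f : Y -> Z) :=
  measurable_fun [set: g_sigma_algebraType (completed_algebra_gen mu)] f.

Definition absolutely_continuous_on (R : realType) (a b : R) (F : R -> R) :=
  forall e : R, 0 < e -> exists2 k : R, 0 < k &
    forall n (u v : nat -> R),
      (forall i, (i < n)%N -> [/\ a <= u i, u i <= v i & v i <= b]) ->
      trivIset `I_n (fun i => `]u i, v i[%classic) ->
      \sum_(i < n) (v i - u i) < k ->
      \sum_(i < n) `|F (v i) - F (u i)| < e.

Section curves.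
Context {R : realType}.

Definition unit_itv : set R := `[0, 1].

Lemma clamp_subproof (t : R) :
  Num.min 1 (Num.max 0 t) \in unit_itv.
Proof.
rewrite inE /unit_itv/= in_itv/= le_min ler01 le_max lexx/=.
by rewrite ge_min lexx.
Qed.

Definition clamp (t : R) : unit_itv := 
  exist (fun x => x \in unit_itv) _ (clamp_subproof t).

Definition reparametrization (s : unit_itv -> unit_itv) : Prop :=
  [/\ continuous s,
      forall t u, set_val t <= set_val u -> set_val (s t) <= set_val (s u) &
      forall u, exists t, s t = u].

Lemma clampE (t : R) : 0 <= t <= 1 -> set_val (clamp t) = t.
Proof.
by rewrite set_valE/= => /andP[t0 t1]; rewrite max_r// min_r.
Qed.

Lemma set_val_unit (u : unit_itv) : 0 <= set_val u <= 1.
Proof.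
rewrite set_valE/=; case: u => u /=.
by rewrite inE /unit_itv/= in_itv.
Qed.

Lemma clampK (u : unit_itv) : clamp (set_val u) = u.
Proof.
apply: val_inj; have := clampE (set_val_unit u).
by rewrite set_valE.
Qed.

Lemma clamp_le (s t : R) : s <= t -> set_val (clamp s) <= set_val (clamp t).
Proof.
move=> st; rewrite set_valE/=.
by rewrite le_min2// le_max2.
Qed.

Lemma clamp_le0 (t : R) : t <= 0 -> clamp t = clamp 0.
Proof. by move=> t0; apply: val_inj; rewrite /= maxxx max_l. Qed.

Lemma clamp_ge1 (t : R) : 1 <= t -> clamp t = clamp 1.
Proof.
move=> t1; apply: val_inj => /=.
by rewrite !max_r// ?(le_trans ler01 t1)// minxx min_l.
Qed.

Lemma lip1_continuous (h : R -> R) (k : R) : 0 < k ->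
  (forall s t, s <= t -> `|h t - h s| <= k * (t - s)) -> continuous h.
Proof.
move=> k0 hk x; apply/cvgrPdist_lt => e e0; near=> y.
have xy : `|x - y| < e / k.
  by near: y; apply: cvgr_dist_lt; rewrite ?divr_gt0//; exact: cvg_id.
have : k * `|x - y| < e by rewrite mulrC -ltr_pdivlMr.
apply: le_lt_trans; have [le_xy|/ltW le_yx] := leP x y.
  by rewrite distrC (le_trans (hk _ _ le_xy))// distrC ger0_norm// subr_ge0.
by rewrite (le_trans (hk _ _ le_yx))// ger0_norm// subr_ge0.
Unshelve. all: by end_near. Qed.

Lemma clamp_continuous : continuous clamp.
Proof.
apply: continuous_comp_initial; apply: (@lip1_continuous _ 1) => // s t st.
rewrite mul1r ger0_norm ?subr_ge0 ?clamp_le// set_valE/=.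
by case: (lerP 0 s) => ?; case: (lerP 0 t) => ?;
  rewrite !minElt; repeat case: ltP => ?; lra.
Qed.

Lemma reparametrization_ext (s : unit_itv -> unit_itv) :
  reparametrization s ->
  let h t := set_val (s (clamp t)) in
  [/\ continuous h, {homo h : t u / t <= u},
      forall t, t <= 0 -> h t = 0 & forall t, 1 <= t -> h t = 1].
Proof.
move=> [cs ms ss] h; split.
- move=> t; rewrite /h; apply: (@continuous_comp _ _ _ (s \o clamp) set_val).
    by apply: continuous_comp; [exact: clamp_continuous|exact: cs].
  exact: initial_continuous.
- by move=> t u tu; apply: ms; exact: clamp_le.
- move=> t t0; rewrite /h clamp_le0//; have [u su] := ss (clamp 0).
  apply/eqP; rewrite eq_le; case/andP: (set_val_unit (s (clamp 0))) => -> _.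
  rewrite andbT -[leRHS](@clampE 0) ?lexx ?ler01// -[X in _ <= set_val X]su; apply: ms.
  by rewrite clampE ?lexx ?ler01//; case/andP: (set_val_unit u).
- move=> t t1; rewrite /h clamp_ge1//; have [u su] := ss (clamp 1).
  apply/eqP; rewrite eq_le; case/andP: (set_val_unit (s (clamp 1))) => _ -> /=.
  rewrite -[leLHS](@clampE 1) ?lexx ?ler01// -[X in set_val X <= _]su; apply: ms.
  by rewrite (@clampE 1) ?lexx ?ler01//; case/andP: (set_val_unit u).
Qed.

Lemma reparametrization_clamp (h : R -> R) :
  continuous h -> {homo h : t u / t <= u} -> h 0 = 0 -> h 1 = 1 ->
  reparametrization (fun u => clamp (h (set_val u))).
Proof.
move=> ch mh h0 h1; split.
- move=> u; apply: continuous_comp; last exact: clamp_continuous.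
  apply: (@continuous_comp _ _ _ (set_val : unit_itv -> R) h); last exact: ch.
  exact: initial_continuous.
- by move=> t u tu; apply: clamp_le; exact: mh.
- move=> u; have [|t t01 htu] := @IVT _ h 0 1 (set_val u) ler01
      (continuous_subspaceT ch).
  + by rewrite h0 h1 (min_idPl ler01) (max_idPr ler01); exact: set_val_unit.
  + by exists (clamp t); rewrite clampE ?htu ?clampK.
Qed.

Lemma monotone_pullback (f g : R -> R) :
  continuous f -> continuous g ->
  {homo f : t u / t <= u} -> {homo g : t u / t <= u} ->
  (forall t, t <= 0 -> f t = 0) -> (forall t, t <= 0 -> g t = 0) ->
  (forall t, 1 <= t -> f t = 1) -> (forall t, 1 <= t -> g t = 1) ->
  exists a : R -> R,
    [/\ {homo a : v w / v <= w},
        forall v w, v <= w -> a w - a v <= w - v,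
        a 0 = 0, a 2 = 1 &
        forall v, 0 <= v <= 2 -> f (a v) = g (v - a v)].
Proof.
move=> cf cg mf mg f0 g0 f1 g1.
pose S v := [set s | [/\ 0 <= s, s <= 1, s <= Num.max 0 v & f s <= g (v - s)]].
have g_ge0 t : 0 <= g t.
  have [t0|/ltW t0] := leP t 0; first by rewrite g0.
  by rewrite -(g0 0)// mg.
have f_le1 t : f t <= 1.
  have [t0|/ltW t0] := leP 1 t; first by rewrite f1.
  by rewrite -(f1 1)// mf.
have S0 v : S v 0 by split; rewrite ?lexx ?ler01 ?le_max ?lexx// f0.
have hS v : has_sup (S v) by split; [exists 0|exists 1 => s []].
have ubS v s : S v s -> s <= sup (S v).
  by move=> Ss; apply: ub_le_sup => //; case: (hS v).
have supS v x : (forall s, S v s -> s <= x) -> sup (S v) <= x.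
  by move=> h; apply: ge_sup => //; exists 0.
have a_ge0 v : 0 <= sup (S v) by exact: ubS.
have a_le1 v : sup (S v) <= 1 by apply: supS => s [].
have a_lev v : sup (S v) <= Num.max 0 v by apply: supS => s [].
exists (fun v => sup (S v)); split.
- move=> v w vw; apply: supS => s [s0 s1 sv fs]; apply: ubS; split => //.
    by rewrite (le_trans sv)// le_max2.
  by rewrite (le_trans fs)// mg// lerB.
- move=> v w vw; rewrite lerBlDr; apply: supS => s [s0 s1 sv fs].
  have [sd|/ltW sd] := leP s (w - v).
    by rewrite (le_trans sd)// lerDl.
  rewrite -lerBlDl; apply: ubS; split.
  + by rewrite subr_ge0.
  + by lra.
  + by move: sv; case: (lerP 0 w) => ?; case: (lerP 0 v) => ?; lra.
  + have -> : v - (s - (w - v)) = w - s by lra.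
    by rewrite (le_trans _ fs)// mf//; lra.
- by apply/eqP; rewrite eq_le a_ge0 andbT (le_trans (a_lev _))// maxxx.
- apply/eqP; rewrite eq_le a_le1/=; apply: ubS; split=> //.
    by rewrite le_max; apply/orP; right; lra.
  by rewrite f1// g1//; lra.
- move=> v /andP[v0 v2]; set a := sup (S v).
  have cfg : continuous (fun s : R => g (v - s) - f s).
    move=> s; apply: cvgB; last exact: cf.
    apply: (@continuous_comp _ _ _ (fun s => v - s) g); last exact: cg.
    by apply: cvgB; [exact: cvg_cst|exact: cvg_id].
  apply/eqP; rewrite eq_le; apply/andP; split.
    rewrite leNgt; apply/negP => gf.
    have /cvgrPdist_lt /(_ (f a - g (v - a))) := cfg a.
    rewrite subr_gt0 gf => /(_ isT)/nbhs_ballP[e /= e0 He].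
    have [s Ss sa] := sup_adherent e0 (hS v).
    have /= := He s; rewrite /ball/= ger0_norm ?subr_ge0 ?ubS//.
    have {}sa : a - s < e by rewrite ltrBlDl -ltrBlDr.
    move=> /(_ sa).
    case: Ss => _ _ _ fs; rewrite ltr_norml => /andP[+ _].
    by lra.
  have [a1|a1] := leP 1 a.
    have aE : a = 1 by apply/eqP; rewrite eq_le a1 a_le1.
    have va : a <= v by have := a_lev v; rewrite max_r.
    have [w1|w1] := leP (v - a) 1; last by rewrite g1 ?f1// ltW.
    by rewrite (f1 a a1) -(g1 1)// mg.
  have [va|va] := leP v a.
    by rewrite g0 ?subr_le0// -(f0 0)// mf// a_ge0.
  rewrite leNgt; apply/negP => gf.
  have /cvgrPdist_lt /(_ (g (v - a) - f a)) := cfg a.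
  rewrite subr_gt0 gf => /(_ isT)/nbhs_ballP[e /= e0 He].
  pose m := Num.min (e / 2) (Num.min (1 - a) (v - a)).
  have m0 : 0 < m by rewrite !lt_min divr_gt0// !subr_gt0 a1 va.
  have [me m1 mv] : [/\ m <= e / 2, m <= 1 - a & m <= v - a].
    by split; rewrite /m !ge_min lexx ?orbT.
  have : S v (a + m).
    have aa : 0 <= a by exact: a_ge0.
    split; [lra|lra|by rewrite max_r//; lra|].
    have /= := He (a + m); rewrite /ball/= opprD addrA subrr add0r normrN gtr0_norm//.
    move=> /(_ ltac:(lra)); rewrite ltr_norml => /andP[_].
    by lra.
  by move/ubS; rewrite -/a; lra.
Qed.

Lemma reparametrization_id : reparametrization id.
Proof. by split => // [t|u]; [exact: cvg_id|exists u]. Qed.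

Lemma reparametrization_comp s t :
  reparametrization s -> reparametrization t -> reparametrization (s \o t).
Proof.
move=> [cs ms ss] [ct mt st]; split.
- by move=> u; apply: continuous_comp; [exact: ct|exact: cs].
- by move=> u v uv; apply: ms; exact: mt.
- by move=> u; have [v <-] := ss u; have [w <-] := st v; exists w.
Qed.

Lemma reparametrization_pullback s t :
  reparametrization s -> reparametrization t ->
  exists s' t', [/\ reparametrization s', reparametrization t' &
    s \o s' = t \o t'].
Proof.
move=> /[dup] rs /reparametrization_ext[cf mf f0 f1].
move=> /[dup] rt /reparametrization_ext[cg mg g0 g1].
have [a [ma la a0 a2 aE]] := monotone_pullback cf cg mf mg f0 g0 f1 g1.
have ca : continuous a.
  apply: (@lip1_continuous _ 1) => // v w vw.
  by rewrite ger0_norm ?subr_ge0 ?ma// mul1r la.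
have c2 : continuous (fun u : R => 2 * u).
  by move=> u; apply: cvgM; [exact: cvg_cst|exact: cvg_id].
have ca2 : continuous (fun u : R => a (2 * u)).
  by move=> u; apply: (@continuous_comp R R R (fun u : R => 2 * u) a);
    [exact: c2|exact: ca].
exists (fun u => clamp (a (2 * set_val u))).
exists (fun u => clamp (2 * set_val u - a (2 * set_val u))); split.
- apply: (@reparametrization_clamp (fun u => a (2 * u))) => //.
  + by move=> v w vw; apply: ma; lra.
  + by rewrite mulr0.
  + by rewrite mulr1.
- apply: (@reparametrization_clamp (fun u => 2 * u - a (2 * u))).
  + by move=> u; apply: cvgB; [exact: c2|exact: ca2].
  + by move=> v w vw; have := la (2 * v) (2 * w); lra.
  + by rewrite mulr0 a0 subr0.
  + by rewrite mulr1 a2; lra.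
- apply/funext => u; apply: val_inj; rewrite -!set_valE; apply: aE.
  by have /andP[? ?] := set_val_unit u; lra.
Qed.

Definition variation (X : Type) (d : extended_distance R X)
    (g : R -> X) (a b : R) : \bar R :=
  ereal_sup [set v | exists N (t : nat -> R),
    [/\ forall j, (j < N)%N -> t j < t j.+1,
        forall j, (j <= N)%N -> a <= t j <= b &
        v = (\sum_(j < N) d (g (t j.+1)) (g (t j)))%E]].

Definition curve_length (X : Type) (d : extended_distance R X)
    (g : unit_itv -> X) : \bar R := variation d (g \o clamp) 0 1.

Definition rect_curve (X : topologicalType) (d : extended_distance R X) :
    set {compact-open, unit_itv -> X} :=
  [set g | continuous (g : unit_itv -> X) /\ (curve_length d g < +oo)%E].

Definition reparam_eq (X : topologicalType) (d : extended_distance R X) :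
    rel (rect_curve d) :=
  fun g g' => `[< exists s s', [/\ reparametrization s, reparametrization s' &
    (set_val g : unit_itv -> X) \o s = (set_val g' : unit_itv -> X) \o s'] >].

Lemma reparam_eq_refl (X : topologicalType) (d : extended_distance R X) :
  reflexive (@reparam_eq X d).
Proof.
by move=> g; apply/asboolP; exists id, id; split => //;
  exact: reparametrization_id.
Qed.

Lemma reparam_eq_sym (X : topologicalType) (d : extended_distance R X) :
  symmetric (@reparam_eq X d).
Proof.
by move=> g g'; apply/asboolP/asboolP => -[s [s' [? ? ?]]]; exists s', s.
Qed.

Lemma reparam_eq_trans (X : topologicalType) (d : extended_distance R X) :
  transitive (@reparam_eq X d).
Proof.
move=> g2 g1 g3 /asboolP[s [s' [rs rs' e]]] /asboolP[t [t' [rt rt' e']]].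
have [a [b [ra rb ab]]] := reparametrization_pullback rs' rt.
apply/asboolP; exists (s \o a), (t' \o b).
split; [exact: reparametrization_comp|exact: reparametrization_comp|].
rewrite -[LHS]/((set_val g1 \o s) \o a) e.
rewrite -[RHS]/((set_val g3 \o t') \o b) -e'.
by rewrite -[LHS]/(set_val g2 \o (s' \o a)) ab.
Qed.

Definition reparam_equiv (X : topologicalType) (d : extended_distance R X) :
    equiv_rel (rect_curve d) :=
  EquivRel (@reparam_eq X d) (@reparam_eq_refl X d) (@reparam_eq_sym X d)
    (@reparam_eq_trans X d).

End curves.


Definition rect_arc (R : realType) (X : topologicalType)
    (d : extended_distance R X) : Type :=
  quotient_topology {eq_quot (reparam_equiv d)}%qT.

HB.instance Definition _ (R : realType) (X : topologicalType)
  (d : extended_distance R X) := Topological.on (rect_arc d).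
HB.instance Definition _ (R : realType) (X : topologicalType)
  (d : extended_distance R X) := Quotient.on (rect_arc d).

Section pointed_arc.
Context {R : realType} {X : ptopologicalType} (d : extended_distance R X).

Lemma cst_curve_subproof :
  ((fun=> point) : {compact-open, unit_itv (R:=R) -> X}) \in rect_curve d.
Proof.
rewrite inE; split; first exact: cst_continuous.
apply: (@le_lt_trans _ _ 0%E); last exact: ltry.
apply: ge_ereal_sup => _ [N [t [_ _ ->]]].
by rewrite big1// => i _; apply/edist_eq0.
Qed.

Definition cst_arc : rect_arc d :=
  \pi_(rect_arc d)%qT (exist (fun g => g \in rect_curve d) _ cst_curve_subproof).

HB.instance Definition _ := isPointed.Build (rect_arc d) cst_arc.

End pointed_arc.

Section arcs.
Context {R : realType} {X : ptopologicalType} (d : extended_distance R X).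

Definition arc_length (c : rect_arc d) : \bar R :=
  curve_length d (set_val (repr c : rect_curve d)).

Definition curve_ext (g : rect_curve d) (t : R) : X := set_val g (clamp t).

Definition constant_speed (c : rect_arc d) : set (rect_curve d) :=
  [set g | [/\ \pi_(rect_arc d)%qT g = c,
    forall s t, 0 <= s <= 1 -> 0 <= t <= 1 ->
      (d (curve_ext g s) (curve_ext g t) <= arc_length c * `|s - t|%:E)%E &
    forall t, 0 <= t <= 1 ->
      variation d (curve_ext g) 0 t = (arc_length c * t%:E)%E]].

(* In an extended metric-topological space [constant_speed c] is a singleton, so
   the default [repr c] is never used. *)
Definition arc_param (c : rect_arc d) : R -> X :=
  curve_ext (xget (repr c) (constant_speed c)).

(* [\int] is total and, for a nonnegative integrand, is the lower integral over
   Borel simple functions; on Lebesgue-measurable integrands it is the usual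
   integral, even when they are not Borel. *)
Definition arc_integral (c : rect_arc d) (f : X -> \bar R) : \bar R :=
  (arc_length c * \int[lebesgue_measure]_(s in `[0%R, 1%R]) f (arc_param c s))%E.

Section barycenter.
Variables (q : R) (m : {finite_measure set (borel X) -> \bar R}).

Definition barycenter_density
    (pi : {finite_measure set (borel (rect_arc d)) -> \bar R}) : set (X -> R) :=
  [set h | h \in Lfun m q%:E /\
    forall f : borel X -> R, measurable_fun setT f ->
      (exists M : R, forall x, `|f x| <= M) ->
      (\int[pi]_c arc_integral c (EFin \o f) = \int[m]_x (f x * h x)%:E)%E].

Definition Bar (pi : {finite_measure set (borel (rect_arc d)) -> \bar R}) : \bar R :=
  if pselect (exists h, barycenter_density pi h) is left e
  then 'N[m]_q%:E[EFin \o projT1 (cid e)]%E else +oo%E.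

Record T_plan (pi : {finite_measure set (borel (rect_arc d)) -> \bar R}) : Prop := {
  T_plan_radon : radon pi ;
  T_plan_bar : (Bar pi < +oo)%E ;
  T_plan_marginal : forall i : bool, exists2 h, h \in Lfun m q%:E &
    forall A : set (borel X), measurable A ->
      pushforward pi (fun c => arc_param c i%:R : borel X) A =
      (\int[m]_(x in A) (h x)%:E)%E }.

Definition T_ae (P : rect_arc d -> Prop) : Prop :=
  forall pi : {finite_measure set (borel (rect_arc d)) -> \bar R}, T_plan pi ->
    {ae pi, forall c, P c}.

Record weak_upper_gradient (f : X -> R) (g : X -> \bar R) : Prop := {
  wug_ge0 : forall x, (0 <= g x)%E ;
  wug_measurable : @ae_measurable _ _ R (borel X) (\bar R) m g ;
  wug_ineq : T_ae (fun c =>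
    (`|f (arc_param c 1) - f (arc_param c 0)|%:E <= arc_integral c g < +oo)%E) }.

End barycenter.

Definition sobolev_version (f : X -> R) (c : rect_arc d) (F : R -> R) : Prop :=
  [/\ absolutely_continuous_on 0 1 F,
      {ae @lebesgue_measure R, forall t, 0 <= t <= 1 -> f (arc_param c t) = F t},
      F 0 = f (arc_param c 0) & F 1 = f (arc_param c 1)].

Definition strictly_sobolev (f : X -> R) (c : rect_arc d) : Prop :=
  exists F, sobolev_version f c F.

End arcs.

(* Main.v *)
From HB Require Import structures.
From mathcomp Require Import all_boot all_order all_algebra.
From mathcomp Require Import all_classical all_reals all_analysis.
From mathcomp Require Import measurable_realfun ring lra zify.
Require Import Defs.

(** The weak upper gradient inequality only compares the values of f at the two
ends of an arc; the point is to recover it on pieces of the arc.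

The class of plans that defines exceptional sets is stable under random
cutting. If pi is such a plan and t is uniform in [0, 1], independently of the
arc c, let pi' be the law of the piece of c before time t, or after it. One end
of the piece is an end of c, and the other one is the point of c at a uniform
time, whose law is controlled by the barycenter of pi divided by the length of
c; integrals along a piece are at most those along c. So the marginals and the
barycenter of pi' are dominated by functions in L^q, hence have densities in
L^q ([dominated_density]), and a property that holds for almost every arc holds
for almost all pieces of almost every arc ([T_ae_cut]). The length is only
lower semicontinuous on the space of arcs, so that neither the constant-speed
parametrization nor cutting is continuous; pi is therefore first restricted to
a compact set of arcs on which the length is continuous and bounded away from
zero. By Lusin's theorem such sets exhaust the arcs of positive length
([ae_of_regular_compact]). On them cutting is jointly continuous in the arc and
the time ([regular_cut]), so pi' is again a Radon measure ([radon_image]).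

Let R be the constant-speed parametrization of c, phi = f o R, and let Gamma be
the primitive of (length of c) * (g o R). Cutting initial pieces, final pieces,
and final pieces of initial pieces yields, for almost every c, that
|phi s - phi 0| <= Gamma s - Gamma 0 and |phi 1 - phi s| <= Gamma 1 - Gamma s
for almost every s, and |phi s - phi x| <= Gamma s - Gamma x for almost every s
and almost every x < s. Two good times s < t are compared through a common
third time x that tends to s from below; this gives
|phi t - phi s| <= Gamma t - Gamma s on a set of full measure that contains
0 and 1. The McShane extension F of phi from that set satisfies the same bound
everywhere, so F is absolutely continuous and is a version of phi.

Finally Gamma + F is nondecreasing and its Stieltjes measure is at most twice
that of Gamma, hence absolutely continuous; Lebesgue's differentiation theorem
makes F derivable almost everywhere, with |F'| <= Gamma' = (length of c) *
(g o R) ([controlled_derivable]). Any other absolutely continuous version agrees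
with F on [0, 1]. Throughout, g is replaced by a Borel version: as barycenters
have densities, almost every arc spends no time in a negligible set
([T_ae_avoid]). *)

Set Implicit Arguments.
Unset Strict Implicit.
Unset Printing Implicit Defensive.
Import Order.TTheory GRing.Theory Num.Theory.
Import numFieldNormedType.Exports.

Local Open Scope classical_set_scope.
Local Open Scope ring_scope.

(** * Variation of a map into an extended metric space *)

Section variation.
Context {R : realType} {X : Type} (d : extended_distance R X).
Implicit Types (g : R -> X) (a b c : R).

Definition partition_sum g (t : nat -> R) N : \bar R :=
  (\sum_(j < N) d (g (t j.+1)) (g (t j)))%E.

Lemma edistxx x : d x x = 0%E.
Proof. exact/edist_eq0. Qed.

(** Partitions with repeated points are easier to produce than the strictly
increasing ones of [variation]; repetitions contribute zero and are removed. *)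
Lemma weak_to_strict g a b t N :
  (forall j, (j < N)%N -> t j <= t j.+1) ->
  (forall j, (j <= N)%N -> a <= t j <= b) ->
  exists M (u : nat -> R),
    [/\ forall j, (j < M)%N -> u j < u j.+1,
        forall j, (j <= M)%N -> a <= u j <= b, u M = t N &
        partition_sum g t N = partition_sum g u M].
Proof.
elim: N => [|N IH] mt tab.
  exists 0%N, t; split => //.
have [M [u [su uab uM e]]] : exists M (u : nat -> R),
    [/\ forall j, (j < M)%N -> u j < u j.+1,
        forall j, (j <= M)%N -> a <= u j <= b, u M = t N &
        partition_sum g t N = partition_sum g u M].
  by apply: IH => j jN; [apply: mt|apply: tab]; rewrite ltnW.
have := mt N (ltnSn N); rewrite le_eqVlt => /orP[/eqP tN|tN].
  exists M, u; split => //; first by rewrite uM tN.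
  by rewrite /partition_sum big_ord_recr/= -tN edistxx adde0 -/(partition_sum g t N) e.
exists M.+1, (fun j => if (j <= M)%N then u j else t N.+1); split.
- move=> j; rewrite ltnS => jM; rewrite jM; case: ltnP => [/su//|Mj].
  have -> : j = M by apply/eqP; rewrite eqn_leq jM.
  by rewrite uM.
- move=> j jM; case: ifP => [/uab//|_]; exact: tab.
- by rewrite ltnn.
- rewrite /partition_sum !big_ord_recr/= leqnn ltnn -uM.
  rewrite -/(partition_sum g t N) e; congr (_ + _)%E.
  by apply: eq_bigr => i _; rewrite ltn_ord ltnW.
Qed.

Lemma partition_sum_le g a b t N :
  (forall j, (j < N)%N -> t j <= t j.+1) ->
  (forall j, (j <= N)%N -> a <= t j <= b) ->
  (partition_sum g t N <= variation d g a b)%E.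
Proof.
move=> mt tab; have [M [u [su uab _ ->]]] := weak_to_strict g mt tab.
by apply: ereal_sup_ubound; exists M, u.
Qed.

Lemma variation_le g a b x :
  (forall N t, (forall j, (j < N)%N -> t j <= t j.+1) ->
    (forall j, (j <= N)%N -> a <= t j <= b) -> (partition_sum g t N <= x)%E) ->
  a <= b -> (variation d g a b <= x)%E.
Proof.
move=> h ab; apply: ge_ereal_sup => _ [N [t [st tab ->]]].
by apply: h => // j jN; exact/ltW/st.
Qed.

Lemma partition_sum_ge0 g t N : (0 <= partition_sum g t N)%E.
Proof. by apply: sume_ge0 => i _; exact: edist_ge0. Qed.

Lemma variation_ge0 g a b : a <= b -> (0 <= variation d g a b)%E.
Proof.
move=> ab; apply: le_trans (@partition_sum_le g a b (fun=> a) 0 _ _) => //.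
  exact: partition_sum_ge0.
by move=> j _; rewrite lexx.
Qed.

Lemma edist_le_variation g a b : a <= b -> (d (g a) (g b) <= variation d g a b)%E.
Proof.
move=> ab; have := @partition_sum_le g a b (fun n => if n is 0%N then a else b) 1.
rewrite /partition_sum big_ord1/= edist_sym; apply.
- by case.
- by case => [|j] _; rewrite lexx ab.
Qed.

Lemma eq_variation g g' a b : (forall t, a <= t <= b -> g t = g' t) ->
  variation d g a b = variation d g' a b.
Proof.
move=> e; congr ereal_sup; apply/seteqP; split => v [N [t [st tab ->]]];
  exists N, t; split => //; apply: eq_bigr => j _.
- by rewrite !e// tab// ltnW.
- by rewrite !e// tab// ltnW.
Qed.

(** For the first inequality, a partition of [a, c] is clamped to [a, b] and to
[b, c]; the step that crosses b is handled by the triangle inequality. *)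
Lemma variationD g a b c : a <= b -> b <= c ->
  variation d g a c = (variation d g a b + variation d g b c)%E.
Proof.
move=> ab bc; have ac := le_trans ab bc.
apply/eqP; rewrite eq_le; apply/andP; split.
  apply: variation_le => // N t mt tac.
  pose s j := Num.min (t j) b; pose s' j := Num.max (t j) b.
  apply: (@le_trans _ _ (partition_sum g s N + partition_sum g s' N)%E); last first.
    apply: leeD; apply: partition_sum_le.
    - by move=> j jN; rewrite /s le_min2// mt.
    - by move=> j /tac /andP[? ?]; rewrite /s; case: (lerP (t j) b) => ?; lra.
    - by move=> j jN; rewrite /s' le_max2// mt.
    - by move=> j /tac /andP[? ?]; rewrite /s'; case: (lerP (t j) b) => ?; lra.
  rewrite /partition_sum -big_split/=; apply: lee_sum => -[j jN] _ /=.
  rewrite /s /s'; have := mt j jN.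
  case: (lerP (t j) b) => tj; case: (lerP (t j.+1) b) => tj1 tt.
  - by rewrite edistxx adde0.
  - by rewrite addeC edist_triangle.
  - by exfalso; lra.
  - by rewrite edistxx add0e.
have [/eqP->|] := boolP (variation d g a c == +oo%E); first by rewrite leey.
rewrite -ltey => fin.
have h N t N' t' : (forall j, (j < N)%N -> t j <= t j.+1) ->
    (forall j, (j <= N)%N -> a <= t j <= b) ->
    (forall j, (j < N')%N -> t' j <= t' j.+1) ->
    (forall j, (j <= N')%N -> b <= t' j <= c) ->
    (partition_sum g t N + partition_sum g t' N' <= variation d g a c)%E.
  move=> mt tab mt' tbc.
  pose u j := if (j <= N)%N then t j else t' (j - N.+1)%N.
  apply: (@le_trans _ _ (partition_sum g u (N.+1 + N'))); last first.
    apply: partition_sum_le => j jN.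
      rewrite /u; case: (leqP j N) => [jN'|Nj].
        rewrite ltn_neqAle jN' andbT; case: eqP => [->/=|].
          rewrite subnn; have /andP[_ +] := tab N (leqnn _).
          by have /andP[+ _] := tbc 0%N isT; lra.
        by move=> /eqP jn /=; apply: mt; rewrite ltn_neqAle jn.
      rewrite ltnNge (ltnW Nj)/= subSn//; apply: mt'.
      by rewrite -(ltn_add2l N.+1) subnKC.
    rewrite /u; case: (leqP j N) => [/tab|Nj]; first by lra.
    by have := tbc (j - N.+1)%N; rewrite leq_subLR jN => /(_ isT); lra.
  rewrite /partition_sum big_split_ord/= big_ord_recr/=.
  apply: leeD; last first.
    rewrite le_eqVlt; apply/orP; left; apply/eqP; apply: eq_bigr => j _ /=.
    rewrite /u; have -> : (N.+1 + j <= N)%N = false by lia.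
    have -> : (N.+1 + j < N)%N = false by lia.
    by congr (d (g (t' _)) (g (t' _))); lia.
  rewrite -[leLHS]adde0; apply: leeD; last exact: edist_ge0.
  rewrite le_eqVlt; apply/orP; left; apply/eqP; apply: eq_bigr => j _ /=.
  by rewrite /u ltn_ord ltnW.
have fin1 : (variation d g a b < +oo)%E.
  apply: le_lt_trans fin; apply: variation_le => // N t mt tab.
  have := h N t 0%N (fun=> c) mt tab.
  rewrite [X in (_ + X)%E]/partition_sum big_ord0 adde0; apply => // j _.
  by rewrite lexx bc.
have fn1 : variation d g a b \is a fin_num.
  by rewrite ge0_fin_numE// variation_ge0.
rewrite -leeBrDl//; apply: variation_le => // N' t' mt' t'bc.
have fs : partition_sum g t' N' \is a fin_num.
  rewrite ge0_fin_numE ?partition_sum_ge0//; apply: le_lt_trans fin.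
  have := h 0%N (fun=> a) N' t' _ _ mt' t'bc.
  rewrite [X in (X + _)%E]/partition_sum big_ord0 add0e; apply => // j _.
  by rewrite lexx ab.
rewrite leeBrDl// -leeBrDr//; apply: variation_le => // N t mt tab.
by rewrite leeBrDr//; exact: h.
Qed.

Lemma le_variation g a b a' b' : a <= b -> a' <= a -> b <= b' ->
  (variation d g a b <= variation d g a' b')%E.
Proof.
move=> ab aa bb.
rewrite (variationD g aa (le_trans ab bb)) (variationD g ab bb).
rewrite addeCA leeDl// adde_ge0// variation_ge0//.
Qed.

Lemma variation_comp_le g (h : R -> R) a b : a <= b ->
  (forall s t, a <= s -> s <= t -> t <= b -> h s <= h t) ->
  (variation d (g \o h) a b <= variation d g (h a) (h b))%E.
Proof.
move=> ab mh; apply: variation_le => // N t mt tab.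
apply: (@partition_sum_le g _ _ (h \o t)).
- move=> j jN /=; have /andP[] := tab j (ltnW jN); have /andP[] := tab j.+1 jN.
  by move=> ? ? ? ?; apply: mh => //; exact: mt.
- by move=> j /tab/andP[ta tb] /=; rewrite !mh.
Qed.

(** By the intermediate value theorem every partition of [h a, h b] is the image
of a partition of [a, b]. *)
Lemma variation_comp g (h : R -> R) a b : a <= b -> continuous h ->
  (forall s t, a <= s -> s <= t -> t <= b -> h s <= h t) ->
  variation d (g \o h) a b = variation d g (h a) (h b).
Proof.
move=> ab ch mh; apply/eqP; rewrite eq_le variation_comp_le//=.
have hab : h a <= h b by apply: mh.
apply: ge_ereal_sup => _ [N [t [st tab ->]]].
have /choice[u hu] j : exists u, (j <= N)%N -> a <= u <= b /\ h u = t j.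
  have [jN|jN] := leqP j N; last by exists 0.
  have [|u /[!in_itv]/= uab hu] := @IVT _ h a b (t j) ab (continuous_subspaceT ch).
    by rewrite (min_idPl hab) (max_idPr hab); exact: tab.
  by exists u.
apply: le_trans (@partition_sum_le (g \o h) _ _ u N _ _).
- rewrite /partition_sum le_eqVlt; apply/orP; left; apply/eqP.
  by apply: eq_bigr => j _ /=; rewrite !(hu _ _).2// ltnW.
- move=> j jN; rewrite leNgt; apply/negP => uu.
  have := st _ jN; rewrite ltNge -(hu _ jN).2 -(hu _ (ltnW jN)).2 => /negP; apply.
  have [/andP[? ?] _] := hu _ jN; have [/andP[? ?] _] := hu _ (ltnW jN).
  by apply: mh => //; exact: ltW.
- by move=> j jN; exact: (hu _ jN).1.
Qed.

Lemma variationxx g a : variation d g a a = 0%E.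
Proof.
apply/eqP; rewrite eq_le variation_ge0// andbT; apply: variation_le => // N t _ ta.
rewrite /partition_sum big1// => -[j jN] _ /=.
have tE i : (i <= N)%N -> t i = a by move/ta => /andP[? ?]; apply/le_anti/andP.
by rewrite !tE ?edistxx// ltnW.
Qed.

End variation.

Section lsc.
Context {R : realType} {X : topologicalType} (d : extended_distance R X).
Hypothesis emt : emt_space d.

(** The distance is a supremum of differences of continuous functions. *)
Lemma edist_lsc (I : Type) (F : set_system I) (FF : Filter F) (u v : I -> X)
    (x y : X) (c : R) : u @ F --> x -> v @ F --> y -> (c%:E < d x y)%E ->
  \forall i \near F, (c%:E < d (u i) (v i))%E.
Proof.
move=> ux vy; rewrite (emt_dist emt) => /ereal_sup_gt[_ [f [Lf hf] <-]].
rewrite lte_fin => cf.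
have cf0 : continuous f by case: Lf.
have : (fun i => `|f (u i) - f (v i)|) @ F --> `|f x - f y|.
  apply: cvg_norm; apply: cvgB.
    by apply: (cvg_comp u f ux); exact: cf0.
  by apply: (cvg_comp v f vy); exact: cf0.
move=> /cvgr_gt/(_ _ cf); apply: filterS => i ci.
by apply: lt_le_trans (hf _ _); rewrite lte_fin.
Qed.

Lemma lte_add_split (x y : \bar R) (c : R) : (0 <= x)%E -> (0 <= y)%E ->
  (c%:E < x + y)%E -> exists c1 c2 : R, [/\ (c1%:E < x)%E, (c2%:E < y)%E & c <= c1 + c2].
Proof.
case: x => [x| |]//; case: y => [y| |]// x0 y0.
- rewrite -EFinD lte_fin => cxy; exists (x - (x + y - c) / 2), (y - (x + y - c) / 2).
  by split; rewrite ?lte_fin; lra.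
- by move=> _; exists (x - 1), (c - (x - 1)); rewrite !lte_fin ltry; split => //; lra.
- by move=> _; exists (c - (y - 1)), (y - 1); rewrite !lte_fin ltry; split => //; lra.
- by move=> _; exists c, 0; rewrite !ltry addr0.
Qed.

(** Pointwise convergence suffices, since each partition sum involves finitely
many points. *)
Lemma variation_lsc (I : Type) (F : set_system I) (FF : Filter F)
    (w : I -> R -> X) (u : R -> X) (a b c : R) :
  (forall t, a <= t <= b -> w^~ t @ F --> u t) -> (c%:E < variation d u a b)%E ->
  \forall i \near F, (c%:E < variation d (w i) a b)%E.
Proof.
move=> wu /ereal_sup_gt[_ [N [t [st tab ->]]]].
rewrite -/(partition_sum d u t N) => cN.
suff : \forall i \near F, (c%:E < partition_sum d (w i) t N)%E.
  apply: filterS => i /lt_le_trans; apply; apply: ereal_sup_ubound.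
  by exists N, t.
elim: N c st tab cN => [|N IH] c st tab.
  by rewrite /partition_sum big_ord0 => c0; apply: nearW => i; rewrite big_ord0.
rewrite /partition_sum big_ord_recr/=.
move=> /(lte_add_split (partition_sum_ge0 d u t N) (edist_ge0 _ _ _)).
move=> [c1 [c2 [h1 h2 cc]]].
have : \forall i \near F, (c1%:E < partition_sum d (w i) t N)%E.
  apply: IH => // j jN; [by apply: st; exact: ltnW|by apply: tab; exact: ltnW].
have := @edist_lsc _ F FF (w^~ (t N.+1)) (w^~ (t N)) _ _ c2
  (wu _ (tab _ (leqnn _))) (wu _ (tab _ (leqnSn _))) h2.
apply: filterS2 => i i2 i1; rewrite big_ord_recr/=.
by apply: le_lt_trans (lteD i1 i2); rewrite -EFinD lee_fin.
Qed.

End lsc.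

(** * Curves, arcs and their arclength *)

Section reparam.
Context {R : realType}.

(** A reparametrization extended by constants outside [0, 1]: working with total
functions on the line avoids the subtype of the unit interval. *)
Definition reparam (h : R -> R) :=
  [/\ continuous h, {homo h : s t / s <= t},
     forall t, t <= 0 -> h t = 0 & forall t, 1 <= t -> h t = 1].

Lemma reparam01 h t : reparam h -> 0 <= h t <= 1.
Proof.
move=> [ch mh h0 h1]; have [t0|/ltW t0] := leP t 0; first by rewrite h0// lexx ler01.
have [t1|/ltW t1] := leP 1 t; first by rewrite h1// lexx ler01.
by have := mh _ _ t0; have := mh _ _ t1; rewrite (h1 1)// (h0 0)// => -> ->.
Qed.

Definition clampR (t : R) : R := set_val (clamp t).

Lemma clampR01 t : 0 <= clampR t <= 1.
Proof. exact: set_val_unit. Qed.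

Lemma clampRE t : 0 <= t <= 1 -> clampR t = t.
Proof. exact: clampE. Qed.

Lemma clampR_continuous : continuous clampR.
Proof.
move=> t; apply: (@continuous_comp _ _ _ clamp set_val).
  exact: clamp_continuous.
exact: initial_continuous.
Qed.

Lemma clampR_homo : {homo clampR : s t / s <= t}.
Proof. by move=> s t; exact: clamp_le. Qed.

Lemma clampRle0 t : t <= 0 -> clampR t = 0.
Proof. by move=> t0; rewrite /clampR clamp_le0// clampE// lexx ler01. Qed.

Lemma clampRge1 t : 1 <= t -> clampR t = 1.
Proof. by move=> t0; rewrite /clampR clamp_ge1// clampE// lexx ler01. Qed.

Lemma reparam_clampR : reparam clampR.
Proof.
split; [exact: clampR_continuous|exact: clampR_homo|exact: clampRle0|exact: clampRge1].
Qed.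

Lemma reparam_clamp (h : R -> R) : {within `[0, 1], continuous h} ->
  (forall s t, 0 <= s -> s <= t -> t <= 1 -> h s <= h t) -> h 0 = 0 -> h 1 = 1 ->
  reparam (h \o clampR).
Proof.
move=> ch mh h0 h1; split.
- move=> t; have := ch; move/(subspace_sigL_continuousP).
  move=> /(_ (clamp t)) cs; apply: (@continuous_comp _ _ _ clamp (sigL _ h)) cs.
  exact: clamp_continuous.
- move=> s t st /=; have /andP[? ?] := clampR01 s; have /andP[? ?] := clampR01 t.
  by apply: mh => //; exact: clampR_homo.
- by move=> t t0 /=; rewrite clampRle0.
- by move=> t t0 /=; rewrite clampRge1.
Qed.

End reparam.

Section curves.
Context {R : realType} {X : ptopologicalType} (d : extended_distance R X).
Local Notation C := (rect_curve d).
Local Notation RA := (rect_arc d).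
Implicit Types (g : C).

Lemma curve_in g : rect_curve d (set_val g).
Proof. by rewrite set_valE; apply: set_mem; exact: (valP g). Qed.

Lemma curve_ext_clamp g t : curve_ext g t = curve_ext g (clampR t).
Proof. by rewrite /curve_ext /clampR clampK. Qed.

Lemma curve_ext_continuous g : continuous (curve_ext g).
Proof.
move=> t; apply: (@continuous_comp _ _ _ clamp (set_val g : unit_itv -> X)).
  exact: clamp_continuous.
by have [+ _] := curve_in g; apply.
Qed.

Lemma curve_ext_length g : (variation d (curve_ext g) 0 1 < +oo)%E.
Proof. by have [_ +] := curve_in g. Qed.

Lemma curve_lengthE g : curve_length d (set_val g) = variation d (curve_ext g) 0 1.
Proof. by []. Qed.

(** The type annotation selects the compact-open topology. *)
Definition mkcurve_fun (u : R -> X) : {compact-open, unit_itv (R:=R) -> X} :=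
  u \o set_val.

Lemma mkcurve_subproof (u : R -> X) : continuous u ->
  (variation d u 0 1 < +oo)%E -> mkcurve_fun u \in rect_curve d.
Proof.
move=> cu fu; rewrite inE; split.
  move=> t; apply: (@continuous_comp _ _ _ set_val u); last exact: cu.
  exact: initial_continuous.
apply: le_lt_trans fu; rewrite /curve_length le_eqVlt; apply/orP; left; apply/eqP.
by apply: eq_variation => t t01; rewrite /mkcurve_fun/= clampE.
Qed.

Definition mkcurve (u : R -> X) (cu : continuous u)
    (fu : (variation d u 0 1 < +oo)%E) : C :=
  exist (fun w => w \in rect_curve d) _ (mkcurve_subproof cu fu).

Lemma mkcurveE u cu fu t : curve_ext (@mkcurve u cu fu) t = u (clampR t).
Proof. by rewrite /curve_ext /mkcurve/= set_valE/=. Qed.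

(** The time changes that select a portion of a curve; [reparam] is the case in
which the portion is everything. *)
Definition into01 (h : R -> R) :=
  [/\ continuous h, {homo h : s t / s <= t} , 0 <= h 0 & h 1 <= 1].

Lemma recurve_fin g h : into01 h -> (variation d (curve_ext g \o h) 0 1 < +oo)%E.
Proof.
move=> [ch mh h0 h1]; apply: le_lt_trans (curve_ext_length g).
apply: le_trans (variation_comp_le _ _ _ _) _ => //.
  by move=> *; exact: mh.
by apply: le_variation => //; exact: mh.
Qed.

Lemma recurve_cont g h : into01 h -> continuous (curve_ext g \o h).
Proof.
move=> [ch _ _ _] t; apply: continuous_comp; [exact: ch|exact: curve_ext_continuous].
Qed.

Definition recurve g h (ok : into01 h) : C :=
  mkcurve (@recurve_cont g h ok) (@recurve_fin g h ok).

Lemma recurveE g h ok t : curve_ext (@recurve g h ok) t = curve_ext g (h (clampR t)).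
Proof. by rewrite /recurve mkcurveE. Qed.

Lemma reparam_into01 h : reparam h -> into01 h.
Proof. by case=> ch mh h0 h1; split=> //; [rewrite h0|rewrite h1]. Qed.

Definition arc_of g : RA := \pi_(rect_arc d)%qT g.

Lemma arc_ofP g g' : arc_of g = arc_of g' <->
  exists h h', [/\ reparam h, reparam h' & curve_ext g \o h = curve_ext g' \o h'].
Proof.
split.
  move=> /eqmodP /asboolP[s [s' [rs rs' e]]].
  exists (fun t => set_val (s (clamp t))), (fun t => set_val (s' (clamp t))).
  split; [exact: reparametrization_ext|exact: reparametrization_ext|].
  apply/funext => t /=; rewrite /curve_ext !clampK.
  by have := congr1 (fun F => F (clamp t)) e.
move=> [h [h' [rh rh' e]]]; apply/eqmodP/asboolP.
exists (fun u => clamp (h (set_val u))), (fun u => clamp (h' (set_val u))); split.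
- by case: rh => ch mh h0 h1; apply: reparametrization_clamp => //; [exact: h0|exact: h1].
- by case: rh' => ch mh h0 h1; apply: reparametrization_clamp => //; [exact: h0|exact: h1].
- apply/funext => u /=; have := congr1 (fun F => F (set_val u)) e.
  by rewrite /= /curve_ext.
Qed.

Lemma arc_of_recurve g h ok : reparam h -> arc_of (@recurve g h ok) = arc_of g.
Proof.
move=> rh; apply/arc_ofP; exists clampR, h; split=> //; first exact: reparam_clampR.
apply/funext => t /=; rewrite recurveE clampRE ?clampR01//.
case: rh => _ _ h0 h1; have [t0|/ltW t0] := leP t 0; first by rewrite clampRle0// !h0.
have [t1|/ltW t1] := leP 1 t; first by rewrite clampRge1// !h1.
by rewrite clampRE// t0.
Qed.

Lemma arc_surj (c : RA) : exists g, arc_of g = c.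
Proof. by exists (repr c); rewrite /arc_of reprK. Qed.

Lemma variation_reparam g h s t : reparam h -> s <= t ->
  variation d (curve_ext g \o h) s t = variation d (curve_ext g) (h s) (h t).
Proof. by move=> [ch mh _ _] st; apply: variation_comp => // *; exact: mh. Qed.

Lemma arc_length_of g : arc_length (arc_of g) = variation d (curve_ext g) 0 1.
Proof.
rewrite /arc_length curve_lengthE.
have : arc_of (repr (arc_of g)) = arc_of g by rewrite /arc_of reprK.
move=> /arc_ofP[h [h' [rh rh' e]]].
have := variation_reparam (repr (arc_of g)) rh ler01.
rewrite e variation_reparam//.
by case: rh => _ _ -> // -> //; case: rh' => _ _ -> // -> // ->.
Qed.

Lemma arc_length_lty (c : RA) : (arc_length c < +oo)%E.
Proof. by have [g <-] := arc_surj c; rewrite arc_length_of curve_ext_length. Qed.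

Lemma arc_length_ge0 (c : RA) : (0 <= arc_length c)%E.
Proof. by have [g <-] := arc_surj c; rewrite arc_length_of variation_ge0. Qed.

Lemma arc_length_fin (c : RA) : arc_length c \is a fin_num.
Proof. by rewrite ge0_fin_numE ?arc_length_ge0 ?arc_length_lty. Qed.

Definition len (c : RA) : R := fine (arc_length c).

Lemma lenE (c : RA) : arc_length c = (len c)%:E.
Proof. by rewrite fineK// arc_length_fin. Qed.

Lemma len_ge0 (c : RA) : 0 <= len c.
Proof. by rewrite -lee_fin -lenE arc_length_ge0. Qed.

Definition vlen g (s t : R) : R := fine (variation d (curve_ext g) s t).

Lemma vlenE g s t : 0 <= s -> s <= t -> t <= 1 ->
  variation d (curve_ext g) s t = (vlen g s t)%:E.
Proof.
move=> s0 st t1; rewrite fineK// ge0_fin_numE ?variation_ge0//.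
by apply: le_lt_trans (curve_ext_length g); exact: le_variation.
Qed.

Lemma vlen_ge0 g s t : s <= t -> 0 <= vlen g s t.
Proof. by move=> st; rewrite fine_ge0// variation_ge0. Qed.

Lemma vlenD g s t u : 0 <= s -> s <= t -> t <= u -> u <= 1 ->
  vlen g s u = vlen g s t + vlen g t u.
Proof.
move=> s0 st tu u1; apply: EFin_inj; rewrite EFinD -!vlenE//.
- exact: variationD.
- exact: le_trans s0 st.
- exact: le_trans tu u1.
- exact: le_trans st tu.
Qed.

Lemma vlenxx g s : vlen g s s = 0.
Proof. by rewrite /vlen variationxx. Qed.

Lemma len_vlen g : len (arc_of g) = vlen g 0 1.
Proof. by rewrite /len arc_length_of. Qed.

Lemma vlen0_eq g s t : 0 <= s -> s <= t -> t <= 1 -> vlen g s t = 0 ->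
  curve_ext g s = curve_ext g t.
Proof.
move=> s0 st t1 v0; apply/(edist_eq0 d)/eqP; rewrite eq_le edist_ge0 andbT.
by apply: le_trans (edist_le_variation _ _ st) _; rewrite vlenE// v0.
Qed.

Hypothesis emt : emt_space d.

Lemma vlen_lsc_curve (F : set_system C) (FF : Filter F) (g : C) (s t c : R) :
  (forall u, s <= u <= t -> (fun w => curve_ext w u) @ F --> curve_ext g u) ->
  0 <= s -> s <= t -> t <= 1 -> c < vlen g s t ->
  \forall g' \near F, c < vlen g' s t.
Proof.
move=> h s0 st t1; rewrite -lte_fin -vlenE// => cc.
have := variation_lsc emt FF h cc.
by apply: filterS => g'; rewrite vlenE// lte_fin.
Qed.

(** Semicontinuity in time is deduced from semicontinuity in the curve, by letting
the curve stop at time s and s tend to t. *)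
Lemma vlen_lsc_r g (t c : R) : 0 <= t <= 1 -> c < vlen g 0 t ->
  \forall s \near t, 0 <= s <= 1 -> c < vlen g 0 s.
Proof.
move=> /andP[t0 t1]; rewrite -lte_fin -vlenE// => cc.
have H u : 0 <= u <= t ->
    (fun s => (curve_ext g \o Num.min s) u) @ nbhs t --> curve_ext g u.
  move=> /andP[u0 ut].
  have : (fun s : R => Num.min s u) s @[s --> t] --> Num.min t u.
    by apply: continuous_min; [exact: cvg_id|exact: cvg_cst].
  rewrite (min_idPr ut) => hm.
  by apply: (cvg_comp (fun s : R => Num.min s u) (curve_ext g) hm); exact: curve_ext_continuous.
have := variation_lsc emt (nbhs_filter t) H cc.
apply: filterS => s /= h /andP[s0 s1].
rewrite -lte_fin -vlenE//; apply: lt_le_trans h _.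
have [st|/ltW ts] := leP s t.
  rewrite (variationD _ _ s0 st).
  rewrite [X in (_ + X)%E](_ : _ = 0%E) ?adde0.
    apply: le_trans (variation_comp_le _ _ s0 _) _.
      by move=> a b a0 ab bs; rewrite le_min2.
    by rewrite (min_idPr s0) minxx.
  apply/eqP; rewrite eq_le variation_ge0// andbT.
  apply: le_trans (variation_comp_le _ _ st _) _.
    by move=> a b a0 ab bs; rewrite le_min2.
  by rewrite minxx (min_idPl st) variationxx.
apply: le_trans (variation_comp_le _ _ t0 _) _.
  by move=> a b a0 ab bs; rewrite le_min2.
rewrite (min_idPr s0) (min_idPr ts); exact: le_variation.
Qed.

Lemma vlen_lsc_l g (t c : R) : 0 <= t <= 1 -> c < vlen g t 1 ->
  \forall s \near t, 0 <= s <= 1 -> c < vlen g s 1.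
Proof.
move=> /andP[t0 t1]; rewrite -lte_fin -vlenE// => cc.
have H u : t <= u <= 1 ->
    (fun s => (curve_ext g \o Num.max s) u) @ nbhs t --> curve_ext g u.
  move=> /andP[u0 ut].
  have : (fun s : R => Num.max s u) s @[s --> t] --> Num.max t u.
    by apply: continuous_max; [exact: cvg_id|exact: cvg_cst].
  rewrite (max_idPr u0) => hm.
  by apply: (cvg_comp (fun s : R => Num.max s u) (curve_ext g) hm); exact: curve_ext_continuous.
have := variation_lsc emt (nbhs_filter t) H cc.
apply: filterS => s /= h /andP[s0 s1].
rewrite -lte_fin -vlenE//; apply: lt_le_trans h _.
have [st|/ltW ts] := leP t s.
  rewrite (variationD _ _ st s1).
  rewrite [X in (X + _)%E](_ : _ = 0%E) ?add0e.
    apply: le_trans (variation_comp_le _ _ s1 _) _.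
      by move=> a b a0 ab bs; rewrite le_max2.
    by rewrite (max_idPr s1) maxxx.
  apply/eqP; rewrite eq_le variation_ge0// andbT.
  apply: le_trans (variation_comp_le _ _ st _) _.
    by move=> a b a0 ab bs; rewrite le_max2.
  by rewrite maxxx (max_idPl st) variationxx.
apply: le_trans (variation_comp_le _ _ t1 _) _.
  by move=> a b a0 ab bs; rewrite le_max2.
rewrite (max_idPr s1) (max_idPr ts); exact: le_variation.
Qed.

Let abs_aux (a b c1 c2 v e : R) : b - e < a -> c2 - e < c1 -> v = b + c2 ->
  v = a + c1 -> `|b - a| < e.
Proof. by move=> l1 l2 h1 h2; rewrite ltr_norml; apply/andP; split; lra. Qed.

(** The lengths before and after time t are both lower semicontinuous in t and
their sum is constant, so both are continuous. *)
Lemma vlen_continuous g : {within `[0, 1], continuous (vlen g 0)}.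
Proof.
apply/subspace_continuousP => t /=; rewrite in_itv/= => /[dup] t01 /andP[t0 t1].
apply/cvgrPdist_lt => e e0.
have lo : vlen g 0 t - e < vlen g 0 t by lra.
have hi : vlen g t 1 - e < vlen g t 1 by lra.
near=> s.
have s01 : 0 <= s <= 1.
  by have : (`[0, 1]%classic : set R) s by near: s; exact: withinT; rewrite /= in_itv.
have /andP[s0 s1] := s01.
have l1 : vlen g 0 t - e < vlen g 0 s.
  move: s01; near: s; rewrite near_withinE.
  by have := vlen_lsc_r t01 lo; apply: filterS => s h _ /h.
have l2 : vlen g t 1 - e < vlen g s 1.
  move: s01; near: s; rewrite near_withinE.
  by have := vlen_lsc_l t01 hi; apply: filterS => s h _ /h.
exact: (abs_aux l1 l2 (vlenD g (lexx 0) t0 t1 (lexx 1)) (vlenD g (lexx 0) s0 s1 (lexx 1))).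
Unshelve. all: by end_near. Qed.

End curves.

(** * The constant-speed parametrization, and subarcs *)

Section constant_speed.
Context {R : realType} {X : ptopologicalType} (d : extended_distance R X).
Local Notation C := (rect_curve d).
Local Notation RA := (rect_arc d).
Implicit Types (g : C) (c : RA).
Hypothesis emt : emt_space d.

Lemma vlen_mono g s t : 0 <= s -> s <= t -> t <= 1 -> vlen g 0 s <= vlen g 0 t.
Proof.
by move=> s0 st t1; rewrite (vlenD g (lexx 0) s0 st t1) lerDl vlen_ge0.
Qed.

Lemma curve_ext_eq_vlen g s t : 0 <= s <= 1 -> 0 <= t <= 1 ->
  vlen g 0 s = vlen g 0 t -> curve_ext g s = curve_ext g t.
Proof.
wlog st : s t / s <= t.
  move=> H s01 t01 e; have [/H|/ltW/H h] := leP s t; first by apply.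
  exact/esym/h.
move=> /andP[s0 s1] /andP[t0 t1] e; apply: vlen0_eq => //.
by apply: (@addrI _ (vlen g 0 s)); rewrite -(vlenD g (lexx 0) s0 st t1) addr0.
Qed.

(** The curve is composed with a right inverse tau of its normalized arclength V.
Although tau may jump, the composite r is continuous: the curve is constant on
the fibres of V, so the preimage by r of a closed set is the image by V of a
compact set. *)
Lemma constant_speed_nonempty c : constant_speed c !=set0.
Proof.
have [g gc] := arc_surj c.
have lE : len c = vlen g 0 1 by rewrite -gc len_vlen.
have := len_ge0 c; rewrite le_eqVlt => /orP[/eqP l0|l0].
  have v0 s t : 0 <= s -> s <= t -> t <= 1 -> vlen g s t = 0.
    move=> s0 st t1; apply/eqP; rewrite eq_le vlen_ge0// andbT.
    have := vlenD g (lexx 0) s0 (le_trans st t1) (lexx 1).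
    rewrite (vlenD g s0 st t1 (lexx 1)) -lE -l0.
    by have := vlen_ge0 g s0; have := vlen_ge0 g t1; lra.
  exists g; split => //.
    move=> s t s01 t01; rewrite lenE -l0 mul0e (@curve_ext_eq_vlen g s t)//.
      by rewrite edistxx.
    by case/andP: s01 => *; case/andP: t01 => *; rewrite !v0.
  by move=> t /andP[t0 t1]; rewrite lenE -l0 mul0e vlenE// v0.
pose V t := vlen g 0 t / len c.
have cV : {within `[0, 1], continuous V}.
  move=> t; apply: (@cvgM _ _ _ _ (vlen g 0 : subspace `[0,1]%classic -> R) (cst (len c)^-1)).
    exact: vlen_continuous.
  exact: cvg_cst.
have V0 : V 0 = 0 by rewrite /V vlenxx mul0r.
have V1 : V 1 = 1 by rewrite /V -lE divff// gt_eqF.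
have mV s t : 0 <= s -> s <= t -> t <= 1 -> V s <= V t.
  by move=> s0 st t1; rewrite ler_pM2r ?invr_gt0//; exact: vlen_mono.
have rV : reparam (V \o clampR) by exact: reparam_clamp.
have /choice[tau htau] s : exists t, 0 <= s <= 1 -> 0 <= t <= 1 /\ V t = s.
  have [s01|/negP s01] := boolP (0 <= s <= 1); last by exists 0.
  have [|t /[!in_itv]/= t01 Vt] := IVT ler01 cV (v := s).
    by rewrite V0 V1 (min_idPl ler01) (max_idPr ler01).
  by exists t.
pose r s := curve_ext g (tau (clampR s)).
have rVE t : 0 <= t <= 1 -> r (V t) = curve_ext g t.
  move=> t01; rewrite /r.
  have Vt01 : 0 <= V t <= 1.
    by case/andP: t01 => t0 t1; have := mV _ _ (lexx 0) t0 t1;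
      have := mV _ _ t0 t1 (lexx 1); rewrite V0 V1 => -> ->.
  rewrite clampRE//; have [t'01 e] := htau _ Vt01.
  apply: curve_ext_eq_vlen => //; apply: (@mulIf _ (len c)^-1) => //.
  by rewrite invr_eq0 gt_eqF.
have cr : continuous r.
  apply/continuous_closedP => F cF.
  (* The closed set V ([0, 1] `&` g^-1 F) determines r^-1 F since g factors
     through V. *)
  have -> : r @^-1` F = clampR @^-1` (V @` (`[0, 1] `&` curve_ext g @^-1` F)).
    apply/seteqP; split => s /=.
      move=> Fs; have [t01 e] := htau _ (clampR01 s).
      by exists (tau (clampR s)) => //; split => //; rewrite /= in_itv.
    move=> [t [/[!in_itv]/= t01 Ft] Vt]; rewrite /r.
    have [t'01 e] := htau _ (clampR01 s).
    rewrite (@curve_ext_eq_vlen g _ t)//; apply: (@mulIf _ (len c)^-1).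
      by rewrite invr_eq0 gt_eqF.
    by rewrite -/(V _) e -Vt.
  apply: (continuous_closedP _).1; first exact: clampR_continuous.
  apply: compact_closed; first exact: Rhausdorff.
  apply: continuous_compact.
    by apply: continuous_subspaceW cV => ? [].
  apply: compact_closedI; first exact: segment_compact.
  by apply: (continuous_closedP _).1 cF; exact: curve_ext_continuous.
have var_r t : 0 <= t <= 1 -> variation d r 0 t = (len c * t)%:E.
  move=> /[dup] t01 /htau[a01 Va]; set a := tau t in a01 Va.
  have /andP[a0 a1] := a01.
  have [csig msig sig0 sig1] := rV.
  have := @variation_comp _ _ d r (V \o clampR) 0 a a0 csig.
  rewrite sig0// /= clampRE// Va => <-; last by move=> *; exact: msig.
  rewrite (@eq_variation _ _ d _ (curve_ext g)) => [|u /andP[u0 ua]].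
    rewrite vlenE//; congr EFin; apply: (@mulIf _ (len c)^-1).
      by rewrite invr_eq0 gt_eqF.
    by rewrite -/(V _) Va mulrAC divff ?mul1r// gt_eqF.
  have u01 : 0 <= u <= 1 by rewrite u0 (le_trans ua a1).
  by rewrite /= clampRE// rVE.
have fr : (variation d r 0 1 < +oo)%E by rewrite var_r ?ltry// ler01 lexx.
have rE t : 0 <= t <= 1 -> curve_ext (mkcurve cr fr) t = r t.
  by move=> t01; rewrite mkcurveE clampRE.
exists (mkcurve cr fr); split.
- rewrite -gc; apply/arc_ofP; exists (V \o clampR), clampR; split=> //.
    exact: reparam_clampR.
  apply/funext => t /=; rewrite rE ?rVE ?clampR01//.
  exact: (reparam01 t rV).
- move=> s t; wlog st : s t / s <= t.
    move=> H s01 t01; have [|/ltW] := leP s t; first by move=> /H; apply.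
    by rewrite edist_sym distrC => /H; apply.
  move=> /[dup] s01 /andP[s0 s1] /[dup] t01 /andP[t0 t1].
  rewrite !rE//; apply: le_trans (edist_le_variation _ _ st) _.
  have fs : variation d r 0 s \is a fin_num by rewrite var_r.
  rewrite -(leeD2lE _ _ fs) -variationD// !var_r// lenE -EFinM -EFinD lee_fin.
  by rewrite distrC ger0_norm ?subr_ge0//; lra.
- move=> t t01; rewrite (@eq_variation _ _ d _ r) ?var_r ?lenE//.
  by move=> s /andP[s0 st]; rewrite rE// s0 (le_trans st)//; case/andP: t01.
Qed.

Definition speed_curve c : C := xget (repr c) (constant_speed c).

Lemma speed_curveP c : constant_speed c (speed_curve c).
Proof.
have [g gc] := constant_speed_nonempty c.
by rewrite /speed_curve; case: xgetP => // /(_ g).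
Qed.

Lemma arc_of_speed_curve c : arc_of (speed_curve c) = c.
Proof. by have [] := speed_curveP c. Qed.

Lemma vlen_speed_curve c s t : 0 <= s -> s <= t -> t <= 1 ->
  vlen (speed_curve c) s t = len c * (t - s).
Proof.
have [_ _ h] := speed_curveP c => s0 st t1.
have v0 u : 0 <= u <= 1 -> vlen (speed_curve c) 0 u = len c * u.
  move=> u01; have := h _ u01; case/andP: u01 => u0 u1.
    by rewrite vlenE// lenE -EFinM => -[].
have := vlenD (speed_curve c) (lexx 0) s0 st t1; rewrite !v0.
- by lra.
- by rewrite s0 (le_trans st).
- by rewrite t1 (le_trans s0).
Qed.

Lemma arc_param_continuous c : continuous (arc_param c).
Proof. exact: curve_ext_continuous. Qed.

Lemma arc_param_clamp c t : arc_param c t = arc_param c (clampR t).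
Proof. exact: curve_ext_clamp. Qed.

Lemma arc_param_const c s t : len c = 0 -> arc_param c s = arc_param c t.
Proof.
move=> l0; rewrite arc_param_clamp [RHS]arc_param_clamp.
apply: curve_ext_eq_vlen; rewrite ?clampR01//.
have /andP[s0 s1] := clampR01 s; have /andP[t0 t1] := clampR01 t.
by rewrite !vlen_speed_curve// l0 !mul0r.
Qed.

(** Every representative of an arc runs along the constant-speed one at the rate
given by its normalized arclength. *)
Lemma arc_param_factor g : exists sigma, [/\ reparam sigma,
  curve_ext g = arc_param (arc_of g) \o sigma &
  forall t, 0 <= t <= 1 -> vlen g 0 t = len (arc_of g) * sigma t].
Proof.
set c := arc_of g.
have : arc_of g = arc_of (speed_curve c) by rewrite arc_of_speed_curve.
move=> /arc_ofP[h [h' [rh rh' e]]].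
have [ch mh h0 h1] := rh; have [ch' mh' h'0 h'1] := rh'.
have key t : 0 <= t <= 1 -> vlen g 0 (h t) = len c * h' t.
  move=> /andP[t0 t1].
  have := variation_reparam g rh t0; rewrite e variation_reparam// h0// h'0//.
  have /andP[? ?] := reparam01 t rh; have /andP[? ?] := reparam01 t rh'.
  by rewrite !vlenE// vlen_speed_curve// subr0 => -[/esym].
have sur t : 0 <= t <= 1 -> exists2 u, 0 <= u <= 1 & h u = t.
  move=> t01; have [|u /[!in_itv]/= u01 hu] := IVT ler01 (continuous_subspaceT ch) (v := t).
    by rewrite h0// h1// (min_idPl ler01) (max_idPr ler01).
  by exists u.
have := len_ge0 c; rewrite le_eqVlt => /orP[/eqP l0|l0].
  exists clampR; split; first exact: reparam_clampR.
    apply/funext => t /=; rewrite curve_ext_clamp.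
    have [u u01 <-] := sur _ (clampR01 t).
    rewrite -[LHS]/((curve_ext g \o h) u) e.
    exact: arc_param_const.
  by move=> t /sur[u u01 <-]; rewrite key// -l0 !mul0r.
exists (fun t => vlen g 0 (clampR t) / len c); split.
- apply: (@reparam_clamp _ (fun t => vlen g 0 t / len c)).
  + move=> t; apply: (@cvgM _ _ _ _ (vlen g 0 : subspace `[0,1]%classic -> R) (cst (len c)^-1)).
      exact: vlen_continuous.
    exact: cvg_cst.
  + by move=> s t s0 st t1; rewrite ler_pM2r ?invr_gt0//; exact: vlen_mono.
  + by rewrite vlenxx mul0r.
  + by rewrite -len_vlen divff// gt_eqF.
- apply/funext => t /=; rewrite curve_ext_clamp.
  have [u u01 <-] := sur _ (clampR01 t).
  rewrite key// mulrAC divff ?mul1r ?gt_eqF//.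
  by rewrite -[LHS]/((curve_ext g \o h) u) e.
- by move=> t t01; rewrite clampRE// mulrCA divff ?mulr1// gt_eqF.
Qed.

(** Constant arclength rate characterizes the constant-speed representative. *)
Lemma arc_param_unique g : (forall t, 0 <= t <= 1 -> vlen g 0 t = len (arc_of g) * t) ->
  curve_ext g = arc_param (arc_of g).
Proof.
move=> h; have [sigma [rs e he]] := arc_param_factor g.
apply/funext => t; rewrite e/= .
have := len_ge0 (arc_of g); rewrite le_eqVlt => /orP[/eqP l0|l0].
  exact: arc_param_const.
rewrite [RHS]arc_param_clamp.
have [csig msig sig0 sig1] := rs.
have -> : sigma t = sigma (clampR t).
  have [t0|/ltW t0] := leP t 0; first by rewrite clampRle0// !sig0.
  have [t1|/ltW t1] := leP 1 t; first by rewrite clampRge1// !sig1.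
  by rewrite clampRE// t0.
congr (arc_param _ _); apply: (@mulfI _ (len (arc_of g))); first by rewrite gt_eqF.
by rewrite -he ?clampR01// h// clampR01.
Qed.

(** The arguments are clamped so that [aff a b] maps into [0, 1] for all reals a and
b; no side condition is then needed to form a subcurve. *)
Definition aff (a b u : R) : R :=
  clampR a + (Num.max (clampR a) (clampR b) - clampR a) * u.

Lemma affE a b u : 0 <= a -> a <= b -> b <= 1 -> aff a b u = a + (b - a) * u.
Proof.
move=> a0 ab b1; rewrite /aff !clampRE ?(max_idPr ab)// ?a0 ?(le_trans ab)//.
by rewrite b1 (le_trans a0).
Qed.

Lemma into01_aff a b : into01 (aff a b).
Proof.
have /andP[a0 a1] := clampR01 a; have /andP[b0 b1] := clampR01 b.
split.
- move=> t; apply: cvgD; first exact: cvg_cst.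
  by apply: cvgM; [exact: cvg_cst|exact: cvg_id].
- move=> s t st; rewrite lerD2l ler_wpM2l// subr_ge0 le_max lexx.
  by [].
- by rewrite /aff mulr0 addr0.
- by rewrite /aff mulr1 addrC subrK ge_max a1.
Qed.

Definition subcurve g a b : C := recurve g (into01_aff a b).

Lemma subcurveE g a b t : 0 <= a -> a <= b -> b <= 1 ->
  curve_ext (subcurve g a b) t = curve_ext g (a + (b - a) * clampR t).
Proof. by move=> *; rewrite recurveE affE. Qed.

(** The portion of a curve run through by a monotone time change depends, up to
reparametrization, only on its end times. *)
Lemma arc_of_same_ends g h h' (ok : into01 h) (ok' : into01 h') :
  h 0 = h' 0 -> h 1 = h' 1 -> arc_of (recurve g ok) = arc_of (recurve g ok').
Proof.
suff H k (okk : into01 k) : arc_of (recurve g okk) = arc_of (subcurve g (k 0) (k 1)).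
  by move=> e0 e1; rewrite H (H h') e0 e1.
move: (okk) => [ck mk k0 k1].
have k01 : k 0 <= k 1 by exact: mk.
apply/arc_ofP; exists clampR.
have [e|ne] := eqVneq (k 0) (k 1).
  exists clampR; split; [exact: reparam_clampR|exact: reparam_clampR|].
  apply/funext => t /=; rewrite recurveE subcurveE// clampRE ?clampR01//.
  rewrite -e subrr mul0r addr0; congr curve_ext; apply/eqP.
  by have /andP[? ?] := clampR01 t; rewrite eq_le [X in _ <= X]e !mk// -e mk.
have lt : k 0 < k 1 by rewrite lt_neqAle ne.
pose s t := (k t - k 0) / (k 1 - k 0).
have rs : reparam (s \o clampR).
  apply: reparam_clamp.
  - apply: continuous_subspaceT => t; apply: cvgM; last exact: cvg_cst.
    by apply: cvgB; [exact: ck|exact: cvg_cst].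
  - move=> a b a0 ab b1; rewrite ler_pM2r ?invr_gt0 ?subr_gt0// lerB//; exact: mk.
  - by rewrite /s subrr mul0r.
  - by rewrite /s divff// subr_eq0 eq_sym.
exists (s \o clampR); split => //; first exact: reparam_clampR.
apply/funext => t /=; rewrite recurveE subcurveE// clampRE ?clampR01//.
rewrite (clampRE (reparam01 t rs))/= /s mulrC divfK ?subr_eq0 1?eq_sym//.
by rewrite addrC subrK.
Qed.

(** Cutting commutes with reparametrization, provided that the cutting times are
moved accordingly. *)
Lemma subcurve_factor g g' (s : R -> R) a b : reparam s ->
  curve_ext g = curve_ext g' \o s -> 0 <= a -> a <= b -> b <= 1 ->
  arc_of (subcurve g a b) = arc_of (subcurve g' (s a) (s b)).
Proof.
move=> rs e a0 ab b1; have [cs ms s0 s1] := rs.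
have ok : into01 (s \o aff a b).
  split.
  - by move=> t; apply: continuous_comp; [have [+ _ _ _] := into01_aff a b; apply|exact: cs].
  - by move=> t u tu; apply: ms; have [_ + _ _] := into01_aff a b; apply.
  - by case/andP: (reparam01 (aff a b 0) rs).
  - by case/andP: (reparam01 (aff a b 1) rs).
transitivity (arc_of (recurve g' ok)).
  apply/arc_ofP; exists clampR, clampR.
  split; [exact: reparam_clampR|exact: reparam_clampR|].
  by apply/funext => t /=; rewrite !recurveE e.
have /andP[? ?] := reparam01 a rs; have /andP[? ?] := reparam01 b rs.
have ? := ms _ _ ab.
by apply: arc_of_same_ends; rewrite /= !affE// ?mulr0 ?mulr1 ?addr0// !(addrC _ (_ - _)) !subrK.
Qed.

Definition subarc c a b : RA := arc_of (subcurve (speed_curve c) a b).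

Lemma vlen_subcurve g a b t : 0 <= a -> a <= b -> b <= 1 -> 0 <= t <= 1 ->
  vlen (subcurve g a b) 0 t = vlen g a (a + (b - a) * t).
Proof.
move=> a0 ab b1 /andP[t0 t1].
have [ca ma _ _] := into01_aff a b.
rewrite /vlen; congr fine.
rewrite (@eq_variation _ _ d _ (curve_ext g \o aff a b)); last first.
  by move=> u /andP[u0 ut]; rewrite recurveE clampRE// u0 (le_trans ut).
rewrite variation_comp//; first by rewrite !affE// mulr0 addr0.
by move=> *; exact: ma.
Qed.

Lemma len_subarc c a b : 0 <= a -> a <= b -> b <= 1 ->
  len (subarc c a b) = (b - a) * len c.
Proof.
move=> a0 ab b1; rewrite len_vlen vlen_subcurve// ?ler01 ?lexx//.
have -> : a + (b - a) * 1 = b by lra.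
by rewrite vlen_speed_curve// mulrC.
Qed.

Lemma subarc_param c a b t : 0 <= a -> a <= b -> b <= 1 ->
  arc_param (subarc c a b) t = arc_param c (a + (b - a) * clampR t).
Proof.
move=> a0 ab b1; rewrite -arc_param_unique ?subcurveE//.
move=> u /[dup] u01 /andP[u0 u1].
rewrite vlen_subcurve// vlen_speed_curve//.
- by rewrite -/(subarc c a b) len_subarc//; ring.
- by rewrite lerDl mulr_ge0// subr_ge0.
- by rewrite (le_trans _ b1)//; nra.
Qed.

End constant_speed.

(** * The topology of the space of arcs *)

Section topology.
Context {R : realType} {X : ptopologicalType} (d : extended_distance R X).
Local Notation C := (rect_curve d).
Local Notation RA := (rect_arc d).
Implicit Types (g : C) (c : RA).

Lemma curve_ext_inj g g' : curve_ext g = curve_ext g' -> g = g'.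
Proof.
move=> e; apply: val_inj; apply/funext => u.
have := congr1 (fun F => F (set_val u)) e.
by rewrite /curve_ext clampK !set_valE.
Qed.

(** A subbasis of the compact-open topology, in terms of curves extended to the line. *)
Lemma co_open (K : set R) (O : set X) : compact K -> open O ->
  open [set g : C | forall u, K u -> O (curve_ext g u)].
Proof.
move=> cK oO.
pose B := [set f : {compact-open, unit_itv (R:=R) -> X} | f @` (@clamp R @` K) `<=` O].
have -> : [set g : C | forall u, K u -> O (curve_ext g u)] = set_val @^-1` B.
  apply/seteqP; split => g /= h.
    by move=> _ [_ [u Ku <-] <-]; exact: h.
  by move=> u Ku; apply: h; exists (clamp u) => //; exists u.
have oB : open B.
  apply: compact_open_open => //; apply: continuous_compact => //.
  by apply: continuous_subspaceT; exact: clamp_continuous.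
by exists B.
Qed.

Lemma co_cvg (F : set_system C) (g : C) : Filter F ->
  (forall (K : set R) O, compact K -> K `<=` `[0, 1] -> open O ->
    (forall u, K u -> O (curve_ext g u)) ->
    F [set g' : C | forall u, K u -> O (curve_ext g' u)]) -> F --> g.
Proof.
move=> FF h A; rewrite nbhsE => -[_ [[B oB <-] /= Bg]] /filterS; apply.
have : (set_val @ F) --> (set_val g : {compact-open, unit_itv (R:=R) -> X}).
  apply/compact_open_cvgP => K O cK oO gKO.
  pose K' := (set_val : unit_itv (R:=R) -> R) @` K.
  have cK' : compact K'.
    apply: continuous_compact => //; apply: continuous_subspaceT.
    exact: initial_continuous.
  have := h K' O cK' _ oO; rewrite /K'.
  have H1 : [set set_val x | x in K] `<=` `[0, 1 : R].
    by move=> _ [x Kx <-]; rewrite /= in_itv; exact: set_val_unit.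
  move=> /(_ H1); have H2 u : [set set_val x | x in K] u -> O (curve_ext g u).
    move=> [x Kx <-]; rewrite /curve_ext clampK; apply: gKO.
    by exists x.
  move=> /(_ H2); rewrite /nbhs/=; apply: filterS => g' /= hg' _ [x Kx <-].
  have := hg' (set_val x); rewrite /curve_ext clampK; apply.
  by exists x.
by apply; apply: open_nbhs_nbhs.
Qed.

(** Joint continuity of evaluation, by local compactness of the line. *)
Lemma eval_continuous : continuous (fun p : C * R => curve_ext p.1 p.2).
Proof.
move=> [g0 y0] /= U; rewrite nbhsE => -[V [oV Vg] VU].
have /nbhs_ballP[r /= r0 hr] : nbhs y0 (curve_ext g0 @^-1` V).
  by apply: curve_ext_continuous; apply: open_nbhs_nbhs.
pose K := `[y0 - r / 2, y0 + r / 2]%classic.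
have cK : compact K by exact: segment_compact.
exists ([set g : C | forall u, K u -> V (curve_ext g u)], ball y0 (r / 2)) => /=.
  split; last by apply: nbhsx_ballx; rewrite divr_gt0.
  apply: open_nbhs_nbhs; split; first exact: co_open.
  move=> u; rewrite /K/= in_itv/= => /andP[u1 u2]; apply: hr.
  by rewrite /ball/= ltr_norml; apply/andP; split; lra.
move=> [g y] /= [hg]; rewrite /ball/= ltr_norml => /andP[y1 y2].
by apply: VU; apply: hg; rewrite /K/= in_itv/=; apply/andP; split; lra.
Qed.

(** A time change uniformly close to the identity gives a curve close to the given
one: a continuous curve is uniformly continuous for this purpose by compactness. *)
Lemma curve_approx g (A : set C) : nbhs g A -> exists2 eta : R, 0 < eta &
  forall th (ok : into01 th), (forall t, 0 <= t <= 1 -> `|th t - t| <= eta) ->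
    A (recurve g ok).
Proof.
move=> gA.
pose G (eta : R) : set C := [set g' | exists th (ok : into01 th),
  (forall t, 0 <= t <= 1 -> `|th t - t| <= eta) /\ g' = recurve g ok].
pose F : set_system C := filter_from [set eta : R | 0 < eta] G.
have FF : Filter F.
  apply: filter_from_filter; first by exists 1; rewrite /= ltr01.
  move=> a b /= a0 b0; exists (Num.min a b); first by rewrite /= lt_min a0 b0.
  move=> _ [th [ok [h ->]]]; split; exists th, ok; split=> // t t01.
    by have := h t t01; rewrite le_min => /andP[].
  by have := h t t01; rewrite le_min => /andP[].
suff : F --> g.
  move=> /(_ _ gA)[eta /= eta0 h]; exists eta => // th ok hth; apply: h.
  by exists th, ok.
apply: co_cvg => K O cK K01 oO hO.
have : \forall eta \near (0 : R), K `<=` (fun eta x => forall y, `|y - x| <= eta ->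
    O (curve_ext g y)) eta.
  move/compact_near_coveringP : (cK) => ncK.
  apply: (ncK _ (nbhs (0 : R)) (fun eta x => forall y, `|y - x| <= eta ->
    O (curve_ext g y))) => x Kx.
  have /nbhs_ballP[r /= r0 hr] : nbhs x (curve_ext g @^-1` O).
    by apply: curve_ext_continuous; apply: open_nbhs_nbhs; split => //; exact: hO.
  exists (ball x (r / 2), ball 0 (r / 2)) => /=.
    by split; apply: nbhsx_ballx; rewrite divr_gt0.
  move=> [x' eta] /= [bx beta] y ye; apply: hr.
  move: bx beta; rewrite /ball/= sub0r normrN => bx beta.
  have := ler_distD x' x y; rewrite (distrC x' y).
  have := ler_norm eta; lra.
move=> /nbhs_ballP[e /= e0 he]; exists (e / 2) => /=; first by rewrite divr_gt0.
move=> _ [th [ok [h ->]]] u Ku; rewrite recurveE.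
have u01 : 0 <= u <= 1 by have := K01 _ Ku; rewrite /= in_itv.
rewrite clampRE//; apply: (he (e / 2) _ u Ku); last exact: h.
by rewrite /ball/= sub0r normrN gtr0_norm; lra.
Qed.

Lemma clampR_lip (s t : R) : s <= t -> clampR t - clampR s <= t - s.
Proof.
move=> st; have [s0|/ltW s0] := leP s 0.
  rewrite (clampRle0 s0); have [t0|/ltW t0] := leP t 0; first by rewrite clampRle0//; lra.
  have [t1|/ltW t1] := leP 1 t; first by rewrite clampRge1//; lra.
  by rewrite clampRE ?t0//; lra.
have [s1|/ltW s1] := leP 1 s; first by rewrite !clampRge1// ?(le_trans s1)//; lra.
rewrite (@clampRE _ s) ?s0//; have [t1|/ltW t1] := leP 1 t; first by rewrite clampRge1//; lra.
by rewrite clampRE ?t1 ?(le_trans s0).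
Qed.

(** The map h may have flat parts, so it has no continuous right inverse; but its
convex combination with the identity is strictly increasing, and the inverse of
that is an approximate section of h. *)
Lemma reparam_section (h : R -> R) (eta : R) : reparam h -> 0 < eta < 1 ->
  exists tau, reparam tau /\ forall t, 0 <= t <= 1 -> `|h (tau t) - t| <= eta.
Proof.
move=> rh /andP[e0 e1]; have [ch mh h0 h1] := rh.
(* H is strictly increasing on [0, 1] and within eta of h. *)
pose H u := (1 - eta) * h u + eta * clampR u.
have cH : continuous H.
  move=> u; apply: cvgD; apply: cvgM; try exact: cvg_cst; first exact: ch.
  exact: clampR_continuous.
have H0 : H 0 = 0 by rewrite /H h0// clampRle0// !mulr0 addr0.
have H1 : H 1 = 1 by rewrite /H h1// clampRge1// !mulr1 subrK.
have /choice[tau htau] y : exists u, 0 <= u <= 1 /\ H u = clampR y.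
  have [|u /[!in_itv]/= u01 Hu] := IVT ler01 (continuous_subspaceT cH) (v := clampR y).
    by rewrite H0 H1 (min_idPl ler01) (max_idPr ler01) clampR01.
  by exists u.
have Hge u v : 0 <= u -> u <= v -> v <= 1 -> eta * (v - u) <= H v - H u.
  move=> u0 uv v1; rewrite /H !clampRE ?u0 ?v1 ?(le_trans u0)//; last exact: le_trans v1.
  have := mh _ _ uv; nra.
have mtau : {homo tau : s t / s <= t}.
  move=> s t st; rewrite leNgt; apply/negP => lt.
  have [/andP[s0 s1] Hs] := htau s; have [/andP[t0 t1] Ht] := htau t.
  have := Hge _ _ t0 (ltW lt) s1; rewrite Hs Ht.
  have := clampR_homo st; nra.
exists tau; split.
  split => //.
  - apply: (@lip1_continuous _ _ eta^-1); first by rewrite invr_gt0.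
    move=> s t st; rewrite ger0_norm ?subr_ge0 ?mtau// mulrC ler_pdivlMr// mulrC.
    have [/andP[s0 s1] Hs] := htau s; have [/andP[t0 t1] Ht] := htau t.
    apply: le_trans (Hge _ _ s0 (mtau _ _ st) t1) _; rewrite Hs Ht.
    exact: clampR_lip.
  - move=> t t0; have [/andP[a0 a1]] := htau t; rewrite clampRle0// /H clampRE ?a0// => HE.
    have /andP[h_0 h_1] := reparam01 (tau t) rh.
    have p1 : 0 <= (1 - eta) * h (tau t) by rewrite mulr_ge0// subr_ge0 ltW.
    have p2 : 0 <= eta * tau t by rewrite mulr_ge0// ltW.
    have : eta * tau t = 0 by lra.
    by move=> /eqP; rewrite mulf_eq0 gt_eqF//= => /eqP.
  - move=> t t1; have [/andP[a0 a1]] := htau t; rewrite clampRge1// /H clampRE ?a0// => HE.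
    have /andP[h_0 h_1] := reparam01 (tau t) rh.
    have p1 : 0 <= (1 - eta) * (1 - h (tau t)) by rewrite mulr_ge0// subr_ge0// ltW.
    have p2 : 0 <= eta * (1 - tau t) by rewrite mulr_ge0 ?subr_ge0// ltW.
    have : eta * (1 - tau t) = 0 by lra.
    by move=> /eqP; rewrite mulf_eq0 gt_eqF//= subr_eq0 => /eqP.
move=> t t01; have [/andP[a0 a1]] := htau t; rewrite clampRE// /H clampRE ?a0// => HE.
rewrite -[X in _ - X]HE.
have /andP[h_0 h_1] := reparam01 (tau t) rh.
have -> : h (tau t) - ((1 - eta) * h (tau t) + eta * tau t) = eta * (h (tau t) - tau t) by ring.
rewrite normrM gtr0_norm// ler_piMr ?(ltW e0)// ler_norml; apply/andP; split; lra.
Qed.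

Lemma reparam_comp (h k : R -> R) : reparam h -> reparam k -> reparam (h \o k).
Proof.
move=> [ch mh h0 h1] [ck mk k0 k1]; split.
- by move=> t; apply: continuous_comp; [exact: ck|exact: ch].
- by move=> s t st; apply: mh; exact: mk.
- by move=> t t0 /=; rewrite k0// h0.
- by move=> t t1 /=; rewrite k1// h1.
Qed.

Lemma recurve_continuous th (ok : into01 th) : continuous (fun g : C => recurve g ok).
Proof.
move=> g; apply: co_cvg => [|K O cK K01 oO hO]; first by apply: fmap_filter; exact: nbhs_filter.
pose K' := th @` (@clampR R @` K).
have cK' : compact K'.
  apply: continuous_compact; first by apply: continuous_subspaceT; case: (ok).
  apply: continuous_compact => //; apply: continuous_subspaceT; exact: clampR_continuous.
have := co_open cK' oO; rewrite openE => /(_ g); rewrite /interior/=.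
have H u : K' u -> O (curve_ext g u).
  by move=> [_ [v Kv <-] <-]; rewrite -recurveE; exact: hO.
move=> /(_ H) hn; apply: (@filterS _ (nbhs g) _ _ _ _ hn) => g' /= hg' u Ku; rewrite recurveE.
by apply: hg'; exists (clampR u) => //; exists u.
Qed.

Lemma arc_of_continuous : continuous (@arc_of R X d).
Proof. exact: pi_continuous. Qed.

Lemma arc_openE (A : set RA) : open A = open (@arc_of R X d @^-1` A).
Proof. by []. Qed.

(** If g' is equivalent to a curve g in the open set A, then some reparametrization
of g' is so close to g that it lies in A; that fixed reparametrization carries a
neighbourhood of g' into A. *)
Lemma arc_of_open (A : set C) : open A -> open (@arc_of R X d @` A).
Proof.
move=> oA; rewrite arc_openE openE => g' [g Ag].
move=> /arc_ofP[h [h' [rh rh' e]]].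
have [eta eta0 happrox] := curve_approx (open_nbhs_nbhs (conj oA Ag)).
have e2 : 0 < Num.min eta 2^-1 < 1.
  by rewrite lt_min eta0/= invr_gt0 ltr0n/= gt_min invf_lt1 ?ltr1n ?orbT ?ltr0n.
have [tau [rtau htau]] := reparam_section rh e2.
have rr := reparam_comp rh' rtau; have ok := reparam_into01 rr.
have okh := reparam_into01 (reparam_comp rh rtau).
have A' : A (recurve g' ok).
  have -> : recurve g' ok = recurve g okh.
    apply: curve_ext_inj; apply/funext => t; rewrite !recurveE/=.
    by rewrite -[LHS]/((curve_ext g' \o h') _) -e.
  apply: happrox => t /htau /= /le_trans; apply.
  by rewrite ge_min lexx.
have : nbhs g' ((fun w : C => recurve w ok) @^-1` A).
  by apply: recurve_continuous; apply: open_nbhs_nbhs.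
apply: filterS => w /= Aw; exists (recurve w ok) => //.
exact: arc_of_recurve.
Qed.

Lemma nbhs_arc_of g (A : set C) : nbhs g A -> nbhs (arc_of g) (@arc_of R X d @` A).
Proof.
rewrite nbhsE => -[B [oB Bg] BA].
apply: (@filterS _ _ _ (@arc_of R X d @` B)); first exact: image_subset.
by apply: open_nbhs_nbhs; split; [exact: arc_of_open|exists g].
Qed.

End topology.

(** * Separation, and joint continuity of the constant-speed parametrization *)

Section hausdorff_arcs.
Import ArrowAsProduct.
Context {R : realType} {X : ptopologicalType} (d : extended_distance R X).
Local Notation C := (rect_curve d).
Local Notation RA := (rect_arc d).
Implicit Types (g : C) (c : RA).
Hypothesis emt : emt_space d.

(** The possible first components of monotone pairs (a v, v - a v) that join (0, 0)
to (1, 1): parametrizing a pair of reparametrizations by the sum of the two times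
makes both components 1-Lipschitz, hence the set of pairs compact. *)
Definition coupling : set (R -> R) :=
  [set a | [/\ forall v, 0 <= a v <= 1, a 0 = 0, a 2 = 1 &
    forall v w, 0 <= v -> v <= w -> w <= 2 -> a v <= a w <= a v + (w - v)]].

(** A closed subset of a product of copies of [0, 1]. *)
Lemma coupling_compact : compact (coupling : set (prod_topology (fun _ : R => R))).
Proof.
have cA := @tychonoff R (fun=> R) (fun=> `[0, 1]%classic) (fun=> @segment_compact R 0 1).
have ev (v : R) : continuous (fun a : prod_topology (fun _ : R => R) => (a v : R)).
  exact: (@proj_continuous _ (fun _ : R => R) v).
have evB (v w : R) : continuous (fun a : prod_topology (fun _ : R => R) => (a w - a v : R)).
  by move=> a; apply: (@cvgB R R _ (nbhs a) _ (fun a => a w) (fun a => a v) (a w) (a v)); exact: ev.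
apply: (subclosed_compact _ cA); last first.
  by move=> a [h _ _ _] v /=; rewrite in_itv; exact: h.
have -> : coupling = (\bigcap_(v in [set: R]) (fun a => a v) @^-1` `[0, 1]) `&`
   ((fun a => a 0) @^-1` [set 0]) `&` ((fun a => a 2) @^-1` [set 1]) `&`
   \bigcap_(p in [set p : R * R | [/\ 0 <= p.1, p.1 <= p.2 & p.2 <= 2]])
     ((fun a => a p.2 - a p.1) @^-1` `[0, p.2 - p.1]).
  apply/seteqP; split => a /=.
    move=> [h a0 a2 h2]; split; first split; first split => //.
    - by move=> v _; rewrite /= in_itv/=; exact: h.
    - exact: a2.
    - move=> [v w] /= [v0 vw w2]; rewrite in_itv/=; have := h2 _ _ v0 vw w2.
      by move=> /andP[? ?]; apply/andP; split; lra.
  move=> [[[h a0] a2] h2]; split => //.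
    by move=> v; have := h v I; rewrite /= in_itv.
  move=> v w v0 vw w2; have := h2 (v, w) (And3 v0 vw w2).
  by rewrite /= in_itv/= => /andP[? ?]; apply/andP; split; lra.
apply: closedI; first apply: closedI; first apply: closedI.
- apply: closed_bigI => v _; apply: (continuous_closedP _).1 (ev v) _ _.
  exact: itv_closed.
- by apply: (continuous_closedP _).1 (ev 0) _ _; exact: closed_eq.
- by apply: (continuous_closedP _).1 (ev 2) _ _; exact: closed_eq.
- apply: closed_bigI => -[v w] _ /=; apply: (continuous_closedP _).1 (evB v w) _ _.
  exact: itv_closed.
Qed.

(** The equivalence of two curves is the existence of a coupling, an element of a
compact set. *)
Lemma arc_of_coupling g g' : arc_of g = arc_of g' <->
  exists2 a, coupling a & forall v, 0 <= v <= 2 -> curve_ext g (a v) = curve_ext g' (v - a v).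
Proof.
split.
  move=> /arc_ofP[h [h' [rh rh' e]]].
  have [ch mh h0 h1] := rh; have [ch' mh' h'0 h'1] := rh'.
  (* The parameter v of the coupling is the sum of the two times. *)
  pose S t := h t + h' t.
  have cS : continuous S by move=> t; apply: cvgD; [exact: ch|exact: ch'].
  have S0 : S 0 = 0 by rewrite /S h0// h'0// addr0.
  have S1 : S 1 = 2 by rewrite /S h1// h'1.
  have /choice[k hk] v : exists t, 0 <= v <= 2 -> 0 <= t <= 1 /\ S t = v.
    have [v02|/negP v02] := boolP (0 <= v <= 2); last by exists 0.
    have [|t /[!in_itv]/= t01 St] := IVT ler01 (continuous_subspaceT cS) (v := v).
      by rewrite S0 S1 min_l// max_r.
    by exists t.
  exists (h \o k).
    split => [v|||v w v0 vw w2] /=.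
    - exact: reparam01.
    - have [|] := hk 0; first by rewrite lexx/=.
      move=> _; rewrite /S; have /andP[? ?] := reparam01 (k 0) rh.
      by have /andP[? ?] := reparam01 (k 0) rh'; lra.
    - have [|] := hk 2; first by rewrite lexx andbT ler0n.
      move=> _; rewrite /S; have /andP[? ?] := reparam01 (k 2) rh.
      by have /andP[? ?] := reparam01 (k 2) rh'; lra.
    - have [|_ Sv] := hk v; first by rewrite v0 (le_trans vw).
      have [|_ Sw] := hk w; first by rewrite w2 (le_trans v0).
      have [vw'|vw'] := leP (k v) (k w).
        rewrite mh//=; move: Sv Sw; rewrite /S.
        by have := mh' _ _ vw'; lra.
      have e1 : v = w.
        apply/eqP; rewrite eq_le vw/= -Sv -Sw /S lerD//; [apply: mh; exact: ltW|apply: mh'; exact: ltW].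
      by rewrite e1 lexx subrr addr0 lexx.
  move=> v v02 /=; have [k01 Sk] := hk _ v02.
  rewrite -[X in _ = curve_ext g' (X - _)]Sk /S addrAC subrr add0r.
  exact: (congr1 (fun F => F (k v)) e).
move=> [a [a01 a0 a2 ha] e].
have lipa t u : 0 <= t -> t <= u -> u <= 1 -> 0 <= a (2 * u) - a (2 * t) <= 2 * (u - t).
  move=> t0 tu u1.
  have p1 : 0 <= 2 * t by lra.
  have p2 : 2 * t <= 2 * u by lra.
  have p3 : 2 * u <= 2 by lra.
  by have /andP[? ?] := ha _ _ p1 p2 p3; apply/andP; split; lra.
have clip t u : t <= u -> 0 <= a (2 * clampR u) - a (2 * clampR t) <= 2 * (u - t).
  move=> tu; have /andP[t0 t1] := clampR01 t; have /andP[u0 u1] := clampR01 u.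
  have /andP[-> /=] := lipa _ _ t0 (clampR_homo tu) u1.
  by have := clampR_lip tu; lra.
apply/arc_ofP; exists (fun t => a (2 * clampR t)), (fun t => 2 * clampR t - a (2 * clampR t)).
split.
- split.
  + apply: (@lip1_continuous _ _ 2) => // t u tu; have /andP[l1 l2] := clip _ _ tu.
    by rewrite ger0_norm.
  + by move=> t u tu; have /andP[l1 l2] := clip _ _ tu; lra.
  + by move=> t t0; rewrite clampRle0// mulr0.
  + by move=> t t0; rewrite clampRge1// mulr1.
- have bnd t u : t <= u -> 0 <= 2 * clampR u - a (2 * clampR u) - (2 * clampR t - a (2 * clampR t)) <= 2 * (u - t).
    move=> tu; have /andP[l1 l2] := clip _ _ tu; have := clampR_lip tu.
    have /andP[t0 t1] := clampR01 t; have /andP[u0 u1] := clampR01 u.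
    have /andP[] := lipa _ _ t0 (clampR_homo tu) u1.
    by move=> *; apply/andP; split; lra.
  split.
  + apply: (@lip1_continuous _ _ 2) => // t u tu; have /andP[l1 l2] := bnd _ _ tu.
    by rewrite ger0_norm.
  + by move=> t u tu; have /andP[l1 l2] := bnd _ _ tu; lra.
  + by move=> t t0; rewrite clampRle0// mulr0 a0 subr0.
  + by move=> t t0; rewrite clampRge1// mulr1 a2; lra.
- apply/funext => t /=; apply: e; have /andP[? ?] := clampR01 t.
  by apply/andP; split; lra.
Qed.

(** For inequivalent curves g and g', every coupling has a time at which the two
curves differ, and this persists for nearby couplings and nearby curves; by
compactness of couplings, all curves near g and near g' are inequivalent. The
projection to arcs being open, this separates the arcs. *)
Lemma rect_arc_hausdorff : hausdorff_space RA.
Proof.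
rewrite open_hausdorff => c c' cc'.
have [g gc] := arc_surj c; have [g' gc'] := arc_surj c'.
(* P (g, g') a says that the coupling a does not identify g and g'. *)
pose P (p : C * C) (a : prod_topology (fun _ : R => R)) :=
  ~ (forall v, 0 <= v <= 2 -> curve_ext p.1 (a v) = curve_ext p.2 (v - a v)).
have [] : \forall p \near (g, g'), coupling `<=` P p.
  move/compact_near_coveringP : coupling_compact => nc; apply: (nc _ (nbhs (g, g')) P) => a ca.
  have /existsNP[v /not_implyP[v02 ne]] :
      ~ forall v, 0 <= v <= 2 -> curve_ext g (a v) = curve_ext g' (v - a v).
    move=> h; move/eqP: cc'; apply; rewrite -gc -gc'.
    by apply/arc_of_coupling; exists a.
  have := emt_hausdorff emt; rewrite open_hausdorff => /(_ _ _ (introN eqP ne)).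
  move=> [[U V] /= [/[!inE] Ug Vg] [oU oV UV]].
  have c1 := @eval_continuous _ _ d (g, a v); have c2 := @eval_continuous _ _ d (g', v - a v).
  have [[A1 B1] /= [nA1 nB1] h1] := c1 _ (open_nbhs_nbhs (conj oU Ug)).
  have [[A2 B2] /= [nA2 nB2] h2] := c2 _ (open_nbhs_nbhs (conj oV Vg)).
  have ev : (fun b : prod_topology (fun _ : R => R) => (b v : R)) @ a --> a v.
    exact: (@proj_continuous _ (fun _ : R => R) v).
  exists ((fun b : prod_topology (fun _ : R => R) => B1 (b v) /\ B2 (v - b v)), A1 `*` A2) => /=.
    split; last by exists (A1, A2).
    apply: filterI; first exact: ev nB1.
    have : (fun b : prod_topology (fun _ : R => R) => v - (b v : R)) @ a --> v - a v.
      by apply: (@cvgB R R _ (nbhs a) _ (fun=> v) (fun b => b v) v (a v)); [exact: cvg_cst|exact: ev].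
    by apply.
  move=> [b [g1 g2]] /= [[b1 b2] [a1 a2]] /(_ v v02) /= e.
  have : (U `&` V) (curve_ext g1 (b v)).
    by split; [exact: (h1 (g1, b v))|rewrite e; exact: (h2 (g2, v - b v))].
  by rewrite UV.
move=> [A B] /= [nA nB] h.
exists ((@arc_of R X d @` A°), (@arc_of R X d @` B°)) => /=.
  split; rewrite inE; [exists g|exists g'] => //; exact: nbhs_singleton (nbhs_interior _).
split; [apply: arc_of_open; exact: open_interior|apply: arc_of_open; exact: open_interior|].
apply/eqP/seteqP; split => // _ [[g1 /interior_subset A1 <-] [g2 /interior_subset B2 /esym e]].
have [a ca ha] := (arc_of_coupling _ _).1 e.
exact: (h (g1, g2) (conj A1 B2) a ca).
Qed.

End hausdorff_arcs.

Section continuity.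
Context {R : realType} {X : ptopologicalType} (d : extended_distance R X).
Local Notation C := (rect_curve d).
Local Notation RA := (rect_arc d).
Implicit Types (g : C) (c : RA).
Hypothesis emt : emt_space d.

Lemma vlen_lsc g (s t x : R) : 0 <= s -> s <= t -> t <= 1 -> x < vlen g s t ->
  \forall g' \near g, x < vlen g' s t.
Proof.
move=> s0 st t1; apply: (@vlen_lsc_curve _ _ d emt (nbhs g) (nbhs_filter g) g s t x) => // u _.
have := @eval_continuous _ _ d (g, u) => h.
move=> A /h[[B1 B2] /= [n1 n2] hB]; apply: (@filterS _ (nbhs g) _ _ _ _ n1) => g' g'1.
by apply: (hB (g', u)); split => //; exact: nbhs_singleton.
Qed.

Lemma len_lsc (x : R) : open [set c : RA | x < len c].
Proof.
rewrite arc_openE openE => g /=; rewrite len_vlen => xg.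
have := vlen_lsc (lexx 0) ler01 (lexx 1) xg.
by apply: filterS => g' /=; rewrite len_vlen.
Qed.

(** Moving end times, as continuous functions of a parameter t. The commutation with
reparametrizations ensures that cutting does not depend on the representative. *)
Definition cut (a b : R -> R) := [/\ continuous a, continuous b,
  forall t, 0 <= t <= 1 -> [/\ 0 <= a t, a t <= b t & b t <= 1] &
  forall s t, reparam s -> 0 <= t <= 1 -> s (a t) = a (s t) /\ s (b t) = b (s t)].

Lemma cut_init : cut (cst 0) id.
Proof.
split; first exact: cst_continuous.
- by move=> t; exact: cvg_id.
- by move=> t /andP[? ?]; split => /=.
- by move=> s t [_ _ h0 _] _; split => //=; exact: h0.
Qed.

Lemma cut_final : cut id (cst 1).
Proof.
split; first by move=> t; exact: cvg_id.
- exact: cst_continuous.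
- by move=> t /andP[? ?]; split => /=.
- by move=> s t [_ _ _ h1] _; split => //=; exact: h1.
Qed.

Definition cutcurve (a b : R -> R) (p : C * R) : C := subcurve p.1 (a p.2) (b p.2).

Lemma cutcurve_continuous a b : cut a b -> continuous (cutcurve a b).
Proof.
move=> [ca cb _ _] [g0 t0]; apply: co_cvg => K O cK K01 oO hO.
pose th (q : R * R) := aff (a q.1) (b q.1) (clampR q.2).
have cth : continuous th.
  have c1 : continuous (fun q : R * R => clampR (a q.1)).
    move=> q; apply: (@continuous_comp _ _ _ (fun q : R * R => a q.1)); last exact: clampR_continuous.
    by apply: (@continuous_comp _ _ _ fst a); [exact: cvg_fst|exact: ca].
  have c2 : continuous (fun q : R * R => clampR (b q.1)).
    move=> q; apply: (@continuous_comp _ _ _ (fun q : R * R => b q.1)); last exact: clampR_continuous.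
    by apply: (@continuous_comp _ _ _ fst b); [exact: cvg_fst|exact: cb].
  have c3 : continuous (fun q : R * R => clampR q.2).
    by move=> q; apply: (@continuous_comp _ _ _ snd (@clampR R)); [exact: cvg_snd|exact: clampR_continuous].
  move=> q; apply: cvgD; first exact: c1.
  apply: cvgM; last exact: c3.
  apply: cvgB; last exact: c1.
  exact: (@continuous_max R _ (fun q : R * R => clampR (a q.1)) (fun q : R * R => clampR (b q.1)) q (c1 q) (c2 q)).
have : \forall p \near (g0, t0), K `<=` (fun (p : C * R) u => O (curve_ext p.1 (th (p.2, u)))) p.
  move/compact_near_coveringP : cK => nc.
  apply: (nc _ (nbhs (g0, t0)) (fun (p : C * R) u => O (curve_ext p.1 (th (p.2, u))))) => u Ku.
  have h0 : O (curve_ext g0 (th (t0, u))) by have := hO u Ku; rewrite recurveE.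
  have [[A1 B1] /= [nA1 nB1] h1] := @eval_continuous _ _ d (g0, th (t0, u)) _
    (open_nbhs_nbhs (conj oO h0)).
  have [[A2 B2] /= [nA2 nB2] h2] := cth (t0, u) _ nB1.
  exists (B2, A1 `*` A2); first by split => //; exists (A1, A2).
  move=> [u' [g' t']] /= [Bu [Ag At]]; apply: (h1 (g', th (t', u'))); split => //=.
  exact: (h2 (t', u')).
move=> hn; apply: (@filterS _ (nbhs (g0, t0)) _ _ _ _ hn) => -[g t] /= h u Ku.
by rewrite recurveE; exact: h.
Qed.

Definition cutarc (a b : R -> R) (c : RA) (t : R) : RA := subarc c (a t) (b t).

Section regular_arcs.
Context {Y : topologicalType} (Psi : C * R -> Y).
Hypothesis cPsi : continuous Psi.
Hypothesis iPsi : forall g g' s t, reparam s -> curve_ext g = curve_ext g' \o s ->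
  0 <= t <= 1 -> Psi (g, t) = Psi (g', s t).

(** At an arc of positive length, the constant-speed parametrization is jointly
continuous in the arc, its length and the time. Here [Psi] is a continuous
function of a curve and a time that is invariant under reparametrization. An arc
near c0 is represented by a curve g near the constant-speed representative of
c0; if moreover its length is close to that of c0, then semicontinuity of the
length before and after a given time shows that g moves at nearly constant
speed, so that evaluating at time s of the arc amounts to evaluating g at a time
close to s. *)
Lemma arc_param_cvg c0 (s0 : R) (U : set Y) : 0 < len c0 -> 0 <= s0 <= 1 ->
  nbhs (Psi (speed_curve c0, s0)) U ->
  exists2 e : R, 0 < e & \forall c \near c0, forall s, `|len c - len c0| < e ->
    `|s - s0| < e -> 0 <= s <= 1 -> U (Psi (speed_curve c, s)).
Proof.
move=> l0 /andP[s00 s01] nU.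
have [[A B] /= [nA /nbhs_ballP[r /= r0 rB]] hAB] := cPsi nU.
set l := len c0 in l0 *; set R0 := speed_curve c0 in nA.
pose a := Num.max 0 (s0 - r / 2); pose b := Num.min 1 (s0 + r / 2).
have [a0 a1] : 0 <= a /\ a <= 1.
  by rewrite /a; split; [rewrite le_max lexx|rewrite ge_max ler01/=; lra].
have [b0 b1] : 0 <= b /\ b <= 1.
  by rewrite /b; split; [rewrite le_min ler01/=; lra|rewrite ge_min lexx].
(* The constants make both contradictions below linear: an error e in the
   lengths is small against l * r, the length travelled in time r. *)
pose e := Num.min (r / 4) (l * r / 16).
have e0 : 0 < e by rewrite lt_min !divr_gt0// mulr_gt0.
have [er elr] : e <= r / 4 /\ e <= l * r / 16 by rewrite /e !ge_min !lexx ?orbT.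
clearbody e.
have va : l * (1 - a) - e < vlen R0 a 1 by rewrite vlen_speed_curve// -/l; lra.
have vb : l * b - e < vlen R0 0 b by rewrite vlen_speed_curve// -/l; lra.
exists (Num.min e (r / 8)); first by rewrite lt_min e0 divr_gt0.
have nN : nbhs R0 [set g | [/\ A g, l * (1 - a) - e < vlen g a 1 & l * b - e < vlen g 0 b]].
  have := vlen_lsc (lexx 0) b0 b1 vb; have := vlen_lsc a0 a1 (lexx 1) va.
  by apply: filterS3 nA.
have := nbhs_arc_of nN; rewrite arc_of_speed_curve//.
apply: filterS => c [g [Ag ga gb] gc] s.
rewrite !lt_min => /andP[lc1 _] /andP[sc1 sc2] /andP[s0' s1'].
have [sigma [rs gE hs]] := arc_param_factor emt g.
rewrite gc in gE hs.
have [csig msig sig0 sig1] := rs.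
have [|t /[!in_itv]/= t01 st] := IVT ler01 (continuous_subspaceT csig) (v := s).
  by rewrite sig0// sig1// (min_idPl ler01) (max_idPr ler01) s0'.
rewrite -st -(@iPsi g)//; apply: (hAB (g, t)); split => //=; apply: rB.
have lcE : len c = vlen g 0 1 by rewrite -gc len_vlen.
move: lc1; rewrite ltr_norml => /andP[lc1 lc2].
move: sc1; rewrite ltr_norml => /andP[sc1 sc3].
move: sc2; rewrite ltr_norml => /andP[sc4 sc5].
have vt : vlen g 0 t = len c * s by rewrite hs// st.
have /andP[t0 t1] := t01.
have lca : vlen g 0 a = len c - vlen g a 1 by rewrite lcE (vlenD g (lexx 0) a0 a1 (lexx 1)); lra.
have lo : a <= t.
  have [aE|aE] := leP (s0 - r / 2) 0; first by rewrite /a max_l.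
  have aE' : a = s0 - r / 2 by rewrite /a max_r// ltW.
  rewrite leNgt; apply/negP => ta.
  have := vlen_mono g t0 (ltW ta) a1; rewrite vt lca leNgt => /negP; apply.
  rewrite aE' in ga *.
  have p1 : 0 <= (len c - (l - e)) * s by rewrite mulr_ge0//; lra.
  have p2 : 0 <= e * (1 - s) by rewrite mulr_ge0//; lra.
  have p3 : 0 <= l * (s - (s0 - r / 8)) by rewrite mulr_ge0//; lra.
  have p4 : 0 < l * r by rewrite mulr_gt0.
  lra.
have hi : t <= b.
  have [bE|bE] := leP 1 (s0 + r / 2); first by rewrite /b min_l.
  have bE' : b = s0 + r / 2 by rewrite /b min_r// ltW.
  rewrite leNgt; apply/negP => tb.
  have := vlen_mono g b0 (ltW tb) t1; rewrite vt leNgt => /negP; apply.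
  rewrite bE' in gb *.
  have p1 : 0 <= (l + e - len c) * s by rewrite mulr_ge0//; lra.
  have p2 : 0 <= e * (1 - s) by rewrite mulr_ge0//; lra.
  have p3 : 0 <= l * (s0 + r / 8 - s) by rewrite mulr_ge0//; lra.
  have p4 : 0 < l * r by rewrite mulr_gt0.
  lra.
have a2 : s0 - r / 2 <= a by rewrite /a le_max lexx orbT.
have b2 : b <= s0 + r / 2 by rewrite /b ge_min lexx orbT.
by rewrite /ball/= ltr_norml; apply/andP; split; lra.
Qed.

End regular_arcs.

End continuity.

(** * Lower integrals, Borel versions and image measures *)

Section lower_integral.
Context d (T : measurableType d) (R : realType) (mu : {measure set T -> \bar R}).
Local Open Scope ereal_scope.
Import HBNNSimple.

(** The integral of an arbitrary nonnegative function is a supremum over the simple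
functions below it, hence monotone without measurability. *)
Lemma ge0_le_lower_integral (D : set T) (f g : T -> \bar R) :
  (forall x, D x -> 0 <= f x) -> (forall x, D x -> f x <= g x) ->
  \int[mu]_(x in D) f x <= \int[mu]_(x in D) g x.
Proof.
move=> f0 fg; have g0 x : D x -> 0 <= g x by move=> Dx; exact: le_trans (f0 _ Dx) (fg _ Dx).
rewrite ge0_integralE// ge0_integralE//; apply: le_ereal_sup.
apply: image_subset => h /= hf x; apply: (le_trans (hf x)).
by apply: lee_restrict.
Qed.

Lemma ge0_le_lower_integral_off (N : set T) (f g : T -> \bar R) :
  measurable N -> mu N = 0 -> (forall x, 0 <= f x) -> (forall x, 0 <= g x) ->
  (forall x, ~ N x -> f x <= g x) -> \int[mu]_x f x <= \int[mu]_x g x.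
Proof.
move=> mN N0 f0 g0 fg; rewrite [X in X <= _]ge0_integralTE//.
apply: ge_ereal_sup => _ [h /= hf <-].
rewrite -integralT_nnsfun (@ge0_negligible_integral _ _ _ _ setT N)//; last 2 first.
  exact/measurable_EFinP.
  by move=> x _; rewrite lee_fin.
rewrite setTD integral_mkcond; apply: ge0_le_lower_integral => x _.
  by apply: erestrict_ge0 => y _; rewrite lee_fin.
rewrite /patch; case: ifPn => // /set_mem Nx; exact: le_trans (hf x) (fg _ Nx).
Qed.

Lemma ge0_eq_lower_integral_off (N : set T) (f g : T -> \bar R) :
  measurable N -> mu N = 0 -> (forall x, 0 <= f x) -> (forall x, 0 <= g x) ->
  (forall x, ~ N x -> f x = g x) -> \int[mu]_x f x = \int[mu]_x g x.
Proof.
move=> mN N0 f0 g0 fg; apply/eqP; rewrite eq_le.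
by apply/andP; split; apply: (ge0_le_lower_integral_off mN N0) => // x /fg ->.
Qed.

Lemma eq_integral_off (D N : set T) (f g : T -> \bar R) :
  measurable N -> mu N = 0 -> (forall x, D x -> ~ N x -> f x = g x) ->
  \int[mu]_(x in D) f x = \int[mu]_(x in D) g x.
Proof.
move=> mN N0 fg; rewrite integralE [RHS]integralE.
congr (_ - _); rewrite integral_mkcond [RHS]integral_mkcond;
  apply: (ge0_eq_lower_integral_off mN N0) => x; rewrite ?erestrict_ge0// => Nx;
  by rewrite /patch; case: ifPn => // /set_mem Dx; rewrite ?funeposE ?funenegE fg.
Qed.

Lemma lower_integral_subset (A B : set T) (f : T -> \bar R) :
  (forall x, B x -> 0 <= f x) -> A `<=` B ->
  \int[mu]_(x in A) f x <= \int[mu]_(x in B) f x.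
Proof.
move=> f0 AB; rewrite integral_mkcond [leRHS]integral_mkcond.
apply: ge0_le_lower_integral => x _; first by apply: erestrict_ge0 => y /AB /f0.
rewrite /patch; case: ifPn => [/set_mem /AB Bx|_]; first by rewrite mem_set.
by case: ifPn => // /set_mem /f0.
Qed.

End lower_integral.

Section borel_version.
Context d (T : measurableType d) (R : realType) (mu : {measure set T -> \bar R}).

(** The sets that agree with a measurable set off a measurable null set form a
sigma-algebra. *)
Lemma completed_version (A : set T) : (completed_algebra_gen mu).-sigma.-measurable A ->
  exists B N, [/\ measurable B, measurable N, mu N = 0%E & forall x, ~ N x -> A x <-> B x].
Proof.
pose G := [set A : set T | exists B N, [/\ measurable B, measurable N, mu N = 0%E &
  forall x, ~ N x -> A x <-> B x]].
move: A; change ((completed_algebra_gen mu).-sigma.-measurable `<=` G).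
apply: smallest_sub; last first.
  move=> _ [B mB [N [M [mM M0 NM]] <-]]; exists B, M; split => // x Mx.
  by split => [[//|/NM//]|]; left.
split.
- by exists set0, set0; split.
- move=> A [B [N [mB mN N0 AB]]]; exists (~` B), N; split => //; first exact: measurableC.
  move=> x /AB xAB; split => [[_ nA] /xAB//|nB]; split => // /xAB.
  exact: nB.
- move=> A hA; have /choice[B hB] n := hA n.
  have /choice[N hN] n := hB n.
  exists (\bigcup_n B n), (\bigcup_n N n); split.
  + by apply: bigcupT_measurable => n; have [] := hN n.
  + by apply: bigcupT_measurable => n; have [] := hN n.
  + apply/eqP; rewrite eq_le measure_ge0 andbT.
    apply: (le_trans (measure_sigma_subadditive _ _ _ (@subset_refl _ _))).
    * by move=> n; have [] := hN n.
    * by apply: bigcupT_measurable => n; have [] := hN n.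
    * by rewrite eseries0// => n _ _; have [] := hN n.
  + move=> x nN; split => -[n _ h]; exists n => //; have [_ _ _ hx] := hN n;
      by apply/hx => // Nx; apply: nN; exists n.
Qed.

(** Each superlevel set at a rational level is replaced by a measurable set, and the
function is set to zero on the union of the countably many null sets involved. *)
Lemma ae_measurable_version (g : T -> \bar R) : ae_measurable mu g ->
  exists g' N, [/\ measurable_fun setT g', measurable N, mu N = 0%E,
    forall x, ~ N x -> g' x = g x & forall x, N x -> g' x = 0%E].
Proof.
move=> mg.
have /choice[B hB] (q : rat) : exists B N, [/\ measurable B, measurable N, mu N = 0%E &
    forall x, ~ N x -> ((ratr q)%:E < g x)%E <-> B x].
  have := mg measurableT `](ratr q)%:E, +oo[%classic (emeasurable_itv _).
  rewrite setTI => /completed_version[B [N [mB mN N0 h]]].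
  by exists B, N; split => // x /h <-; rewrite /= in_itv/= andbT.
have /choice[N hN] q := hB q.
pose M := \bigcup_q N q.
have mM : measurable M.
  by apply: bigcupT_measurable_rat => q; have [] := hN q.
have M0 : mu M = 0%E.
  apply: measure_negligible => //.
  have -> : M = \bigcup_n (if unpickle n is Some q then N q else set0).
    apply/seteqP; split => x [i _ h].
      exists (pickle i); first exact: I.
      rewrite pickleK; exact: h.
    by move: h; case: (unpickle i) => [q h|[]]; exists q.
  apply: negligible_bigcup => n; case: unpickle => [q|]; last exact: negligible_set0.
  by apply/negligibleP; have [] := hN q.
pose g' x := if x \in M then 0%E else g x.
exists g', M; split => //; last 2 first.
- by move=> x Mx; rewrite /g' memNset.
- by move=> x Mx; rewrite /g' mem_set.
apply: (measurability _ (ErealGenOInfty.measurableE R)) => // _ [_ [r ->] <-].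
rewrite setTI.
have -> : g' @^-1` `]r%:E, +oo[%classic =
   \bigcup_(q in [set q : rat | r <= ratr q]) (B q `\` M) `|`
   (if r < 0 then M else set0).
  apply/seteqP; split => x /=; rewrite in_itv/= andbT /g'.
    have [/set_mem Mx|/negP Mx] := boolP (x \in M).
      by rewrite lte_fin => r0; right; rewrite r0.
    move=> rg; left.
    have [q rq qg] : exists2 q : rat, r <= ratr q & ((ratr q)%:E < g x)%E.
      case: (g x) rg => [y| |]//.
        rewrite lte_fin => /rat_in_itvoo[q /[!in_itv]/= /andP[q1 q2]].
        by exists q; rewrite ?lte_fin// ltW.
      have /rat_in_itvoo[q /[!in_itv]/= /andP[q1 q2]] : r < r + 1 by rewrite ltrDl.
      by exists q; rewrite ?ltry// ltW.
    exists q => //; split; last by move=> Mx'; apply: Mx; exact: mem_set.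
    have [_ _ _ h] := hN q; apply/h => // Nx; apply: Mx; apply: mem_set.
    by exists q.
  move=> [[q /= rq [Bx Mx]]|].
    rewrite memNset//; apply: (@le_lt_trans _ _ (ratr q)%:E); first by rewrite lee_fin.
    have [_ _ _ h] := hN q; apply/h => // Nx; apply: Mx.
    by exists q.
  by case: ifP => // r0 Mx; rewrite mem_set// lte_fin.
apply: measurableU; last by case: ifP.
rewrite bigcup_mkcond; apply: bigcupT_measurable_rat => q; case: ifP => // _.
by apply: measurableD => //; have [] := hN q.
Qed.

End borel_version.

Section mixture.
Context d1 d2 (T : measurableType d1) (Y : measurableType d2) (R : realType).
Context (P : {measure set T -> \bar R}) (D : set T) (mD : measurable D).
Context (w : T -> R) (phi : T -> Y).
Hypothesis mw : measurable_fun D w.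
Hypothesis w0 : forall x, 0 <= w x.
Let mwE : measurable_fun D (EFin \o w).
Proof. exact/measurable_EFinP. Qed.

Hypothesis mphi : measurable_fun D phi.
Local Open Scope ereal_scope.

(** The image by [phi] of the measure with density [w] on [D]. *)
Definition mixture (B : set Y) : \bar R := \int[P]_(x in D) ((w x)%:E * (\1_B (phi x))%:E).

Let mind B : measurable B -> measurable_fun D (fun x => (\1_B (phi x) : R)%:E).
Proof.
move=> mB; apply/measurable_EFinP.
exact: (measurable_comp measurableT _ _ mphi).
Qed.

Let mixture0 : mixture set0 = 0.
Proof. by apply: integral0_eq => x _; rewrite indic0/= mule0. Qed.

Let mixture_ge0 B : 0 <= mixture B.
Proof. by apply: integral_ge0 => x _; rewrite mule_ge0// lee_fin. Qed.

Let mixture_additive : semi_sigma_additive mixture.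
Proof.
move=> F mF tF mUF.
have -> : mixture (\bigcup_n F n) = \sum_(n <oo) mixture (F n).
  rewrite /mixture -integral_nneseries//; last 2 first.
  - by move=> n; apply: emeasurable_funM => //; exact: mind.
  - by move=> n x _; rewrite mule_ge0// lee_fin.
  apply: eq_integral => x _.
  rewrite indicE; have [/set_mem[n _ Fn]|/negP h] := boolP (phi x \in _).
    rewrite (@nneseriesD1 _ _ n)//= ?indicE ?mem_set//; last first.
      by move=> k _; rewrite mule_ge0// lee_fin.
    rewrite eseries0 ?adde0// => k _ kn; rewrite indicE memNset ?mule0// => Fk.
    move/trivIsetP : tF => /(_ k n I I kn)/seteqP[+ _] => /(_ (phi x)).
    by apply.
  rewrite mule0 eseries0// => k _ _; rewrite indicE memNset ?mule0// => Fk; apply: h.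
  by apply: mem_set; exists k.
by apply: is_cvg_ereal_nneg_natsum_cond => n _ _; exact: mixture_ge0.
Qed.

HB.instance Definition _ := isMeasure.Build _ _ _ mixture mixture0 mixture_ge0 mixture_additive.

Import HBNNSimple.

Lemma integral_mixture (F : Y -> \bar R) : measurable_fun setT F ->
  (forall y, 0 <= F y) ->
  \int[mixture]_y F y = \int[P]_(x in D) ((w x)%:E * F (phi x)).
Proof.
move=> mF F0; pose h := nnsfun_approx measurableT mF.
have hF y : (h n y)%:E @[n --> \oo] --> F y.
  by apply: cvg_nnsfun_approx => //.
have nd y : nondecreasing_seq (fun n => (h n y)%:E).
  by move=> a b ab; rewrite lee_fin; exact/lefP/nd_nnsfun_approx.
transitivity (limn (fun n => \int[mixture]_y (h n y)%:E)).
  rewrite -monotone_convergence//.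
  - by apply: eq_integral => y _; apply/esym/cvg_lim => //; exact: hF.
  - by move=> n; exact/measurable_EFinP.
  - by move=> n y _; rewrite lee_fin.
transitivity (limn (fun n => \int[P]_(x in D) ((w x)%:E * (h n (phi x))%:E))); last first.
  rewrite -monotone_convergence//.
  - apply: eq_integral => x _; apply/cvg_lim => //.
    by apply: cvgeZl => //; exact: hF.
  - move=> n; apply: emeasurable_funM => //; apply/measurable_EFinP.
    exact: (measurable_comp measurableT _ _ mphi).
  - by move=> n x _; rewrite mule_ge0// lee_fin.
  - by move=> x _ a b ab; rewrite lee_pmul// ?lee_fin//; have := nd (phi x) _ _ ab.
congr (limn _); apply/funext => n.
rewrite integralT_nnsfun sintegralE.
transitivity (\int[P]_(x in D) (\sum_(r \in range (h n))
   (r%:E * ((w x)%:E * (\1_(h n @^-1` [set r]) (phi x))%:E)))); last first.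
  apply: eq_integral => x _; rewrite [in RHS]fimfunE -fsumEFin// ge0_mule_fsumr.
    apply: eq_fsbigr => r _.
    by rewrite EFinM muleCA.
  by move=> r; rewrite EFinM nnfun_muleindic_ge0.
rewrite ge0_integral_fsum//.
- apply: eq_fsbigr => r /set_mem[t _ <-].
  rewrite ge0_integralZl//.
  + by apply: emeasurable_funM => //; exact: mind.
  + by move=> x _; rewrite mule_ge0// lee_fin.
  + by rewrite lee_fin.
- by move=> r; apply: emeasurable_funM => //; apply: emeasurable_funM => //; exact: mind.
- move=> r x _; rewrite muleCA; apply: mule_ge0; first by rewrite lee_fin.
  exact: nnfun_muleindic_ge0.
Qed.

Lemma mixture_measure : exists nu : {measure set Y -> \bar R},
  (forall B, nu B = \int[P]_(x in D) ((w x)%:E * (\1_B (phi x))%:E)) /\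
  forall F : Y -> \bar R, measurable_fun setT F -> (forall y, 0 <= F y) ->
  \int[nu]_y F y = \int[P]_(x in D) ((w x)%:E * F (phi x)).
Proof. by exists mixture; split => // F mF F0; exact: integral_mixture. Qed.

Lemma mixture_finite : \int[P]_(x in D) (w x)%:E < +oo ->
  exists nu : {finite_measure set Y -> \bar R},
  (forall B, measurable B -> nu B = \int[P]_(x in D) ((w x)%:E * (\1_B (phi x))%:E)) /\
  forall F : Y -> \bar R, measurable_fun setT F -> (forall y, 0 <= F y) ->
  \int[nu]_y F y = \int[P]_(x in D) ((w x)%:E * F (phi x)).
Proof.
move=> fin.
have fm : fin_num_fun mixture.
  apply: lty_fin_num_fun; rewrite /mixture; apply: le_lt_trans fin.
  rewrite le_eqVlt; apply/orP; left; apply/eqP; apply: eq_integral => x _.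
  by rewrite indicT mule1.
pose fmix := @Measure_isFinite.Build _ _ _ mixture fm.
pose nu : {finite_measure set Y -> \bar R} := HB.pack mixture fmix.
exists nu; split => // F mF F0; exact: integral_mixture.
Qed.

End mixture.

(** * Densities, and approximation by compact sets *)

Section density.
Context d (T : measurableType d) (R : realType).
Context (m nu : {finite_measure set T -> \bar R}) (q : R) (h : T -> R).
Hypothesis q1 : 1 <= q.
Hypothesis hq : h \in Lfun m q%:E.
Hypothesis nuh : forall A, measurable A -> (nu A <= \int[m]_(x in A) `|h x|%:E)%E.

Let mh : measurable_fun setT h.
Proof. by move: hq => /sub_Lfun_mfun; rewrite inE. Qed.

(** Radon-Nikodym. The density is at most |h| only almost everywhere; taking the
minimum with |h| gives a version whose L^q norm is visibly finite. *)
Lemma dominated_density : exists k : T -> R, [/\ k \in Lfun m q%:E,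
  forall A, measurable A -> nu A = (\int[m]_(x in A) (k x)%:E)%E,
  forall x, 0 <= k x &
  forall F : T -> \bar R, measurable_fun setT F -> (forall x, 0 <= F x)%E ->
    (\int[nu]_x F x = \int[m]_x (F x * (k x)%:E))%E].
Proof.
have dom : nu `<< m.
  apply/null_content_dominatesP => A mA A0; apply/eqP; rewrite eq_le measure_ge0 andbT.
  apply: (le_trans (nuh mA)); rewrite (@integral_abs_eq0 _ _ _ m A (EFin \o h))//.
  by apply/measurable_EFinP; exact: measurable_funTS.
pose f0 := Radon_Nikodym_SigmaFinite.f nu m.
have f00 := Radon_Nikodym_SigmaFinite.f_ge0 dom.
have f0fin := Radon_Nikodym_SigmaFinite.f_fin_num dom.
have f0int := Radon_Nikodym_SigmaFinite.f_integrable dom.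
have mf0 : measurable_fun setT f0 by exact: measurable_int f0int.
pose f x := fine (f0 x).
have fE x : f0 x = (f x)%:E by rewrite fineK.
have f0E A : measurable A -> (nu A = \int[m]_(x in A) (f x)%:E)%E.
  move=> mA; rewrite (Radon_Nikodym_SigmaFinite.f_integral dom mA).
  by apply: eq_integral => x _; rewrite -fE.
have mf : measurable_fun setT f by exact: measurableT_comp.
have f_ge0 x : 0 <= f x by rewrite fine_ge0.
have mah : measurable_fun setT (fun x => `|h x|) by exact: measurableT_comp.
(* The null set on which the Radon-Nikodym density exceeds |h|. *)
pose D := [set x | `|h x| < f x].
have mD : measurable D.
  have mb : measurable_fun setT (fun x => f x - `|h x|) by exact: measurable_funB.
  have := mb measurableT _ (measurable_itv `]0, +oo[); rewrite setTI.
  by congr measurable; apply/seteqP; split => x /=; rewrite in_itv/= andbT subr_gt0.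
have D0 : m D = 0%E.
  have mhD : measurable_fun D (fun x => `|h x|%:E).
    by apply/measurable_EFinP; exact: measurable_funTS.
  have mfD : measurable_fun D (EFin \o f) by apply/measurable_EFinP; exact: measurable_funTS.
  have mbD : measurable_fun D (fun x => (f x - `|h x|)%:E).
    by apply/measurable_EFinP; apply: measurable_funTS; exact: measurable_funB.
  have : (\int[m]_(x in D) `|(f x - `|h x|)%:E| = 0)%E.
    have fin : (\int[m]_(x in D) `|h x|%:E)%E \is a fin_num.
      rewrite ge0_fin_numE; last by apply: integral_ge0 => x _; rewrite lee_fin.
      apply: (@le_lt_trans _ _ (\int[m]_(x in D) (f x)%:E)%E).
        apply: ge0_le_integral => //.
        by move=> x /ltW; rewrite lee_fin.
      by rewrite -(f0E D mD) ltey_eq fin_num_measure.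
    apply/eqP; rewrite eq_le; apply/andP; split; last by exact: integral_ge0.
    rewrite -(leeD2lE _ _ fin) adde0 -ge0_integralD//; last exact: measurableT_comp.
    have := nuh mD; rewrite (f0E D mD); apply: le_trans.
    rewrite le_eqVlt; apply/orP; left; apply/eqP; apply: eq_integral => x /set_mem Dx.
    rewrite gee0_abs ?lee_fin ?subr_ge0 ?(ltW Dx)// -EFinD; congr EFin.
    by rewrite addrC subrK.
  move=> /(ae_eq_integral_abs m mD mbD).1 [N [mN N0 sN]].
  apply/eqP; rewrite eq_le measure_ge0 andbT -N0 le_measure ?inE// => x Dx.
  apply: sN => /= /(_ Dx)[] /eqP; rewrite subr_eq0 => /eqP e.
  by move: Dx; rewrite /D/= -e ltxx.
pose k x := Num.min (f x) `|h x|.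
have mk : measurable_fun setT k.
  exact: measurable_minr.
have k_ge0 x : 0 <= k x by rewrite le_min f_ge0 normr_ge0.
have kf x : ~ D x -> k x = f x by move/negP; rewrite -leNgt => /min_idPl.
exists k; split => //.
- apply/andP; split; first by rewrite inE.
  rewrite inE /= /finite_norm.
  have : finite_norm m q%:E h by move: hq => /sub_Lfun_finLfun; rewrite inE.
  rewrite /finite_norm; apply: le_lt_trans.
  have q0 : 0 < q by rewrite (lt_le_trans ltr01).
  have mono (r : R) (x y : \bar R) : 0 < r -> (0 <= x)%E -> (x <= y)%E -> (x `^ r <= y `^ r)%E.
    move=> r0 x0 xy; apply: (gt0_ler_poweR (ltW r0)) => //; rewrite in_itv/= leey andbT//.
    exact: le_trans xy.
  rewrite unlock /Lnorm; apply: (mono); first by rewrite invr_gt0.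
    by apply: integral_ge0 => x _; exact: poweR_ge0.
  apply: ge0_le_lower_integral => x _; first exact: poweR_ge0.
  apply: (mono) => //; rewrite lee_fin ger0_norm//.
  by rewrite ge_min lexx orbT.
- move=> A mA; rewrite f0E//; apply: (eq_integral_off mD D0) => x _ Dx.
  by rewrite kf.
- move=> F mF F0.
  rewrite -(Radon_Nikodym_SigmaFinite.change_of_variables dom F0 measurableT mF).
  by apply: (eq_integral_off mD D0) => x _ Dx; rewrite -/f0 fE kf.
Qed.

End density.

Section measure_approx.
Context d (T : measurableType d) (R : realType) (mu : {measure set T -> \bar R}).
Local Open Scope ereal_scope.

Lemma measure_bigcup_le (A : (set T)^nat) (e : R) : (0 <= e)%R ->
  (forall n, measurable (A n)) -> (forall n, mu (A n) <= (e / (2 ^ n.+1)%:R)%:E) ->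
  mu (\bigcup_n A n) <= e%:E.
Proof.
move=> e0 mA hA.
apply: (le_trans (measure_sigma_subadditive _ mA _ (@subset_refl _ _))).
  exact: bigcupT_measurable.
apply: le_trans (epsilon_trick0 xpredT e0).
by apply: lee_nneseries => // n _; exact: hA.
Qed.

End measure_approx.

Section finite_measure_approx.
Context d (T : measurableType d) (R : realType) (mu : {finite_measure set T -> \bar R}).
Local Open Scope ereal_scope.

(** Continuity from below of a finite measure. *)
Lemma measure_bigcup_truncate (A : (set T)^nat) (e : R) : (0 < e)%R ->
  (forall n, measurable (A n)) ->
  exists n, mu (\bigcup_n A n `\` \bigcup_(k in `I_n) A k) < e%:E.
Proof.
move=> e0 mA; pose B n := \bigcup_(k in `I_n) A k.
have mB n : measurable (B n) by exact: bigcup_measurable.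
have UB : \bigcup_n B n = \bigcup_n A n.
  apply/seteqP; split => x [n _].
    by move=> [k _ Ak]; exists k.
  by move=> An; exists n.+1 => //; exists n => /=.
have mU : measurable (\bigcup_n A n) by exact: bigcupT_measurable.
have BU n : B n `<=` \bigcup_n A n by move=> x [k _ Ak]; exists k.
have : mu (B n) @[n --> \oo] --> mu (\bigcup_n B n).
  apply: nondecreasing_cvg_mu => //; first by rewrite UB.
  move=> a b ab; apply/subsetPset => x [k /= ka Ak]; exists k => //=.
  exact: leq_trans ab.
rewrite UB => cv.
have fU : mu (\bigcup_n A n) \is a fin_num by rewrite fin_num_measure.
have : mu (\bigcup_n A n) - e%:E < mu (\bigcup_n A n).
  by rewrite lteBlDr// lteDl// lte_fin.
move=> lt; have : nbhs (mu (\bigcup_n A n)) [set y | mu (\bigcup_n A n) - e%:E < y].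
  by apply: open_nbhs_nbhs; split => //; exact: open_ereal_gt_ereal.
move=> /cv[n _ /(_ n (leqnn _)) /= hn]; exists n.
rewrite -/(B n) measureD//; last by rewrite ltey_eq fin_num_measure.
rewrite setIC setIidl; last exact: BU.
have fB : mu (B n) \is a fin_num by rewrite fin_num_measure.
by rewrite lteBlDr// addeC -lteBlDr.
Qed.

End finite_measure_approx.

Section radon.
Context (R : realType) (Y : ptopologicalType) (mu : {finite_measure set (borel Y) -> \bar R}).
Hypothesis hY : hausdorff_space Y.
Local Open Scope ereal_scope.

Lemma borel_open (A : set Y) : open A -> measurable (A : set (borel Y)).
Proof. by move=> oA; exact: sub_sigma_algebra. Qed.

Lemma borel_closed (A : set Y) : closed A -> measurable (A : set (borel Y)).
Proof.
move=> cA; rewrite -(setCK A); apply: measurableC; apply: borel_open.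
exact: closed_openC.
Qed.

Lemma borel_compact (A : set Y) : compact A -> measurable (A : set (borel Y)).
Proof. by move=> /(compact_closed hY); exact: borel_closed. Qed.

Lemma radon_inner (B : set (borel Y)) (e : R) : radon mu -> measurable B -> (0 < e)%R ->
  exists K : set Y, [/\ compact K, K `<=` B & mu (B `\` K) < e%:E].
Proof.
move=> rmu mB e0; have := rmu B mB => muB.
have fB : mu B \is a fin_num by rewrite fin_num_measure.
have /ereal_sup_gt[_ [K [cK KB] <-] hK] :
    mu B - e%:E < ereal_sup [set mu K | K in [set K : set Y | compact K /\ K `<=` B]].
  by rewrite -muB lteBlDr// lteDl// lte_fin.
have mK := borel_compact cK.
exists K; split => //.
rewrite measureD//; last by rewrite ltey_eq fin_num_measure.
rewrite setIC setIidl//.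
have fK : mu K \is a fin_num by rewrite fin_num_measure.
by rewrite lteBlDr// addeC -lteBlDr.
Qed.

(** For each rational r the sets {f < r} and {f >= r} are approximated from inside by
compact sets, up to a summable error. On the intersection K over r of the unions
of these pairs, {f < r} and {f >= r} are both relatively closed. *)
Lemma lusin (f : borel Y -> R) (A : set (borel Y)) (e : R) : radon mu ->
  measurable_fun setT f -> measurable A -> (0 < e)%R ->
  exists K : set Y, [/\ compact K, K `<=` A, mu (A `\` K) < e%:E &
    forall x, K x -> forall eps : R, (0 < eps)%R ->
      \forall y \near x, K y -> (`|f y - f x| < eps)%R].
Proof.
move=> rmu mf mA e0.
(* An enumeration of the rationals. *)
pose q n : rat := odflt 0%R (unpickle n).
pose lo n : set (borel Y) := A `&` f @^-1` [set x | (x < ratr (q n))%R].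
pose hi n : set (borel Y) := A `&` f @^-1` [set x | (ratr (q n) <= x)%R].
have mlo n : measurable (lo n).
  apply: measurableI => //; rewrite -[X in measurable X]setTI.
  by apply: mf => //; exact: (measurable_itv `]-oo, _[).
have mhi n : measurable (hi n).
  apply: measurableI => //; rewrite -[X in measurable X]setTI.
  apply: mf => //.
  have -> : [set x | (ratr (q n) <= x)%R] = `[ratr (q n), +oo[%classic :> set R.
    by apply/seteqP; split => x /=; rewrite in_itv/= andbT.
  exact: measurable_itv.
have en n : (0 < e / 2 / (2 ^ n.+1)%:R / 2)%R by rewrite !divr_gt0// ltr0n expn_gt0.
have /choice[K1 hK1] n := radon_inner rmu (mlo n) (en n).
have /choice[K2 hK2] n := radon_inner rmu (mhi n) (en n).
(* On K, being in K1 n means f < q n, and being in K2 n means f >= q n. *)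
pose K := \bigcap_n (K1 n `|` K2 n).
have cK1 n : compact (K1 n) by have [] := hK1 n.
have cK2 n : compact (K2 n) by have [] := hK2 n.
have cKn n : compact (K1 n `|` K2 n) by exact: compactU.
have KA : K `<=` A.
  by move=> x /(_ 0%N I) [] Kx; [have [_ h _] := hK1 0%N|have [_ h _] := hK2 0%N]; case: (h _ Kx).
have cK : compact K.
  apply: (subclosed_compact _ (cKn 0%N)); last exact: bigcap_inf.
  by apply: closed_bigI => n _; apply: compact_closed.
exists K; split => //.
- have -> : A `\` K = \bigcup_n (A `\` (K1 n `|` K2 n)).
    by rewrite /K setDE setC_bigcap setI_bigcupr; apply: eq_bigcupr => n _; rewrite setDE.
  apply: (@le_lt_trans _ _ (e / 2)%:E); last by rewrite lte_fin; lra.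
  apply: measure_bigcup_le.
  + by rewrite divr_ge0// ltW.
  + by move=> n; apply: measurableD => //; exact: borel_compact.
  + move=> n.
    have mD1 : measurable (lo n `\` K1 n : set (borel Y)).
      by apply: measurableD => //; exact: borel_compact.
    have mD2 : measurable (hi n `\` K2 n : set (borel Y)).
      by apply: measurableD => //; exact: borel_compact.
    apply: (@le_trans _ _ (mu ((lo n `\` K1 n) `|` (hi n `\` K2 n)))).
      apply: le_measure; rewrite ?inE.
      * by apply: measurableD => //; exact: borel_compact.
      * exact: measurableU.
      * move=> x [Ax nK]; have [fx|fx] := ltP (f x) (ratr (q n)).
          by left; split => // Kx; apply: nK; left.
        by right; split => // Kx; apply: nK; right.
    apply: (le_trans (measureU2 _ mD1 mD2)).
    have [_ _ h1] := hK1 n; have [_ _ h2] := hK2 n.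
    apply: (le_trans (leeD (ltW h1) (ltW h2))).
    by rewrite -EFinD lee_fin; lra.
- move=> x Kx eps eps0.
  have key (a : R) : (f x < a)%R -> \forall y \near x, K y -> (f y < a)%R.
    move=> /rat_in_itvoo[r /[!in_itv]/= /andP[r1 r2]].
    have qr : q (pickle r) = r by rewrite /q pickleK.
    have cl : closed (K2 (pickle r)) by exact: compact_closed.
    have nK2 : (~` K2 (pickle r)) x.
      move=> /=; have [_ h _] := hK2 (pickle r) => /h[_] /=; rewrite qr leNgt.
      by rewrite r1.
    have : nbhs x (~` K2 (pickle r)).
      by apply: open_nbhs_nbhs; split => //; exact: closed_openC.
    apply: filterS => y nKy Ky; have [Ky1|//] := Ky (pickle r) I.
    have [_ h _] := hK1 (pickle r); have [_] := h _ Ky1; rewrite /= qr => fr.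
    exact: lt_trans r2.
  have key' (a : R) : (a < f x)%R -> \forall y \near x, K y -> (a < f y)%R.
    move=> /rat_in_itvoo[r /[!in_itv]/= /andP[r1 r2]].
    have qr : q (pickle r) = r by rewrite /q pickleK.
    have cl : closed (K1 (pickle r)) by exact: compact_closed.
    have nK1 : (~` K1 (pickle r)) x.
      move=> /=; have [_ h _] := hK1 (pickle r) => /h[_] /=; rewrite qr ltNge.
      by rewrite (ltW r2).
    have : nbhs x (~` K1 (pickle r)).
      by apply: open_nbhs_nbhs; split => //; exact: closed_openC.
    apply: filterS => y nKy Ky; have [//|Ky1] := Ky (pickle r) I.
    have [_ h _] := hK2 (pickle r); have [_] := h _ Ky1; rewrite /= qr => fr.
    exact: lt_le_trans fr.
  have h1 : (f x < f x + eps)%R by rewrite ltrDl.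
  have h2 : (f x - eps < f x)%R by rewrite ltrBlDr ltrDl.
  have := key _ h1; have := key' _ h2; apply: filterS2 => y y1 y2 Ky.
  by rewrite ltr_norml; have := y1 Ky; have := y2 Ky => *; apply/andP; split; lra.
Qed.

End radon.

(** * Radon measures as images under maps continuous on a compact set *)

Section radon_of_open.
Context (R : realType) (Y : ptopologicalType) (nu : {finite_measure set (borel Y) -> \bar R}).
Hypothesis hY : hausdorff_space Y.
Local Open Scope ereal_scope.

Definition inner_closed (B : set Y) := forall e : R, (0 < e)%R ->
  exists C : set Y, [/\ closed C, C `<=` B & nu (B `\` C) < e%:E].

Lemma inner_closed_bigcup (B : (set Y)^nat) :
  (forall n, measurable (B n : set (borel Y))) ->
  (forall n, inner_closed (B n)) -> inner_closed (\bigcup_n B n).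
Proof.
move=> mB iB e e0.
have en n : (0 < e / 2 / (2 ^ n.+1)%:R)%R by rewrite !divr_gt0// ltr0n expn_gt0.
have /choice[C hC] n := iB n _ (en n).
have mC n : measurable (C n : set (borel Y)) by apply: borel_closed; have [] := hC n.
have e20 : (0 < e / 2)%R by rewrite divr_gt0.
have [n hn] := @measure_bigcup_truncate _ _ _ nu C (e / 2) e20 mC.
exists (\bigcup_(k in `I_n) C k); split.
- apply: closed_bigcup; first exact: finite_II.
  by move=> k _; have [] := hC k.
- by move=> x [k _ Ck]; exists k => //; have [_ h _] := hC k; exact: h.
have mD n' : measurable (B n' `\` C n' : set (borel Y)) by exact: measurableD.
have mU : measurable (\bigcup_n C n : set (borel Y)) by exact: bigcupT_measurable.
have mUn : measurable (\bigcup_(k in `I_n) C k : set (borel Y)) by exact: bigcup_measurable.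
apply: (@le_lt_trans _ _ (nu ((\bigcup_n (B n `\` C n)) `|` (\bigcup_n C n `\` \bigcup_(k in `I_n) C k)))).
  apply: le_measure; rewrite ?inE.
  - by apply: measurableD => //; exact: bigcupT_measurable.
  - by apply: measurableU; [exact: bigcupT_measurable|exact: measurableD].
  - move=> x [[k _ Bk] nC]; have [Ck|Ck] := pselect (C k x).
      by right; split => //; exists k.
    by left; exists k.
apply: (le_lt_trans (measureU2 _ _ _)); [exact: bigcupT_measurable|exact: measurableD|].
have e2 : (0 <= e / 2)%R by rewrite divr_ge0// ltW.
have h1 := @measure_bigcup_le _ _ _ nu _ _ e2 mD (fun n' => ltW (let: And3 _ _ h := hC n' in h)).
apply: (le_lt_trans (leeD h1 (lexx _))).
apply: (@lt_le_trans _ _ ((e / 2)%:E + (e / 2)%:E)%E); first by rewrite lteD2lE.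
by rewrite -EFinD lee_fin; lra.
Qed.

Lemma inner_closed_bigcap (B : (set Y)^nat) :
  (forall n, measurable (B n : set (borel Y))) ->
  (forall n, inner_closed (B n)) -> inner_closed (\bigcap_n B n).
Proof.
move=> mB iB e e0.
have en n : (0 < e / 2 / (2 ^ n.+1)%:R)%R by rewrite !divr_gt0// ltr0n expn_gt0.
have /choice[C hC] n := iB n _ (en n).
have mC n : measurable (C n : set (borel Y)) by apply: borel_closed; have [] := hC n.
have mD n' : measurable (B n' `\` C n' : set (borel Y)) by exact: measurableD.
exists (\bigcap_n C n); split.
- by apply: closed_bigI => n _; have [] := hC n.
- by move=> x Cx n _; have [_ h _] := hC n; apply: h; exact: Cx.
have e2 : (0 <= e / 2)%R by rewrite divr_ge0// ltW.
have h1 := @measure_bigcup_le _ _ _ nu _ _ e2 mD (fun n' => ltW (let: And3 _ _ h := hC n' in h)).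
apply: (@le_lt_trans _ _ (e / 2)%:E); last by rewrite lte_fin; lra.
apply: le_trans h1; apply: le_measure; rewrite ?inE.
- by apply: measurableD; apply: bigcapT_measurable.
- exact: bigcupT_measurable.
- move=> x [Bx nC]; have /existsNP[n /not_implyP[_ nCn]] : ~ forall n, True -> C n x by [].
  by exists n => //; split => //; exact: Bx.
Qed.

(** The sets that, together with their complement, are approximated from inside by
closed sets form a sigma-algebra. On a measure carried by a compact set, closed
sets may be replaced by compact sets. *)
Lemma radon_of_open (Q : set Y) : compact Q -> nu (~` Q) = 0 ->
  (forall U : set Y, open U -> inner_closed U) -> radon nu.
Proof.
move=> cQ Q0 iU.
have iC (F : set Y) : closed F -> inner_closed F.
  by move=> cF e e0; exists F; split => //; rewrite setDv measure0 lte_fin.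
pose G := [set B : set (borel Y) | [/\ measurable B, inner_closed B & inner_closed (~` B)]].
have GB : (@measurable _ (borel Y)) `<=` G.
  apply: smallest_sub; last first.
    move=> U oU; split; [exact: borel_open|exact: iU|apply: iC; exact: open_closedC].
  split.
  - split => //; [apply: iC; exact: closed0|rewrite setC0; apply: iU; exact: openT].
  - by move=> B [mB iB iB']; rewrite setTD; split => //; [exact: measurableC|rewrite setCK].
  - move=> B hB; have mB n : measurable (B n : set (borel Y)) by have [] := hB n.
    split; first exact: bigcupT_measurable.
      by apply: inner_closed_bigcup => // n; have [] := hB n.
    rewrite setC_bigcup; apply: inner_closed_bigcap => n; last by have [] := hB n.
    exact: measurableC.
move=> B mB; have [_ iB _] := GB _ mB.
have mQ : measurable (Q : set (borel Y)) by exact: borel_compact.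
apply/eqP; rewrite eq_le; apply/andP; split; last first.
  apply: ge_ereal_sup => _ [K [cK KB] <-]; apply: le_measure; rewrite ?inE//.
  exact: borel_compact.
apply/lee_addgt0Pr => e e0; have [C [cC CB hC]] := iB e e0.
have mC : measurable (C : set (borel Y)) by exact: borel_closed.
have cCQ : compact (C `&` Q) by rewrite setIC; exact: compact_closedI.
apply: (@le_trans _ _ (nu ((C `&` Q) `|` (~` Q `|` (B `\` C))))).
  apply: le_measure; rewrite ?inE//.
    apply: measurableU; first exact: measurableI.
    by apply: measurableU; [exact: measurableC|exact: measurableD].
  move=> x Bx; have [Qx|Qx] := pselect (Q x); last by right; left.
  have [Cx|Cx] := pselect (C x); first by left.
  by right; right.
have mn : measurable (~` Q : set (borel Y)) by exact: measurableC.
have mD : measurable (B `\` C : set (borel Y)) by exact: measurableD.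
apply: (le_trans (measureU2 _ _ _)); [exact: measurableI|exact: measurableU|].
apply: leeD.
  by apply: ereal_sup_ubound; exists (C `&` Q) => //; split => // x [/CB].
apply: (le_trans (measureU2 _ mn mD)); rewrite -[leRHS]add0e; apply: leeD; last exact: ltW.
by rewrite -[leRHS]Q0.
Qed.

End radon_of_open.

Section image.
Context (R : realType) (Z Y : ptopologicalType).
Context (mu : {finite_measure set (borel Z) -> \bar R}).
Hypothesis hZ : hausdorff_space Z.
Context (Phi : Z * R -> Y).
Local Notation I01 := (`[0%R, 1%R]%classic : set R).

(** Continuity of the restriction of [Phi] to A x [0, 1], stated with neighbourhoods
in the ambient space. *)
Definition cont_on (A : set Z) := forall z s U, A z -> 0 <= s <= 1 ->
  nbhs (Phi (z, s)) U -> \forall p \near (z, s), A p.1 -> 0 <= p.2 <= 1 -> U (Phi p).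

(** The line being second countable, a relatively open subset of A x [0, 1] is a
countable union of rectangles indexed by rational intervals, whatever the
topology of the first factor. *)
Lemma rectangle_cover (A : set Z) (U : set Y) : cont_on A -> open U ->
  exists (V : nat -> set Z) (J : nat -> set R), [/\ forall n, open (V n),
    forall n, compact (J n), forall n, J n `<=` I01 &
    (A `*` I01) `&` Phi @^-1` U = \bigcup_n ((V n `&` A) `*` J n)].
Proof.
move=> cA oU.
(* An enumeration of the intervals with rational ends; V n is the largest
   open set whose product with J n is mapped into U along A. *)
pose q n : rat * rat := odflt (0%R, 0%R) (unpickle n).
pose J n : set R := I01 `&` `[ratr (q n).1, ratr (q n).2]%classic.
pose V n : set Z := \bigcup_(W in [set W : set Z | open W /\ forall z s, W z -> A z -> J n s -> U (Phi (z, s))]) W.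
exists V, J; split.
- by move=> n; apply: bigcup_open => W [].
- move=> n; apply: compact_closedI; first exact: segment_compact.
  exact: itv_closed.
- by move=> n x [].
- apply/seteqP; split => [[z s] [[/= Az]]|[z s] [n _ [[[W [oW hW] Wz] Az] Js]]]; last first.
    by split; [split => //; case: Js|exact: hW].
  rewrite in_itv/= => s01 Us.
  have [[B1 B2] /= [nB1 /nbhs_ballP[r /= r0 hr]] hB] := cA z s U Az s01 (open_nbhs_nbhs (conj oU Us)).
  have /rat_in_itvoo[q1 /[!in_itv]/= /andP[q11 q12]] : s - r < s by rewrite ltrBlDr ltrDl.
  have /rat_in_itvoo[q2 /[!in_itv]/= /andP[q21 q22]] : s < s + r by rewrite ltrDl.
  have [n qE] : exists n, q n = (q1, q2) by exists (pickle (q1, q2)); rewrite /q pickleK.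
  have JE x : J n x <-> 0 <= x <= 1 /\ ratr q1 <= x <= ratr q2.
    by rewrite /J qE /setI/= !in_itv.
  exists n; first exact: I.
  split; last by apply/JE; rewrite (ltW q12) (ltW q21).
  split => //; exists B1°; last exact: nbhs_singleton (nbhs_interior nB1).
  split; first exact: open_interior.
  move=> z' s' /interior_subset Bz' Az' /JE[s'01 /andP[s1 s2]].
  apply: (hB (z', s')) => //; split => //=.
  apply: hr; rewrite /ball/= ltr_norml; apply/andP; split; lra.
Qed.

Lemma compact_measurable_R (J : set R) : compact J -> measurable J.
Proof. move=> cJ; apply: closed_measurable; exact: compact_closed (@Rhausdorff R) cJ. Qed.

(** The product sigma-algebra may be smaller than the Borel sigma-algebra of the
product, so continuity is not enough by itself; the countable cover by
rectangles is. *)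
Lemma cont_on_measurable (A : set Z) : measurable (A : set (borel Z)) -> cont_on A ->
  measurable_fun (A `*` I01 : set (borel Z * R)) (Phi : borel Z * R -> borel Y).
Proof.
move=> mA cA; apply: (@measurability _ _ (borel Z * R)%type (borel Y) (A `*` I01) Phi (@open Y) erefl) => _ [U oU <-].
have [V [J [oV cJ JI ->]]] := rectangle_cover cA oU.
apply: bigcupT_measurable => n; apply: measurableX.
  by apply: measurableI => //; exact: borel_open.
exact: compact_measurable_R.
Qed.

Hypothesis hY : hausdorff_space Y.
Hypothesis rmu : radon mu.
Context (K : set Z) (cK : compact K) (hK : cont_on K).

Lemma cont_on_compact (C : set (Z * R)) : C `<=` K `*` I01 -> compact C -> compact (Phi @` C).
Proof.
move=> CK cC; apply: continuous_compact => //.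
apply/subspace_continuousP => -[z s] Czs U nU.
have [Kz] := CK _ Czs; rewrite /= in_itv/= => s01.
have := hK Kz s01 nU; rewrite /nbhs/= => h.
apply: filterS h => p h Cp; have [Kp] := CK _ Cp; rewrite /= in_itv/= => p01.
exact: h.
Qed.

(** By [rectangle_cover] the preimage of an open set is a countable union of
rectangles, each approximated from inside by compact rectangles, whose images are
compact. *)
Lemma radon_image (nu : {finite_measure set (borel Y) -> \bar R}) :
  (forall B : set (borel Y), measurable B ->
    nu B = (mu \x (@lebesgue_measure R))%E ((K `*` I01 : set (borel Z * R)) `&` Phi @^-1` B)) ->
  radon nu.
Proof.
move=> nuE.
have mK : measurable (K : set (borel Z)) by exact: borel_compact.
have cI : compact I01 by exact: segment_compact.
have cKI : compact (K `*` I01) by exact: compact_setX.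
have cQ : compact (Phi @` (K `*` I01)) by exact: cont_on_compact.
have mphi := cont_on_measurable mK hK.
have mKI : measurable (K `*` I01 : set (borel Z * R)).
  by apply: measurableX => //; exact: measurable_itv.
apply: (@radon_of_open R Y nu hY (Phi @` (K `*` I01)) cQ).
  rewrite nuE; last by apply: measurableC; exact: borel_compact.
  rewrite (_ : _ `&` _ = set0) ?measure0//; apply/seteqP; split => // p [Kp] /=.
  by apply; exists p.
move=> U oU e e0.
have [V [J [oV cJ JI UE]]] := rectangle_cover hK oU.
have en n : (0 < e / 2 / (2 ^ n.+1)%:R)%R by rewrite !divr_gt0// ltr0n expn_gt0.
have mVK n : measurable (V n `&` K : set (borel Z)).
  by apply: measurableI => //; exact: borel_open.
have mJ n : measurable (J n) by exact: compact_measurable_R.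
have /choice[A hA] n := radon_inner hZ rmu (mVK n) (en n).
have cA n : compact (A n) by have [] := hA n.
have mA n : measurable (A n : set (borel Z)) by exact: borel_compact.
pose C n := A n `*` J n.
have CK n : C n `<=` K `*` I01.
  move=> [z s] [/= Az Js]; split => /=; last exact: JI Js.
  by have [_ h _] := hA n; have [] := h _ Az.
have cPC n : compact (Phi @` C n).
  by apply: cont_on_compact => //; apply: compact_setX.
have CU n : Phi @` C n `<=` U.
  move=> _ [[z s] [/= Az Js] <-]; have : (\bigcup_n ((V n `&` K) `*` J n)) (z, s).
    by exists n => //; split => //=; have [_ h _] := hA n; exact: h.
  by rewrite -UE => -[].
have mPC n : measurable (Phi @` C n : set (borel Y)) by exact: borel_compact.
have e20 : (0 < e / 2)%R by rewrite divr_gt0.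
have [n hn] := @measure_bigcup_truncate _ _ _ nu _ (e / 2) e20 mPC.
have mU : measurable (\bigcup_n (Phi @` C n) : set (borel Y)) by exact: bigcupT_measurable.
have mUn : measurable (\bigcup_(k in `I_n) (Phi @` C k) : set (borel Y)) by exact: bigcup_measurable.
exists (\bigcup_(k in `I_n) (Phi @` C k)); split.
- apply: closed_bigcup; first exact: finite_II.
  by move=> k _; exact: compact_closed.
- by move=> x [k _ /CU].
have mUU : measurable (U : set (borel Y)) by exact: borel_open.
have h1 : (nu (U `\` \bigcup_n (Phi @` C n)) <= (e / 2)%:E)%E.
  rewrite nuE; last exact: measurableD.
  have mD k : measurable ((V k `&` K `\` A k) `*` J k : set (borel Z * R)).
    by apply: measurableX => //; exact: measurableD.
  have e2 : (0 <= e / 2)%R by rewrite divr_ge0// ltW.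
  apply: le_trans (@measure_bigcup_le _ _ _ (mu \x (@lebesgue_measure R))%E _ _ e2 mD _).
    apply: le_measure; rewrite ?inE.
    - by apply: mphi => //; exact: measurableD.
    - exact: bigcupT_measurable.
    - move=> [z s] [Kzs [Us nC]].
      have : (\bigcup_n ((V n `&` K) `*` J n)) (z, s) by rewrite -UE.
      move=> [k _ [/= VKz Js]]; exists k => //; split => //=; split => // Az.
      by apply: nC; exists k => //; exists (z, s).
  move=> k; rewrite [leLHS]product_measure1E; [|exact: measurableD|exact: mJ].
  have [_ _ hk] := hA k; apply: le_trans (ltW hk).
  rewrite -[leRHS]mule1; apply: lee_wpmul2l => //.
  apply: (@le_trans _ _ (@lebesgue_measure R I01)).
    apply: le_measure; rewrite ?inE; [exact: mJ|exact: measurable_itv|exact: JI].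
  by rewrite lebesgue_measure_itv/= lte_fin ltr01 oppr0 adde0.
apply: (@le_lt_trans _ _ (nu ((U `\` \bigcup_n (Phi @` C n)) `|`
    (\bigcup_n (Phi @` C n) `\` \bigcup_(k in `I_n) (Phi @` C k))))).
  apply: le_measure; rewrite ?inE.
  - exact: measurableD.
  - by apply: measurableU; exact: measurableD.
  - move=> x [Ux nx]; have [Cx|Cx] := pselect ((\bigcup_n (Phi @` C n)) x); first by right.
    by left.
apply: (le_lt_trans (measureU2 _ _ _)); [exact: measurableD|exact: measurableD|].
apply: (le_lt_trans (leeD h1 (lexx _))).
apply: (@lt_le_trans _ _ ((e / 2)%:E + (e / 2)%:E)%E); first by rewrite lteD2lE.
by rewrite -EFinD lee_fin; lra.
Qed.

End image.

(** * Fubini on a slab, and affine changes of variable *)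

Section fubini_restricted.
Context d (Z : measurableType d) (R : realType) (mu : {finite_measure set Z -> \bar R}).
Local Notation I01 := (`[0%R, 1%R]%classic : set R).
Local Notation leb := (@lebesgue_measure R).
Local Open Scope ereal_scope.

Lemma fubini_restricted (A : set Z) (F : Z * R -> \bar R) : measurable A ->
  measurable_fun (A `*` I01) F -> (forall p, 0 <= F p) ->
  measurable_fun A (fun z => \int[leb]_(s in I01) F (z, s)) /\
  \int[mu \x leb]_(p in A `*` I01) F p = \int[mu]_(z in A) \int[leb]_(s in I01) F (z, s).
Proof.
move=> mA mF F0.
have mAI : measurable (A `*` I01) by apply: measurableX => //; exact: measurable_itv.
have mF' : measurable_fun setT (F \_ (A `*` I01)) by exact/(measurable_restrictT _ _).1.
have F0' p : 0 <= (F \_ (A `*` I01)) p by apply: erestrict_ge0.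
have e z : A z -> \int[leb]_(s in I01) F (z, s) = \int[leb]_s (F \_ (A `*` I01)) (z, s).
  move=> Az; rewrite integral_mkcond; apply: eq_integral => s _.
  rewrite /patch; case: ifPn => [/set_mem s01|sn].
    by rewrite mem_set//.
  by rewrite memNset// => -[_ /mem_set]; apply/negP.
split.
  apply: (eq_measurable_fun (fun z => \int[leb]_s (F \_ (A `*` I01)) (z, s))).
    by move=> z /set_mem Az; rewrite e.
  apply: measurable_funTS.
  exact: (measurable_fun_fubini_tonelli_F (m2 := leb) _ mF' F0').
rewrite integral_mkcond (fubini_tonelli1 (m2 := leb) _ mF' F0') [RHS]integral_mkcond.
apply: eq_integral => z _; rewrite /fubini_F [RHS]/patch; case: ifPn => [/set_mem Az|nA].
  by rewrite e.
apply: integral0_eq => s _; rewrite /patch memNset// => -[/= Az _].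
by move/negP: nA; apply; exact: mem_set.
Qed.

End fubini_restricted.

Section affine.
Context (R : realType).
Local Notation leb := (@lebesgue_measure R).
Local Open Scope ereal_scope.

Lemma affine_measurable (a k : R) : measurable_fun setT (fun s : R => (a + k * s)%R : measurableTypeR R).
Proof. by apply: measurable_funD => //; exact: measurable_funM. Qed.

(** Uniqueness of Lebesgue measure, applied to its image under the affine map. *)
Lemma integral_affine (a k : R) (F : R -> \bar R) : (0 < k)%R ->
  measurable_fun setT F -> (forall x, 0 <= F x) ->
  \int[leb]_x F x = \int[leb]_x (k%:E * F (a + k * x)%R).
Proof.
move=> k0 mF F0.
have [nu [nuE nuI]] := @mixture_measure _ _ (measurableTypeR R) (measurableTypeR R) R leb
  setT measurableT (fun=> k) (fun s => a + k * s)%R (@measurable_cst _ _ _ _ _ k) (fun=> ltW k0)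
  (affine_measurable a k).
have lebE : forall B : set (measurableTypeR R), measurable B -> leb B = nu B.
  apply: lebesgue_measure_unique => B /ocitvP[->|[[x y] /= xy ->]].
    by rewrite !measure0.
  rewrite nuE.
  have pre : (fun s : R => (a + k * s)%R) @^-1` `]x, y]%classic = `]((x - a) / k)%R, ((y - a) / k)%R]%classic.
    apply/seteqP; split => s /=; rewrite !in_itv/= ltr_pdivrMr// ler_pdivlMr//;
    by move=> /andP[? ?]; apply/andP; split; lra.
  transitivity (\int[leb]_s (k%:E * (\1_(`]((x - a) / k)%R, ((y - a) / k)%R]%classic) s)%:E)).
    rewrite ge0_integralZl//; last 2 first.
      by apply/measurable_EFinP.
      by rewrite lee_fin ltW.
    rewrite integral_indic// setIT !lebesgue_measure_itv/= !lte_fin.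
    rewrite [X in _ = _ * X]lebesgue_measure_itv/= !lte_fin.
    have -> : ((x - a) / k < (y - a) / k)%R by rewrite ltr_pM2r ?invr_gt0// ltrD2r.
    rewrite xy -?EFinM -!EFinD -?EFinM; congr EFin.
    by field; rewrite gt_eqF.
  by apply: eq_integral => s _; rewrite -pre.
rewrite -(nuI F mF F0); apply: eq_measure_integral => B mB _; exact: lebE.
Qed.

End affine.

(** * Sets of arcs with continuous length *)

Section regular_arcs.
Context {R : realType} {X : ptopologicalType} (d : extended_distance R X).
Local Notation C := (rect_curve d).
Local Notation RA := (rect_arc d).
Local Notation I01 := (`[0%R, 1%R]%classic : set R).
Local Notation leb := (@lebesgue_measure R).
Implicit Types (g : C) (c : RA).
Hypothesis emt : emt_space d.

Definition len_continuous_on (A : set RA) := forall c, A c -> forall e : R, 0 < e ->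
  \forall c' \near c, A c' -> `|len c' - len c| < e.

(** Positivity and continuity of the length are what makes the constant-speed
parametrization continuous on a set of arcs. *)
Definition regular_arcs (A : set RA) := (forall c, A c -> 0 < len c) /\ len_continuous_on A.

Lemma regular_cont_on (Y : ptopologicalType) (Psi : C * R -> Y) (A : set RA) :
  continuous Psi ->
  (forall g g' s t, reparam s -> curve_ext g = curve_ext g' \o s ->
    0 <= t <= 1 -> Psi (g, t) = Psi (g', s t)) ->
  regular_arcs A -> cont_on (fun p : RA * R => Psi (speed_curve p.1, p.2)) A.
Proof.
move=> cPsi iPsi [A0 cA] c s U Ac s01 nU.
have [e e0 h] := arc_param_cvg emt cPsi iPsi (A0 _ Ac) s01 nU.
have hA := cA c Ac e e0.
exists ([set c' | (A c' -> `|len c' - len c| < e) /\ (forall s', `|len c' - len c| < e ->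
    `|s' - s| < e -> 0 <= s' <= 1 -> U (Psi (speed_curve c', s')))], ball s e) => /=.
  split; last exact: nbhsx_ballx.
  by apply: filterS2 hA h.
move=> [c' s'] /= [[h1 h2] bs] Ac' s'01; apply: h2 => //; first exact: h1.
by move: bs; rewrite /ball/= distrC.
Qed.

Lemma regular_eval (A : set RA) : regular_arcs A -> cont_on (fun p : RA * R => arc_param p.1 p.2) A.
Proof.
apply: (@regular_cont_on X (fun p => curve_ext p.1 p.2)); first exact: eval_continuous.
by move=> g g' s t rs ->.
Qed.

(** Cutting is jointly continuous in the arc and the time on such sets: on curves it
is continuous without restriction. *)
Lemma regular_cut a b (A : set RA) : cut a b -> regular_arcs A ->
  cont_on (fun p : RA * R => cutarc a b p.1 p.2) A.
Proof.
move=> ab; apply: (@regular_cont_on RA (@arc_of R X d \o cutcurve a b)).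
  move=> p; apply: continuous_comp; [exact: cutcurve_continuous|exact: arc_of_continuous].
move=> g g' s t rs e t01; rewrite /= /cutcurve/=.
have [_ _ /(_ _ t01)[h1 h2 h3] /(_ _ _ rs t01)[e1 e2]] := ab.
by rewrite (subcurve_factor rs e)// e1 e2.
Qed.

Lemma len_measurable : measurable_fun setT (@len R X d : borel RA -> R).
Proof.
apply: (measurability _ (RGenOInfty.measurableE R)) => // _ [_ [r ->] <-].
rewrite setTI; apply: borel_open.
have -> : @len R X d @^-1` `]r, +oo[%classic = [set c : RA | r < len c].
  by apply/seteqP; split => c /=; rewrite in_itv/= andbT.
exact: len_lsc.
Qed.

(** The end points of an arc are those of any representative, so they depend
continuously on the arc whatever its length. *)
Lemma endpoint_measurable (i : R) : (i = 0 \/ i = 1) ->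
  measurable_fun setT (fun c : borel RA => arc_param c i : borel X).
Proof.
move=> i01; apply: (@measurability _ _ (borel RA) (borel X) setT _ (@open X) erefl) => _ [U oU <-].
rewrite setTI; apply: borel_open; rewrite arc_openE.
have -> : @arc_of R X d @^-1` ((fun c => arc_param c i) @^-1` U) =
    (fun g : C => curve_ext g i) @^-1` U.
  apply/seteqP; split => g /=; have [s [[_ _ s0 s1] -> _]] := arc_param_factor emt g;
  by case: i01 => ->; [rewrite /= s0|rewrite /= s1].
apply: open_comp => // g _ V nV.
have [[A B] /= [nA nB] h] := @eval_continuous R X d (g, i) V nV.
apply: (@filterS _ (nbhs g) _ _ _ _ nA) => g' Ag'.
by apply: (h (g', i)); split => //; exact: nbhs_singleton.
Qed.

(** The sets to which plans are restricted before cutting. The lower bound on the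
length makes the law of the cutting point controlled by the barycenter. *)
Definition regular_compact (e : R) (K : set RA) :=
  [/\ compact K, 0 < e, forall c, K c -> e <= len c & len_continuous_on K].

Lemma regular_compact_regular e K : regular_compact e K -> regular_arcs K.
Proof. by case=> _ e0 h1 h2; split => // c /h1; exact: lt_le_trans. Qed.

Lemma regular_compact_measurable e K : regular_compact e K -> measurable (K : set (borel RA)).
Proof. by case=> cK _ _ _; apply: borel_compact => //; exact: rect_arc_hausdorff. Qed.

(** Lusin's theorem for the length, on each of the sets {len >= 1 / (n + 1)}. *)
Lemma ae_of_regular_compact (pi : {finite_measure set (borel RA) -> \bar R}) (P : RA -> Prop) : radon pi ->
  (forall e K, regular_compact e K -> {ae pi, forall c, K c -> P c}) ->
  {ae pi, forall c, 0 < len c -> P c}.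
Proof.
move=> rpi h.
pose A n : set (borel RA) := [set c : RA | n.+1%:R^-1 <= len c].
have n0 n : 0 < n.+1%:R^-1 :> R by rewrite invr_gt0.
have mA n : measurable (A n).
  have -> : A n = (@len R X d : borel RA -> R) @^-1` `[n.+1%:R^-1, +oo[%classic.
    by apply/seteqP; split => c; rewrite /A /= in_itv/= andbT.
  by have := len_measurable measurableT (measurable_itv `[n.+1%:R^-1, +oo[); rewrite setTI.
have /choice[K hK] n := lusin (rect_arc_hausdorff emt) rpi len_measurable (mA n) (n0 n).
have gK n : regular_compact n.+1%:R^-1 (K n).
  by have [cK KA _ hc] := hK n; split => // c /KA.
have mK n : measurable (K n : set (borel RA)) by exact: regular_compact_measurable (gK n).
(* The arcs of positive length that are missed by all the compact sets. *)
pose N : set (borel RA) := \bigcup_k (A k `\` \bigcup_n K n).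
have mU : measurable (\bigcup_n K n : set (borel RA)) by exact: bigcupT_measurable.
have Nneg : pi.-negligible N.
  apply: negligible_bigcup => k; apply/negligibleP; first exact: measurableD.
  apply/eqP; rewrite eq_le measure_ge0 andbT; apply/lee_addgt0Pr => e e0.
  rewrite add0e.
  have [n hn] : exists n, (k <= n)%N /\ n.+1%:R^-1 < e.
    have := near_infty_natSinv_lt (PosNum e0) => -[n _ hn].
    by exists (maxn n k); rewrite leq_maxr; split => //; apply: (hn (maxn n k)); exact: leq_maxl.
  have [kn ne] := hn; have [_ _ hh _] := hK n.
  apply: (@le_trans _ _ (n.+1%:R^-1)%:E); last by rewrite lee_fin ltW.
  apply: le_trans (ltW hh); apply: le_measure; rewrite ?inE.
  - exact: measurableD.
  - exact: measurableD.
  - move=> c [Ac nc]; split; last by move=> Kc; apply: nc; exists n.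
    apply: le_trans Ac; rewrite lef_pV2 ?posrE// ler_nat ltnS//.
have hn n := h _ _ (gK n).
have : pi.-negligible (N `|` \bigcup_n ~` [set c | K n c -> P c]).
  by apply: negligibleU => //; apply: negligible_bigcup => n; exact: hn.
apply: negligibleS => c /= /not_implyP[c0 nP].
have [[n _ Kc]|nK] := pselect ((\bigcup_n K n) c).
  by right; exists n => //= /(_ Kc).
left; have [n _ hn'] := near_infty_natSinv_lt (PosNum c0).
have := hn' n (leqnn n); rewrite /= => nc.
exists n; first exact: I.
by split; [rewrite /A/= ltW|exact: nK].
Qed.

Lemma arc_integralE c (f : X -> \bar R) :
  arc_integral c f = ((len c)%:E * \int[leb]_(s in I01) f (arc_param c s))%E.
Proof. by rewrite /arc_integral lenE. Qed.

Lemma arc_integral_ge0 c (f : X -> \bar R) : (forall x, (0 <= f x)%E) -> (0 <= arc_integral c f)%E.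
Proof.
move=> f0; rewrite arc_integralE mule_ge0 ?lee_fin ?len_ge0//.
exact: integral_ge0.
Qed.

Lemma arc_param_measurable c : measurable_fun setT (arc_param c : R -> borel X).
Proof.
apply: (@measurability _ _ R (borel X) setT _ (@open X) erefl) => _ [U oU <-].
rewrite setTI; apply: open_measurable; apply: open_comp => // t _.
exact: arc_param_continuous.
Qed.

(** Stated for any arc c' that runs along c at an affine rate, as needed for pieces
of pieces. *)
Lemma arc_integral_affine c c' (f : borel X -> \bar R) (a b : R) :
  measurable_fun setT f -> (forall x, 0 <= f x)%E -> a <= b ->
  len c' = (b - a) * len c ->
  (forall s, 0 <= s <= 1 -> arc_param c' s = arc_param c (a + (b - a) * s)) ->
  arc_integral c' f =
  ((len c)%:E * \int[leb]_(s in `[a, b]) f (arc_param c s))%E.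
Proof.
move=> mf f0 ab lenE' paramE; rewrite arc_integralE lenE'.
move: (ab); rewrite le_eqVlt => /orP[/eqP abE|lt].
  rewrite abE subrr mul0r mul0e set_itv1 integral_set1 ?mule0//.
rewrite mulrC EFinM -muleA; congr (_ * _)%E.
have mF : measurable_fun setT (fun s : R => f (arc_param c s)).
  exact: measurableT_comp mf (arc_param_measurable c).
rewrite integral_mkcond [RHS]integral_mkcond [RHS](@integral_affine R a (b - a))//; last 3 first.
- by rewrite subr_gt0.
- apply: (measurable_restrictT _ _).1; first exact: measurable_itv.
  exact: measurable_funTS.
- by move=> x; apply: erestrict_ge0.
rewrite -ge0_integralZl//; last 3 first.
- apply: (measurable_restrictT _ _).1; first exact: measurable_itv.
  apply: measurable_funTS; apply: measurableT_comp mf _; exact: arc_param_measurable.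
- by move=> x _; apply: erestrict_ge0.
- by rewrite lee_fin subr_ge0.
apply: eq_integral => s _; congr (_ * _)%E.
rewrite /patch; have ba : 0 < b - a by rewrite subr_gt0.
have -> : (s \in I01) = (a + (b - a) * s \in `[a, b]%classic).
  apply/idP/idP; rewrite !inE/= !in_itv/=.
    by move=> /andP[? ?]; apply/andP; split; nra.
  rewrite lerDl pmulr_rge0// => /andP[-> h] /=.
  by rewrite -(ler_pM2l ba) mulr1; lra.
case: ifPn => // /[!inE]/= /[!in_itv]/= /andP[h1 h2].
rewrite paramE//; move: h1 h2; rewrite lerDl pmulr_rge0// => -> h /=.
by rewrite -(ler_pM2l ba) mulr1; lra.
Qed.

Lemma arc_integral_subarc c (f : borel X -> \bar R) (a b : R) :
  measurable_fun setT f -> (forall x, 0 <= f x)%E -> 0 <= a -> a <= b -> b <= 1 ->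
  arc_integral (subarc c a b) f =
  ((len c)%:E * \int[leb]_(s in `[a, b]) f (arc_param c s))%E.
Proof.
move=> mf f0 a0 ab b1; apply: arc_integral_affine => //; first exact: len_subarc.
by move=> s s01; rewrite subarc_param// clampRE.
Qed.

Lemma arc_integral_subarc_le c (f : borel X -> \bar R) (a b : R) :
  measurable_fun setT f -> (forall x, 0 <= f x)%E -> 0 <= a -> a <= b -> b <= 1 ->
  (arc_integral (subarc c a b) f <= arc_integral c f)%E.
Proof.
move=> mf f0 a0 ab b1; rewrite arc_integral_subarc// arc_integralE.
apply: lee_wpmul2l; first by rewrite lee_fin len_ge0.
apply: lower_integral_subset => // s /=; rewrite !in_itv/= => /andP[h1 h2].
by rewrite (le_trans a0)//= (le_trans h2).
Qed.

End regular_arcs.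

(** * Barycenters *)

Section integral_abse.
Context dd (T : measurableType dd) (R : realType) (mu : {measure set T -> \bar R}).
Local Open Scope ereal_scope.

Lemma integral_le_abse (D : set T) (F : T -> \bar R) :
  \int[mu]_(x in D) F x <= \int[mu]_(x in D) `|F x|.
Proof.
rewrite integralE; apply: (@le_trans _ _ (\int[mu]_(x in D) F^\+ x)).
  rewrite -[leRHS]sube0; apply: leeB => //; exact: integral_ge0.
apply: ge0_le_lower_integral => x _ //.
by rewrite funeposE ge_max lee_abs abse_ge0.
Qed.

End integral_abse.

Section barycenter.
Context {R : realType} {X : ptopologicalType} (d : extended_distance R X).
Local Notation RA := (rect_arc d).
Local Notation I01 := (`[0%R, 1%R]%classic : set R).
Local Notation leb := (@lebesgue_measure R).
Implicit Types (c : RA).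
Hypothesis emt : emt_space d.
Context (q : R) (m : {finite_measure set (borel X) -> \bar R}).
Hypothesis q1 : 1 <= q.

Lemma Lfun_integral_lty (h : X -> R) : h \in Lfun m q%:E -> (\int[m]_x `|h x|%:E < +oo)%E.
Proof.
move=> hq; have mf : (m setT) \is a fin_num by exact: fin_num_measure.
have : h \in Lfun m 1%E.
  by apply: (@Lfun_subset _ _ _ m 1%E q%:E _ _ mf) => //; rewrite lee_fin.
move=> /sub_Lfun_finLfun; rewrite inE /= /finite_norm Lnorm1.
by [].
Qed.

(** [Bar] is a norm or infinity according to the existence of a density. *)
Lemma Bar_density (pi : {finite_measure set (borel RA) -> \bar R}) :
  (Bar q m pi < +oo)%E -> exists h, barycenter_density q m pi h.
Proof. by rewrite /Bar; case: pselect => //; rewrite ltxx. Qed.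

Lemma density_Bar (pi : {finite_measure set (borel RA) -> \bar R}) :
  (exists h, barycenter_density q m pi h) -> (Bar q m pi < +oo)%E.
Proof.
move=> e; rewrite /Bar; case: pselect => // e'; case: (cid e') => h [hq _] /=.
by move: hq => /sub_Lfun_finLfun; rewrite inE.
Qed.

Lemma indic_measurable (B : set (borel X)) : measurable B ->
  measurable_fun setT (EFin \o (\1_B : borel X -> R)).
Proof. by move=> mB; apply/measurable_EFinP; exact: measurable_indic. Qed.

Section from_regular.
Context (pi : {finite_measure set (borel RA) -> \bar R}) (A : set RA).
Hypothesis mA : measurable (A : set (borel RA)).
Hypothesis gA : regular_arcs A.

(** Regularity of A is used for measurability: integrals along arcs are measurable
in the arc because the parametrization is jointly measurable on A. *)
Lemma arc_integral_fubini (F : borel X -> \bar R) : measurable_fun setT F ->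
  (forall x, 0 <= F x)%E ->
  measurable_fun (A : set (borel RA)) (fun c => arc_integral c F) /\
  (\int[pi \x leb]_(p in (A `*` I01 : set (borel RA * R)))
    ((len p.1)%:E * F (arc_param p.1 p.2)) = \int[pi]_(c in A) arc_integral c F)%E.
Proof.
move=> mF F0.
have mphi := cont_on_measurable mA (regular_eval emt gA).
have mlen : measurable_fun (A `*` I01 : set (borel RA * R)) (fun p => (len p.1)%:E).
  apply: measurable_funTS; apply/measurable_EFinP.
  by apply: (measurableT_comp (len_measurable emt)); exact: measurable_fst.
have mG : measurable_fun (A `*` I01 : set (borel RA * R))
    (fun p => ((len p.1)%:E * F (arc_param p.1 p.2))%E).
  apply: emeasurable_funM => //.
  exact: (measurable_comp measurableT _ mF mphi).
have G0 (p : borel RA * R) : (0 <= (len p.1)%:E * F (arc_param p.1 p.2))%E.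
  by rewrite mule_ge0// lee_fin len_ge0.
have [h1 h2] := fubini_restricted pi mA mG G0.
have e (c : RA) : (\int[leb]_(s in I01) ((len c)%:E * F (arc_param c s)) = arc_integral c F)%E.
  rewrite arc_integralE ge0_integralZl//; last by rewrite lee_fin len_ge0.
    apply: measurable_funTS; apply: measurableT_comp mF _; exact: arc_param_measurable.
split; first by apply: eq_measurable_fun h1 => c _; exact: e.
by rewrite h2; apply: eq_integral => c _; exact: e.
Qed.

Hypothesis offA : pi (~` A `&` [set c : RA | 0 < len c]) = 0%E.
Context (hh : X -> R).
Hypothesis hhq : hh \in Lfun m q%:E.
Hypothesis hb : forall B : set (borel X), measurable B ->
  (\int[pi]_(c in A) arc_integral c (EFin \o \1_B) <= \int[m]_(x in B) `|hh x|%:E)%E.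

(** The measure B |-> int_A int_c 1_B dpi(c) is finite and dominated by |hh| m, so it
has a density in L^q; arcs outside A have length zero almost surely and do not
contribute. The identity for signed bounded functions follows by splitting into
positive and negative parts. *)
Lemma barycenter_of_regular : exists k, barycenter_density q m pi k.
Proof.
have mAI : measurable (A `*` I01 : set (borel RA * R)).
  by apply: measurableX => //; exact: measurable_itv.
have mphi := cont_on_measurable mA (regular_eval emt gA).
have mlen : measurable_fun (A `*` I01 : set (borel RA * R)) (fun p => len p.1).
  apply: measurable_funTS.
  by apply: (measurableT_comp (len_measurable emt)); exact: measurable_fst.
have len0 (p : borel RA * R) : 0 <= len p.1 by exact: len_ge0.
have mN : measurable (~` A `&` [set c : RA | 0 < len c] : set (borel RA)).
  apply: measurableI; first exact: measurableC.
  by apply: borel_open; exact: len_lsc.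
have wfin : (\int[pi \x leb]_(p in (A `*` I01 : set (borel RA * R))) (len p.1)%:E < +oo)%E.
  have [_ h2] := arc_integral_fubini (indic_measurable measurableT) (fun x => ltac:(by rewrite lee_fin)).
  apply: le_lt_trans (Lfun_integral_lty hhq); apply: le_trans (hb measurableT).
  rewrite -h2 le_eqVlt; apply/orP; left; apply/eqP; apply: eq_integral => p _.
  by rewrite /= indicT mule1.
have [nu [nuB nuI]] := @mixture_finite _ _ (borel RA * measurableTypeR R)%type (borel X) R (pi \x leb)%E
  (A `*` I01) mAI (fun p => len p.1) (fun p => arc_param p.1 p.2) mlen len0 mphi wfin.
have nuE (F : borel X -> \bar R) : measurable_fun setT F -> (forall x, 0 <= F x)%E ->
    (\int[nu]_x F x = \int[pi]_(c in A) arc_integral c F)%E.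
  by move=> mF F0; rewrite nuI//; have [_ ->] := arc_integral_fubini mF F0.
have dom (B : set (borel X)) : measurable B -> (nu B <= \int[m]_(x in B) `|hh x|%:E)%E.
  move=> mB; apply: le_trans (hb mB); rewrite -nuE//; last 2 first.
  - exact: indic_measurable.
  - by move=> x; rewrite lee_fin.
  by rewrite integral_indic// setIT.
have [k [kq _ k0 kI]] := dominated_density q1 hhq dom.
exists k; split => // f mf [M hM].
have M0 : 0 <= M by exact: le_trans (normr_ge0 _) (hM point).
pose fp x := Num.max (f x) 0; pose fn x := Num.max (- f x) 0.
have mfp : measurable_fun setT (fp : borel X -> R) by apply: measurable_maxr.
have mfn : measurable_fun setT (fn : borel X -> R).
  by apply: measurable_maxr => //; exact: measurableT_comp.
have bp x : 0 <= fp x <= M.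
  rewrite /fp le_max lexx orbT ge_max M0 andbT/=.
  exact: le_trans (ler_norm _) (hM x).
have bn x : 0 <= fn x <= M.
  rewrite /fn le_max lexx orbT ge_max M0 andbT/=.
  by apply: le_trans (ler_norm _) _; rewrite normrN.
have fE x : f x = fp x - fn x.
  by rewrite /fp /fn; case: (lerP (f x) 0) => h; case: (lerP (- f x) 0) => h'; lra.
have bnd (u : X -> R) (c : RA) : (forall x, 0 <= u x <= M) -> measurable_fun setT (u : borel X -> R) ->
    (\int[leb]_(s in I01) (u (arc_param c s))%:E <= M%:E)%E.
  move=> hu mu; apply: (@le_trans _ _ (\int[leb]_(s in I01) (cst M%:E s))%E).
    apply: ge0_le_lower_integral => s _; rewrite lee_fin; by have /andP[] := hu (arc_param c s).
  rewrite integral_cst//.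
  by rewrite /= lebesgue_measure_itv/= lte_fin ltr01 oppr0 adde0 mule1.
have aE c : arc_integral c (EFin \o f) =
    (arc_integral c (EFin \o fp) - arc_integral c (EFin \o fn))%E.
  rewrite !arc_integralE.
  have finn : (\int[leb]_(s in I01) (fn (arc_param c s))%:E)%E \is a fin_num.
    rewrite ge0_fin_numE; first by apply: le_lt_trans (bnd _ c bn mfn) _; rewrite ltry.
    by apply: integral_ge0 => s _; rewrite lee_fin; have /andP[] := bn (arc_param c s).
  rewrite -muleBr//; last by rewrite fin_num_adde_defl// fin_numN.
  congr (_ * _)%E; rewrite integralE; congr (_ - _)%E; apply: eq_integral => s _.
    by rewrite funeposE /= EFin_max.
  by rewrite funenegE /= EFin_max.
have key (u : X -> R) : (forall x, 0 <= u x <= M) -> measurable_fun setT (u : borel X -> R) ->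
    [/\ measurable_fun (A : set (borel RA)) (fun c => arc_integral c (EFin \o u)),
     (forall c, 0 <= arc_integral c (EFin \o u))%E,
     (\int[pi]_(c in A) arc_integral c (EFin \o u) = \int[m]_x ((u x)%:E * (k x)%:E))%E &
     (\int[m]_x ((u x)%:E * (k x)%:E) < +oo)%E].
  move=> hu mu.
  have mE : measurable_fun setT (EFin \o u : borel X -> \bar R) by exact/measurable_EFinP.
  have E0 x : (0 <= (EFin \o u) x)%E by rewrite lee_fin; have /andP[] := hu x.
  have [h1 h2] := arc_integral_fubini mE E0.
  split => //.
  - by move=> c; exact: arc_integral_ge0.
  - by rewrite -nuE// kI.
  - rewrite -kI//; apply: (@le_lt_trans _ _ (\int[nu]_x (cst M%:E x))%E).
      by apply: ge0_le_lower_integral => x _ //=; rewrite lee_fin; have /andP[] := hu x.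
    rewrite integral_cst//; apply: lte_mul_pinfty => //.
    by rewrite ltey_eq fin_num_measure.
have [mp p0 pE pf] := key _ bp mfp; have [mn n0 nE nf] := key _ bn mfn.
transitivity (\int[pi]_c (((fun c => arc_integral c (EFin \o fp)) \_ A) c -
   ((fun c => arc_integral c (EFin \o fn)) \_ A) c))%E.
  apply: (eq_integral_off mN offA) => c _ nN.
  rewrite aE /patch; case: ifPn => // /negP nA.
  have l0 : len c = 0.
    apply/eqP; rewrite eq_le len_ge0 andbT leNgt; apply/negP => l0; apply: nN.
    by split => // Ac; apply: nA; exact: mem_set.
  by rewrite !arc_integralE l0 !mul0e sube0.
have igA (G : borel RA -> \bar R) : measurable_fun (A : set (borel RA)) G -> (forall c, 0 <= G c)%E ->
    (\int[pi]_(c in A) G c < +oo)%E -> pi.-integrable setT (G \_ A).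
  move=> mG G0 fG; apply/integrableP; split.
    exact: (measurable_restrictT _ mA).1.
  move: fG; rewrite integral_mkcond; congr (_ < _)%E; apply: eq_integral => c _.
  by rewrite gee0_abs// erestrict_ge0.
rewrite integralB//; last 2 first.
- by apply: igA => //; rewrite pE.
- by apply: igA => //; rewrite nE.
rewrite -!integral_mkcond pE nE -integralB//.
- by apply: eq_integral => x _; rewrite -!EFinM -EFinB fE mulrBl.
- apply/integrableP; split.
    by apply: emeasurable_funM; [exact/measurable_EFinP|
      apply/measurable_EFinP; move: kq => /sub_Lfun_mfun; rewrite inE].
  rewrite (eq_integral (fun x => (fp x)%:E * (k x)%:E)%E)// => x _.
  by rewrite gee0_abs// mule_ge0// lee_fin//; have /andP[] := bp x.
- apply/integrableP; split.
    by apply: emeasurable_funM; [exact/measurable_EFinP|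
      apply/measurable_EFinP; move: kq => /sub_Lfun_mfun; rewrite inE].
  rewrite (eq_integral (fun x => (fn x)%:E * (k x)%:E)%E)// => x _.
  by rewrite gee0_abs// mule_ge0// lee_fin//; have /andP[] := bn x.
Qed.

End from_regular.

End barycenter.

(** * Cutting a plan at a uniform random time *)

(** A relatively closed subset of a compact set, with relative closedness expressed
by neighbourhoods in the ambient space. *)
Lemma compact_within_closed (T : topologicalType) (A E : set T) : compact A -> E `<=` A ->
  (forall p, A p -> ~ E p -> \forall p' \near p, A p' -> ~ E p') -> compact E.
Proof.
move=> cA EA h F FF FE.
have FA : F A by apply: filterS FE.
have [p [Ap cp]] := cA F FF FA; exists p; split => //.
have [//|nE] := pselect (E p).
have [p' [Ep' /(_ (EA _ Ep'))]] := cp _ _ FE (h p Ap nE).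
by [].
Qed.

Section plan.
Context {R : realType} {X : ptopologicalType} (d : extended_distance R X).
Local Notation RA := (rect_arc d).
Local Notation I01 := (`[0%R, 1%R]%classic : set R).
Local Notation leb := (@lebesgue_measure R).
Implicit Types (c : RA).
Hypothesis emt : emt_space d.
Context (q : R) (m : {finite_measure set (borel X) -> \bar R}).
Hypothesis q1 : 1 <= q.
Context (pi : {finite_measure set (borel RA) -> \bar R}).

Lemma arc_integral_indic_le (h : X -> R) (A : set RA) (B : set (borel X)) :
  barycenter_density q m pi h -> measurable B ->
  (\int[pi]_(c in A) arc_integral c (EFin \o \1_B) <= \int[m]_(x in B) `|h x|%:E)%E.
Proof.
move=> [hq hI] mB.
apply: (@le_trans _ _ (\int[pi]_c arc_integral c (EFin \o (\1_B : X -> R)))%E).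
  apply: lower_integral_subset => // c _; apply: arc_integral_ge0 => x.
  by rewrite lee_fin.
rewrite hI; last 2 first.
- exact: measurable_indic.
- by exists 1 => x; rewrite indicE; case: (_ \in _); rewrite ?normr1 ?normr0.
apply: (le_trans (integral_le_abse _ _ _)).
rewrite [leRHS]integral_mkcond; apply: ge0_le_lower_integral => x _ //.
rewrite /patch indicE; case: ifPn => _; first by rewrite mul1r.
by rewrite mul0r abse0.
Qed.

Section with_K.
Context (e : R) (K : set RA).
Hypothesis gK : regular_compact e K.
Hypothesis tp : T_plan q m pi.

Let mK : measurable (K : set (borel RA)).
Proof. exact: regular_compact_measurable gK. Qed.

Let goodK : regular_arcs K.
Proof. exact: regular_compact_regular gK. Qed.

Let leb1 : leb I01 = 1%E.
Proof. by rewrite lebesgue_measure_itv/= lte_fin ltr01 oppr0 adde0. Qed.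

Let integral_cst1 (x : \bar R) : (\int[leb]_(s in I01) x = x)%E.
Proof. by rewrite integral_cst//= leb1 mule1. Qed.

(** The law of an end of a random piece. A fixed end has the law of an end of the
arc; the end at a uniform time t has law at most 1/e times the barycenter, since
the time integral of an indicator along c is the arc integral divided by the
length, which is at least e on K. *)
Lemma endpoint_bound (ep : R -> R) : [\/ ep = cst 0, ep = cst 1 | ep = id] ->
  exists2 hh : X -> R, hh \in Lfun m q%:E & forall B : set (borel X), measurable B ->
  (\int[pi]_(c in K) \int[leb]_(t in I01) (\1_B (arc_param c (ep t)))%:E <=
   \int[m]_(x in B) `|hh x|%:E)%E.
Proof.
have cstcase (i : bool) : exists2 hh : X -> R, hh \in Lfun m q%:E &
  forall B : set (borel X), measurable B ->
  (\int[pi]_(c in K) \int[leb]_(t in I01) (\1_B (arc_param c (i%:R)))%:E <=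
   \int[m]_(x in B) `|hh x|%:E)%E.
  have [hi hiq hiE] := T_plan_marginal tp i; exists hi => // B mB.
  have me : measurable_fun setT (fun c : borel RA => arc_param c i%:R : borel X).
    by apply: endpoint_measurable => //; case: (i); [right|left].
  apply: (@le_trans _ _ (pushforward pi (fun c : borel RA => arc_param c i%:R : borel X) B)); last first.
    by rewrite hiE//; exact: integral_le_abse.
  have mB' : measurable ((fun c : borel RA => arc_param c i%:R : borel X) @^-1` B).
    by rewrite -[X in measurable X]setTI; exact: me.
  rewrite /pushforward; set pre := (X in measurable X) in mB' *.
  have -> : (pi pre = \int[pi]_c (\1_pre c : R)%:E)%E by rewrite integral_indic// setIT.
  under eq_integral do rewrite integral_cst1.
  by apply: lower_integral_subset => // c _; rewrite lee_fin.
case => ->.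
- exact: (cstcase false).
- exact: (cstcase true).
have [h hd] := Bar_density (T_plan_bar tp).
have [_ e0 eK _] := gK.
exists (e^-1 \o* h); first by apply: Lfun_scale => //; case: hd.
move=> B mB; have := arc_integral_indic_le K hd mB.
have mh : measurable_fun setT (h : borel X -> R) by case: hd => /sub_Lfun_mfun; rewrite inE.
have mah : measurable_fun setT (fun x : borel X => `|h x|) by exact: measurableT_comp.
have -> : (\int[m]_(x in B) `|(e^-1 \o* h) x|%:E = (e^-1)%:E * \int[m]_(x in B) `|h x|%:E)%E.
  rewrite -ge0_integralZl//; last 2 first.
  - by apply/measurable_EFinP; exact: measurable_funTS.
  - by rewrite lee_fin invr_ge0 ltW.
  by apply: eq_integral => x _; rewrite /= normrM mulrC [`|e^-1|]ger0_norm ?invr_ge0 ?(ltW e0)// EFinM.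
move=> /(lee_wpmul2l (x := (e^-1)%:E)); rewrite lee_fin invr_ge0 (ltW e0) => /(_ isT).
apply: le_trans.
have [mI _] := arc_integral_fubini emt pi mK goodK (indic_measurable mB) (fun x => ltac:(by rewrite lee_fin)).
rewrite -ge0_integralZl//; last 2 first.
- by move=> c _; apply: arc_integral_ge0 => x; rewrite lee_fin.
- by rewrite lee_fin invr_ge0 ltW.
apply: ge0_le_lower_integral => c Kc; first by apply: integral_ge0 => s _; rewrite lee_fin.
rewrite arc_integralE muleA -EFinM.
have I0 : (0 <= \int[leb]_(s in I01) (\1_B (arc_param c s) : R)%:E)%E.
  by apply: integral_ge0 => s _; rewrite lee_fin.
rewrite -[leLHS]mul1e; apply: lee_wpmul2r => //.
by rewrite lee_fin mulrC ler_pdivlMr// mul1r eK.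
Qed.

Context (a b : R -> R).
Hypothesis cab : cut a b.
Hypothesis epa : [\/ a = cst 0, a = cst 1 | a = id].
Hypothesis epb : [\/ b = cst 0, b = cst 1 | b = id].

Let D (p : RA * R) : RA := cutarc a b p.1 p.2.
Let cD : cont_on D K. Proof. exact: regular_cut. Qed.
Let Q : set RA := D @` (K `*` I01).
Let hRA : hausdorff_space RA. Proof. exact: rect_arc_hausdorff. Qed.

Let ab01 t : 0 <= t <= 1 -> [/\ 0 <= a t, a t <= b t & b t <= 1].
Proof. by move=> t01; have [_ _ + _] := cab; apply. Qed.

Let lenD p : (K `*` I01) p -> len (D p) = (b p.2 - a p.2) * len p.1.
Proof.
move=> [_]; rewrite /= in_itv/= => /ab01[? ? ?]; rewrite /D /cutarc len_subarc//.
Qed.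

Let cKI : compact (K `*` I01).
Proof. by apply: compact_setX; [case: gK|exact: segment_compact]. Qed.

Let cQ : compact Q. Proof. by apply: (cont_on_compact cD). Qed.

(** The length of the pieces of arcs in K is lower semicontinuous; it is also upper
semicontinuous, because the set of (c, t) whose piece has length at least x is
compact and so has a closed image. *)
Lemma len_continuous_cut : len_continuous_on Q.
Proof.
move=> c Qc eta eta0.
(* E collects the pairs whose piece is too long; its image is compact and
   does not contain c. *)
pose x := len c + eta.
pose E := (K `*` I01) `&` [set p | x <= (b p.2 - a p.2) * len p.1].
have cE : compact E.
  apply: (compact_within_closed cKI); first by move=> p [].
  move=> [c1 t1] /[dup] KI [/= Kc1]; rewrite in_itv/= => t101 nE.
  have [a0 ab b1] := ab01 t101.
  have lt : (b t1 - a t1) * len c1 < x.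
    by rewrite ltNge; apply/negP => h; apply: nE.
  set y := b t1 - a t1 in lt; set l := len c1 in lt.
  have y0 : 0 <= y by rewrite subr_ge0.
  have l0 : 0 <= l by exact: len_ge0.
  (* The margin z keeps (y + z) * (l + z) below x. *)
  pose z := Num.min 1 ((x - y * l) / (2 * (y + l + 1))).
  have yl0 : 0 < y + l + 1 by rewrite ltr_wpDl// addr_ge0.
  have z0 : 0 < z by rewrite lt_min ltr01 divr_gt0 ?subr_gt0// mulr_gt0.
  have z1 : z <= 1 by rewrite /z ge_min lexx.
  have zx : z * (y + l + 1) < x - y * l.
    have : z <= (x - y * l) / (2 * (y + l + 1)) by rewrite /z ge_min lexx orbT.
    rewrite ler_pdivlMr ?mulr_gt0//.
    have : 0 < z * (y + l + 1) by rewrite mulr_gt0.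
    by lra.
  have [_ _ _ hl] := gK.
  have ca : (fun t => b t - a t) @ t1 --> y.
    by have [ca cb _ _] := cab; apply: cvgB; [exact: cb|exact: ca].
  have h2 : \forall t \near t1, `|y - (b t - a t)| < z.
    by move/cvgrPdist_lt: ca; apply.
  exists ([set c' | K c' -> `|len c' - l| < z], [set t | `|y - (b t - a t)| < z]) => /=.
    by split => //; exact: hl.
  move=> [c' t'] /= [hc ht] [/= Kc']; rewrite in_itv/= => t'01 [_ /=].
  rewrite leNgt => /negP; apply.
  have [a0' ab' b1'] := ab01 t'01.
  have := hc Kc'; move: ht; rewrite !ltr_norml => /andP[t3 t4] /andP[l3 l4].
  have y1 : 0 <= b t' - a t' by rewrite subr_ge0.
  have y2 : b t' - a t' <= y + z by lra.
  have l2 : 0 <= len c' by exact: len_ge0.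
  have l5 : len c' <= l + z by lra.
  apply: (@le_lt_trans _ _ ((y + z) * (l + z))); first by rewrite ler_pM.
  have : z * z <= z by rewrite ler_piMl// ltW.
  by lra.
have cDE : closed (D @` E).
  by apply: compact_closed => //; apply: (cont_on_compact cD) => // p [].
have nDE : (~` (D @` E)) c.
  move=> [p [KIp /= xp] pc].
  by move: xp; rewrite -lenD// pc /x; lra.
have h1 : nbhs c (~` (D @` E)) by apply: open_nbhs_nbhs; split => //; exact: closed_openC.
have h2 : nbhs c [set c' : RA | len c - eta < len c'].
  by apply: open_nbhs_nbhs; split => /=; [exact: len_lsc|lra].
apply: filterS2 h1 h2 => c' n1 /= n2 [p KIp pc].
have n3 : len c' < x.
  rewrite ltNge; apply/negP => xc; apply: n1; exists p => //; split => //=.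
  by rewrite -lenD// pc.
by rewrite ltr_norml; apply/andP; split; rewrite /x in n3; lra.
Qed.

(** The law pi' of the piece of c, for c distributed as pi on K and t uniform. A piece
may have length zero, so the barycenter is obtained on the set A of pieces of
positive length, on which the length is continuous by [len_continuous_cut]. *)
Lemma plan_exists : exists2 pi' : {finite_measure set (borel RA) -> \bar R},
  T_plan q m pi' & forall N : set (borel RA), measurable N ->
    measurable_fun (K : set (borel RA))
      (fun c => \int[leb]_(t in I01) (\1_N (cutarc a b c t))%:E)%E /\
    pi' N = (\int[pi]_(c in K) \int[leb]_(t in I01) (\1_N (cutarc a b c t))%:E)%E.
Proof.
have mD := cont_on_measurable mK cD.
have mKI : measurable (K `*` I01 : set (borel RA * R)).
  by apply: measurableX => //; exact: measurable_itv.
have wfin : (\int[pi \x leb]_(p in (K `*` I01 : set (borel RA * R))) (1 : R)%:E < +oo)%E.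
  have [_ ->] := @fubini_restricted _ (borel RA) R pi K (fun=> 1%E) mK (@measurable_cst _ _ _ _ _ _) (fun=> lee01).
  under eq_integral do rewrite integral_cst1.
  by rewrite integral_cst// mul1e ltey_eq fin_num_measure.
have [pi' [piB piI]] := @mixture_finite _ _ (borel RA * measurableTypeR R)%type (borel RA) R (pi \x leb)%E
  (K `*` I01) mKI (fun=> 1) D (@measurable_cst _ _ _ _ _ _) (fun=> ler01) mD wfin.
have piF (F : borel RA -> \bar R) : measurable_fun setT F -> (forall c, 0 <= F c)%E ->
    measurable_fun (K : set (borel RA)) (fun c => \int[leb]_(t in I01) F (D (c, t)))%E /\
    (\int[pi']_c F c = \int[pi]_(c in K) \int[leb]_(t in I01) F (D (c, t)))%E.
  move=> mF F0; rewrite piI//.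
  have mG : measurable_fun (K `*` I01 : set (borel RA * R)) (fun p => F (D p)).
    exact: (measurable_comp measurableT _ mF mD).
  have [h1 h2] := fubini_restricted pi mK mG (fun p => F0 (D p)).
  by split => //; rewrite -h2; apply: eq_integral => p _; rewrite mul1e.
have piN (N : set (borel RA)) : measurable N ->
    measurable_fun (K : set (borel RA)) (fun c => \int[leb]_(t in I01) (\1_N (D (c, t)))%:E)%E /\
    pi' N = (\int[pi]_(c in K) \int[leb]_(t in I01) (\1_N (D (c, t)))%:E)%E.
  move=> mN; have mI : measurable_fun setT (EFin \o (\1_N : borel RA -> R)).
    by apply/measurable_EFinP; exact: measurable_indic.
  have [h1 h2] := piF _ mI (fun c => ltac:(by rewrite lee_fin)).
  by split => //; rewrite -h2 integral_indic// setIT.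
exists pi'; last exact: piN.
have mQ : measurable (Q : set (borel RA)) by exact: borel_compact.
pose A := Q `&` [set c : RA | 0 < len c].
have mA : measurable (A : set (borel RA)).
  by apply: measurableI => //; apply: borel_open; exact: len_lsc.
have gA : regular_arcs A.
  split=> [c []//|c [Qc _] eta eta0].
  by have := len_continuous_cut Qc eta0; apply: filterS => c' h [Qc' _]; exact: h.
have QD c t : K c -> I01 t -> Q (D (c, t)) by move=> Kc t01; exists (c, t).
split.
- apply: (radon_image hRA hRA (T_plan_radon tp) (K := K) (Phi := D)) => //; first by case: gK.
  move=> B mB; rewrite piB//.
  have mS : measurable ((K `*` I01 : set (borel RA * R)) `&` D @^-1` B) by exact: mD.
  transitivity (\int[pi \x leb]_(p in (K `*` I01 : set (borel RA * R)))
     (\1_((K `*` I01 : set (borel RA * R)) `&` D @^-1` B) p)%:E)%E.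
    apply: eq_integral => p /set_mem KIp; rewrite mul1e !indicE; congr (_%:R%:E).
    by apply: congr1; apply/idP/idP; rewrite !inE => // -[].
  apply: etrans.
    exact: (@integral_indic _ (borel RA * measurableTypeR R)%type R (pi \x leb)%E _ mKI _ mS).
  apply: (congr1 (pi \x leb)%E).
  by rewrite setIAC setIid.
- apply: density_Bar.
  have [h hd] := Bar_density (T_plan_bar tp).
  apply: (@barycenter_of_regular _ _ _ emt q m q1 pi' A mA gA _ h).
  + have mN : measurable (~` A `&` [set c : RA | 0 < len c] : set (borel RA)).
      apply: measurableI; first exact: measurableC.
      by apply: borel_open; exact: len_lsc.
    have [_ ->] := piN _ mN; apply: integral0_eq => c Kc; apply: integral0_eq => t t01.
    by rewrite indicE memNset// => -[nA l0]; apply: nA; split => //; exact: QD.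
  + by case: hd.
  + move=> B mB.
    have [mI _] := arc_integral_fubini emt pi' mA gA (indic_measurable mB) (fun x => ltac:(by rewrite lee_fin)).
    have a0 c : (0 <= arc_integral c (EFin \o (\1_B : X -> R)))%E.
      by apply: arc_integral_ge0 => x; rewrite lee_fin.
    rewrite integral_mkcond.
    pose G : borel RA -> \bar R := (fun c : borel RA => arc_integral c (EFin \o (\1_B : X -> R))) \_ (A : set (borel RA)).
    have mG : measurable_fun setT G.
      exact: (measurable_restrictT _ mA).1.
    have G0 c : (0 <= G c)%E by apply: erestrict_ge0.
    have [_ ->] := piF _ mG G0.
    apply: le_trans (arc_integral_indic_le K hd mB).
    apply: ge0_le_lower_integral => c Kc.
      by apply: integral_ge0 => t _; exact: G0.
    rewrite -[leRHS]integral_cst1; apply: ge0_le_lower_integral => t t01.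
      exact: G0.
    have Gle c' : (G c' <= arc_integral c' (EFin \o (\1_B : X -> R)))%E.
      rewrite /G /patch; case: ifPn => _; first exact: lexx.
      exact: a0.
    apply: (le_trans (Gle _)).
    move: t01; rewrite /= in_itv/= => /ab01[at0 abt bt1].
    have B0 (x : borel X) : (0 <= (EFin \o (\1_B : X -> R)) x)%E by rewrite lee_fin.
    exact: (arc_integral_subarc_le emt c (indic_measurable mB) B0 at0 abt bt1).
- move=> i.
  have me : measurable_fun setT (fun c : borel RA => arc_param c i%:R : borel X).
    by apply: endpoint_measurable => //; case: (i); [right|left].
  (* The time on c of the end i of the piece. *)
  pose ep : R -> R := if i then b else a.
  have epE c t : I01 t -> arc_param (D (c, t)) i%:R = arc_param c (ep t).
    rewrite /= in_itv/= => /ab01[? ? ?]; rewrite /D /cutarc subarc_param//.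
    rewrite /ep; case: (i); first by rewrite clampRge1// mulr1 addrC subrK.
    by rewrite clampRle0// mulr0 addr0.
  have [hh hhq hhb] : exists2 hh : X -> R, hh \in Lfun m q%:E & forall B : set (borel X), measurable B ->
    (\int[pi]_(c in K) \int[leb]_(t in I01) (\1_B (arc_param c (ep t)))%:E <=
     \int[m]_(x in B) `|hh x|%:E)%E.
    by apply: endpoint_bound; rewrite /ep; case: (i).
  have [nu [nuB _]] := @mixture_finite _ _ (borel RA) (borel X) R pi' setT measurableT (fun=> 1)
    (fun c => arc_param c i%:R) (@measurable_cst _ _ _ _ _ _) (fun=> ler01) me
    (ltac:(by rewrite integral_cst// mul1e ltey_eq fin_num_measure)).
  have nuE B : measurable B -> nu B = pi' ((fun c : borel RA => arc_param c i%:R : borel X) @^-1` B).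
    move=> mB; rewrite nuB//.
    have mB' : measurable ((fun c : borel RA => arc_param c i%:R : borel X) @^-1` B).
      by rewrite -[X in measurable X]setTI; exact: me.
    set pre := (X in measurable X) in mB' *.
    transitivity (\int[pi']_c (\1_pre c : R)%:E)%E; last by rewrite integral_indic// setIT.
    by apply: eq_integral => c _; rewrite mul1e.
  have dom (B : set (borel X)) : measurable B -> (nu B <= \int[m]_(x in B) `|hh x|%:E)%E.
    move=> mB; apply: le_trans (hhb _ mB); rewrite nuE//.
    have mB' : measurable ((fun c : borel RA => arc_param c i%:R : borel X) @^-1` B).
      by rewrite -[X in measurable X]setTI; exact: me.
    have [_ ->] := piN _ mB'.
    rewrite le_eqVlt; apply/orP; left; apply/eqP.
    apply: eq_integral => c _; apply: eq_integral => t /set_mem t01.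
    by rewrite -(epE c t t01).
  have [k [kq kE _ _]] := dominated_density q1 hhq dom.
  by exists k => // B mB; rewrite -kE// nuE.
Qed.

End with_K.

End plan.

Section T_ae_cut.
Context {R : realType} {X : ptopologicalType} (d : extended_distance R X).
Local Notation RA := (rect_arc d).
Local Notation I01 := (`[0%R, 1%R]%classic : set R).
Local Notation leb := (@lebesgue_measure R).
Hypothesis emt : emt_space d.
Context (q : R) (m : {finite_measure set (borel X) -> \bar R}).
Hypothesis q1 : 1 <= q.

Lemma ge0_integral_eq0_ae dT (T : measurableType dT) (mu : {measure set T -> \bar R})
  (A : set T) (F : T -> \bar R) : measurable A -> measurable_fun A F ->
  (forall x, 0 <= F x)%E -> (\int[mu]_(x in A) F x = 0)%E ->
  {ae mu, forall x, A x -> F x = 0%E}.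
Proof.
move=> mA mF F0 I0; have : ae_eq mu A F (cst 0%E).
  apply: (ae_eq_integral_abs mu mA mF).1; rewrite -I0.
  by apply: eq_integral => x _; rewrite gee0_abs.
by apply: filterS => x h Ax; exact: h.
Qed.

(** An exceptional Borel set is null for the law of the random piece of any plan. *)
Lemma T_ae_cut (a b : R -> R) (P : RA -> Prop) : cut a b ->
  [\/ a = cst 0, a = cst 1 | a = id] -> [\/ b = cst 0, b = cst 1 | b = id] ->
  T_ae q m P ->
  T_ae q m (fun c => 0 < len c -> {ae leb, forall t, 0 <= t <= 1 -> P (cutarc a b c t)}).
Proof.
move=> cab ea eb hP pi tp; apply: ae_of_regular_compact => //; first exact: T_plan_radon tp.
move=> e K gK; have mK := regular_compact_measurable emt gK.
have [pi' tp' piN] := plan_exists emt q1 gK tp cab ea eb.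
have [N [mN N0 PN]] := hP _ tp'.
have [mF] := piN _ mN; rewrite N0 => /esym I0.
have := ge0_integral_eq0_ae mK mF _ I0.
have F0 (x : RA) : (0 <= \int[leb]_(t in I01) (\1_N (cutarc a b x t) : R)%:E)%E.
  by apply: integral_ge0 => t _; rewrite lee_fin.
move=> /(_ F0); apply: filterS => c hc Kc.
have cD := regular_cut emt cab (regular_compact_regular gK).
have mD := cont_on_measurable mK cD.
have mt : measurable_fun I01 (fun t : R => (\1_N (cutarc a b c t) : R)%:E).
  apply/measurable_EFinP.
  have mDc : measurable_fun I01 (fun t : R => cutarc a b c t : borel RA).
    move=> _ B mB; have := mD _ _ mB => /(_ ltac:(by apply: measurableX => //; exact: measurable_itv)).
    move=> /(measurable_xsection c); congr measurable.
    apply/seteqP; split => t; rewrite /xsection/= inE/=.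
      by move=> [[_ t01] Bt].
    by move=> [t01 Bt].
  exact: (measurable_comp measurableT _ _ mDc).
have mt0 (t : R) : (0 <= (\1_N (cutarc a b c t) : R)%:E)%E by rewrite lee_fin.
have := @ge0_integral_eq0_ae _ _ leb I01 _ (measurable_itv _) mt mt0 (hc Kc).
apply: filterS => t ht t01.
have : I01 t by rewrite /= in_itv.
move=> /ht; rewrite indicE; case: (boolP (_ \in N)) => [_|/negP nN _].
  by move=> [] /eqP; rewrite oner_eq0.
have [//|nP] := pselect (P (cutarc a b c t)).
by exfalso; apply: nN; apply: mem_set; exact: PN.
Qed.

End T_ae_cut.

(** * Functions controlled by the primitive of an integrable function *)

Section primitive.
Context {R : realType}.
Local Notation leb := (@lebesgue_measure R).
Context (G : R -> R).
Hypothesis G0 : forall x, 0 <= G x.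
Hypothesis iG : leb.-integrable setT (EFin \o G).

Definition primitive (t : R) : R := \int[leb]_(x in `]-oo, t]) G x.

Let iGS (A : set (measurableTypeR R)) : measurable A -> leb.-integrable A (EFin \o G).
Proof. by move=> mA; exact: integrableS iG. Qed.

Lemma primitiveB s t : s <= t ->
  (primitive t - primitive s)%:E = (\int[leb]_(x in `]s, t]) (G x)%:E)%E.
Proof.
move=> st; rewrite /primitive Rintegral_itvB//; last exact: iGS.
by rewrite /Rintegral fineK//; apply: integrable_fin_num => //; exact: iGS.
Qed.

Lemma primitive_homo s t : s <= t -> primitive s <= primitive t.
Proof.
move=> st; rewrite -subr_ge0 -lee_fin primitiveB//.
by apply: integral_ge0 => x _; rewrite lee_fin.
Qed.

Lemma integral_disjoint_itvs n (u v : nat -> R) (h : R -> \bar R) :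
  measurable_fun setT h -> (forall x, 0 <= h x)%E ->
  trivIset `I_n (fun i => `]u i, v i[%classic) ->
  (\int[leb]_(x in \big[setU/set0]_(i <- iota 0 n) `]u i, v i[%classic) h x =
   \sum_(i < n) \int[leb]_(x in `]u i, v i]) h x)%E.
Proof.
move=> mh h0 tuv.
have mu i : measurable (`]u i, v i[%classic : set (measurableTypeR R)) by exact: measurable_itv.
have tuv' : trivIset [set` iota 0 n] (fun i => `]u i, v i[%classic).
  by apply: sub_trivIset tuv => i /=; rewrite mem_iota add0n.
rewrite (@ge0_integral_bigsetU _ _ R leb _ (fun i => `]u i, v i[%classic : set (measurableTypeR R)))//.
- have -> : iota 0 n = index_iota 0 n by rewrite /index_iota subn0.
  rewrite big_mkord; apply: eq_bigr => i _.
  by rewrite integral_itv_bndo_bndc//; exact: measurable_funTS.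
- exact: iota_uniq.
- exact: measurable_funTS.
Qed.

(** Absolute continuity of the integral, on the union of the intervals. *)
Lemma primitive_ac (e : R) : 0 < e -> exists2 k : R, 0 < k &
  forall n (u v : nat -> R), (forall i, (i < n)%N -> u i <= v i) ->
    trivIset `I_n (fun i => `]u i, v i[%classic) ->
    \sum_(i < n) (v i - u i) < k ->
    \sum_(i < n) (primitive (v i) - primitive (u i)) < e.
Proof.
move=> e0; have [k [k0 hk]] := integral_normr_continuous iG e0.
exists k => // n u v uv tuv suv.
pose A := \big[setU/set0]_(i <- iota 0 n) (`]u i, v i[%classic : set (measurableTypeR R)).
have mA : measurable A by apply: bigsetU_measurable => i _; exact: measurable_itv.
have mG : measurable_fun setT (EFin \o G) by exact: measurable_int iG.
have G0' x : (0 <= (EFin \o G) x)%E by rewrite lee_fin.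
have lA : leb A = (\sum_(i < n) (v i - u i))%:E.
  rewrite -[LHS]mul1e -integral_cst//.
  rewrite integral_disjoint_itvs//.
  rewrite -sumEFin; apply: eq_bigr => i _; rewrite integral_cst//= mul1e.
  rewrite lebesgue_measure_itv/= lte_fin -EFinD; case: ltP => // vu.
  by have := uv i (ltn_ord i); rewrite le_eqVlt ltNge vu orbF => /eqP ->; rewrite subrr.
have lAk : (leb A < k%:E)%E by rewrite lA lte_fin.
have := hk A mA lAk.
have -> : \int[leb]_(x in A) `|G x| = \sum_(i < n) (primitive (v i) - primitive (u i)).
  apply: EFin_inj; rewrite /Rintegral fineK; last first.
    apply: integrable_fin_num => //; apply: eq_integrable (iGS mA) => // x _.
    by rewrite /= ger0_norm.
  under eq_integral do rewrite ger0_norm//.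
  rewrite (integral_disjoint_itvs mG G0' tuv) -sumEFin; apply: eq_bigr => i _.
  by rewrite primitiveB// uv.
by [].
Qed.

Lemma primitive_cauchy (e : R) : 0 < e -> exists2 k : R, 0 < k &
  forall s t, s <= t -> t - s < k -> primitive t - primitive s < e.
Proof.
move=> /primitive_ac[k k0 hk]; exists k => // s t st tsk.
have := hk 1%N (fun=> s) (fun=> t) (fun _ _ => st); rewrite !big_ord1; apply => //.
by move=> i j; rewrite /= !ltnS !leqn0 => /eqP -> /eqP ->.
Qed.

Lemma primitive_cvg s : primitive t @[t --> s] --> primitive s.
Proof.
apply/cvgrPdist_lt => e e0; have [k k0 hk] := primitive_cauchy e0.
apply/nbhs_ballP; exists k => //= t; rewrite /ball/= => stk.
have [st|/ltW ts] := leP s t.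
  rewrite distrC ger0_norm ?subr_ge0 ?primitive_homo//; apply: hk => //.
  by move: stk; rewrite distrC ger0_norm// subr_ge0.
rewrite ger0_norm ?subr_ge0 ?primitive_homo//; apply: hk => //.
by move: stk; rewrite ger0_norm// subr_ge0.
Qed.

Section controlled.
Context (F : R -> R).
Hypothesis FG : forall s t, s <= t -> `|F t - F s| <= primitive t - primitive s.

Lemma controlled_ac : absolutely_continuous_on 0 1 F.
Proof.
move=> e e0; have [k k0 hk] := primitive_ac e0; exists k => // n u v uv tuv suv.
apply: le_lt_trans (hk n u v _ tuv suv); last by move=> i /uv[].
by apply: ler_sum => i _; apply: FG; have [] := uv i (ltn_ord i).
Qed.

End controlled.
End primitive.

(** * Almost everywhere derivability *)

Section derivability.
Context {R : realType}.
Local Notation leb := (@lebesgue_measure R).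
Context (G : R -> R).
Hypothesis G0 : forall x, 0 <= G x.
Hypothesis iG : leb.-integrable setT (EFin \o G).
Local Notation primitive := (primitive G).
Context (F : R -> R).
Hypothesis FG : forall s t, s <= t -> `|F t - F s| <= primitive t - primitive s.

Let H t := primitive t + F t.

Let H_homo : {homo H : s t / s <= t}.
Proof. by move=> s t st; have := FG st; rewrite ler_norml /H => /andP[+ _]; lra. Qed.

Let H_le s t : s <= t -> H t - H s <= 2 * (primitive t - primitive s).
Proof. by move=> st; have := FG st; rewrite ler_norml /H => /andP[_ +]; lra. Qed.

Let H_continuous : continuous H.
Proof.
move=> s; apply/cvgrPdist_lt => e e0.
have e20 : 0 < e / 2 by rewrite divr_gt0.
have [k k0 hk] := primitive_cauchy G0 iG e20.
apply/nbhs_ballP; exists k => //= t; rewrite /ball/= => stk.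
have [st|/ltW ts] := leP s t.
  rewrite distrC ger0_norm ?subr_ge0 ?H_homo//; have := H_le st.
  have : primitive t - primitive s < e / 2.
    by apply: hk => //; move: stk; rewrite distrC ger0_norm// subr_ge0.
  by lra.
rewrite ger0_norm ?subr_ge0 ?H_homo//; have := H_le ts.
have : primitive s - primitive t < e / 2.
  by apply: hk => //; move: stk; rewrite ger0_norm// subr_ge0.
by lra.
Qed.

Let P t := 2 * primitive t.

Let P_homo : {homo P : s t / s <= t}.
Proof. by move=> s t st; rewrite /P ler_pM2l//; exact: primitive_homo. Qed.

Let P_continuous : continuous P.
Proof. by move=> s; apply: cvgMr; exact: primitive_cvg. Qed.

Let Hc : cumulative R R :=
  HB.pack H (@isCumulative.Build R _ R H H_homo (right_continuousW H_continuous)).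

Let Pc : cumulative R R :=
  HB.pack P (@isCumulative.Build R _ R P P_homo (right_continuousW P_continuous)).

Let lsH_le (A : set (measurableTypeR R)) :
  (lebesgue_stieltjes_measure Hc A <= lebesgue_stieltjes_measure Pc A)%E.
Proof.
rewrite /lebesgue_stieltjes_measure /measure_extension /mu_ext.
apply: le_ereal_inf_tmp => _ [B BA <-].
apply: ge_ereal_inf; exists (\sum_(k <oo) wlength Hc (B k))%E; first by exists B.
apply: lee_nneseries => [k _ _|k _]; first exact: (wlength_ge0 Hc).
have [mB _] := BA; have [[a b] _ <-] := mB k => /=.
have [ab|ba] := leP a b; last by rewrite set_itv_ge ?bnd_simp -?leNgt ?(ltW ba)// !wlength0.
by rewrite !wlength_itv_bnd// lee_fin /= /P -mulrBr; exact: H_le.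
Qed.

Let w_meas' : measurable_fun setT (fun x => 2 * G x).
Proof.
apply: measurable_funM => //.
by apply/measurable_EFinP; exact: measurable_int iG.
Qed.

Let w_meas : measurable_fun setT (fun x => (2 * G x)%:E).
Proof.
exact/measurable_EFinP.
Qed.

Let w_ge0 x : 0 <= 2 * G x.
Proof. by rewrite mulr_ge0. Qed.

Let lebesgue_stieltjes_ocitv (f : cumulative R R) (a b : R) : a <= b ->
  lebesgue_stieltjes_measure f `]a, b] = (f b - f a)%:E.
Proof.
move=> ab; rewrite -(wlength_itv_bnd f false false ab).
by apply: measurable_mu_extE; exact: is_ocitv.
Qed.

Let lsP_density : forall A : set (measurableTypeR R), measurable A ->
  lebesgue_stieltjes_measure Pc A = (\int[leb]_(x in A) (2 * G x)%:E)%E.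
Proof.
have [nu [nuB _]] := @mixture_measure _ _ (measurableTypeR R) (measurableTypeR R) R leb setT
  measurableT (fun x => 2 * G x) id w_meas' w_ge0 (@measurable_id _ _ _).
have nuE (A : set (measurableTypeR R)) : measurable A ->
    nu A = (\int[leb]_(x in A) (2 * G x)%:E)%E.
  move=> mA; rewrite nuB [RHS]integral_mkcond; apply: eq_integral => x _.
  by rewrite /patch indicE; case: (_ \in _); rewrite ?mule1 ?mule0.
move=> A mA; rewrite -nuE//; apply: lebesgue_stieltjes_measure_unique => // B [[a b] _ <-] /=.
rewrite nuE; last exact: measurable_itv.
have [ab|ba] := leP a b; last first.
  by rewrite set_itv_ge ?bnd_simp -?leNgt ?(ltW ba)// measure0 integral_set0.
rewrite lebesgue_stieltjes_ocitv// /= /P -mulrBr EFinM primitiveB// -ge0_integralZl//.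
- by apply: measurable_funTS; exact: measurable_int iG.
- by move=> x _; rewrite lee_fin.
Qed.

(** The function H = primitive + F is nondecreasing with increments at most twice
those of the primitive. As outer measures are monotone in the length function,
the Stieltjes measure of H is at most that of twice the primitive, which is
2 G times Lebesgue measure. Hence H is the primitive of an integrable function,
is derivable almost everywhere, and so is F = H - primitive. The bound on the
derivative is the limit of the bound on difference quotients. *)
Lemma controlled_derivable : {ae leb, forall t : R, 0 < t ->
  derivable F t 1 /\ `|derive1 F t| <= G t}.
Proof.
pose LS := lebesgue_stieltjes_measure Hc.
have LSfin : (\int[LS]_(x in setT) (1 : R)%:E < +oo)%E.
  rewrite integral_cst// mul1e; apply: le_lt_trans (lsH_le setT) _.
  rewrite lsP_density//.
  have := integrable_lty measurableT (integrableZl measurableT 2 iG).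
  by under eq_integral do rewrite -EFinM.
have [nu [nuB _]] := @mixture_finite _ _ (measurableTypeR R) (measurableTypeR R) R LS setT
  measurableT (fun=> 1) id (@measurable_cst _ _ _ _ _ _) (fun=> ler01) (@measurable_id _ _ _) LSfin.
have nuE (A : set (measurableTypeR R)) : measurable A -> nu A = LS A.
  move=> mA; rewrite nuB//; under eq_integral do rewrite mul1e.
  by rewrite integral_indic// setIT.
have dom : nu `<< leb.
  apply/null_content_dominatesP => A mA A0; rewrite nuE//; apply/eqP.
  rewrite eq_le measure_ge0 andbT; apply: le_trans (lsH_le A) _; rewrite lsP_density//.
  rewrite (@null_set_integral _ _ _ leb A _ mA)//.
  by apply: measurable_funTS; exact: w_meas.
pose k0 := Radon_Nikodym_SigmaFinite.f nu leb.
have k0fin := Radon_Nikodym_SigmaFinite.f_fin_num dom.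
have k0int := Radon_Nikodym_SigmaFinite.f_integrable dom.
pose k x := fine (k0 x).
have kE : EFin \o k = k0 by apply/funext => x; rewrite /= fineK.
have ik : leb.-integrable setT (EFin \o k) by rewrite kE.
have HE t : 0 < t -> H t = H 0 + \int[leb]_(x in [set` Interval (BRight 0) (BRight t)]) k x.
  move=> t0; apply/eqP; rewrite addrC -subr_eq; apply/eqP; apply: EFin_inj.
  rewrite /Rintegral fineK; last first.
    by apply: integrable_fin_num => //; exact: integrableS ik.
  rewrite -[RHS]/(\int[leb]_(x in `]0%R, t]) (EFin \o k) x)%E kE.
  rewrite -(Radon_Nikodym_SigmaFinite.f_integral dom); last exact: measurable_itv.
  rewrite nuE; last exact: measurable_itv.
  exact: (esym (lebesgue_stieltjes_ocitv Hc (ltW t0))).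
have iky y : leb.-integrable [set` Interval (BRight 0) (BRight y)] (EFin \o k).
  exact: integrableS ik.
have locT (h : R -> R) : leb.-integrable setT (EFin \o h) -> locally_integrable setT h.
  by move=> ih; apply: open_integrable_locally => //; exact: openT.
have iGy y : leb.-integrable `]-oo, y] (EFin \o G) by exact: integrableS iG.
have := FTC1Ny iGy (locT _ iG).
have := FTC1 iky (locT _ ik).
apply: filterS2; first exact: (ae_filter_ringOfSetsType leb).
move=> t; rewrite lte_fin => + dP t0 => /(_ t0)[dk _].
have dH : derivable H t 1.
  have dHk := @derivableD _ _ _ (cst (H 0)) _ _ _ (derivable_cst (H 0) t 1) dk.
  apply: near_eq_derivable dHk.
  near=> s; rewrite /= [RHS]HE//.
  by near: s; exact: lt_nbhsr.
have [dG dGE] := dP.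
have dF : derivable F t 1.
  have -> : F = H - primitive by apply/funext => s; rewrite -[RHS]/(primitive s + F s - primitive s) addrC addKr.
  exact: derivableB.
split => //; rewrite derive1E.
rewrite -dGE derive1E.
have dFn := cvg_norm dF _.
refine (ler_cvg_to (dFn _) dG _); near=> h.
have h1 : h%:A + t = h + t by rewrite -[h%:A]/(h * 1) mulr1.
rewrite /= h1 -[leRHS]/(h^-1 * (primitive (h + t) - primitive t)).
rewrite -[X in `|X|]/(h^-1 * (F (h + t) - F t)).
have [h0|h0] := leP 0 h.
  rewrite normrM ger0_norm ?invr_ge0// ler_wpM2l ?invr_ge0//.
  by apply: FG; rewrite lerDr.
rewrite normrM ltr0_norm ?invr_lt0// -[leRHS]mulrNN opprB ler_wpM2l ?oppr_ge0 ?invr_le0 ?(ltW h0)//.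
by rewrite distrC; apply: FG; rewrite gerDr ltW.
Unshelve. all: by end_near. Qed.

End derivability.

(** * Null sets of the line, uniqueness and extension *)

Section ae_real.
Context {R : realType}.
Local Notation leb := (@lebesgue_measure R).

Lemma ae_mono (P Q : R -> Prop) : (forall x, P x -> Q x) ->
  {ae leb, forall x, P x} -> {ae leb, forall x, Q x}.
Proof.
by move=> PQ; apply: filterS => //; exact: (ae_filter_ringOfSetsType leb).
Qed.

Lemma ae_and (P Q : R -> Prop) :
  {ae leb, forall x, P x} -> {ae leb, forall x, Q x} -> {ae leb, forall x, P x /\ Q x}.
Proof. by apply: filterI; exact: (ae_filter_ringOfSetsType leb). Qed.

End ae_real.

Section almost_everywhere_line.
Context {R : realType}.
Local Notation leb := (@lebesgue_measure R).

Lemma ae_scale (k : R) (P : R -> Prop) : 0 < k ->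
  {ae leb, forall r, P r} -> {ae leb, forall x, P (k * x)}.
Proof.
move=> k0 [N [mN N0 PN]].
have mk : measurable_fun setT (fun s : R => 0 + k * s : measurableTypeR R).
  exact: affine_measurable.
have mpre : measurable ((fun s : R => 0 + k * s : measurableTypeR R) @^-1` N : set (measurableTypeR R)).
  by rewrite -[X in measurable X]setTI; exact: mk.
exists ((fun s : R => 0 + k * s : measurableTypeR R) @^-1` N); split => //; last first.
  by move=> x nP; apply: PN; rewrite add0r.
have mI : measurable_fun setT (fun x : R => (\1_N x : R)%:E).
  by apply/measurable_EFinP; exact: measurable_indic.
have I0 (x : R) : (0 <= (\1_N x : R)%:E)%E by rewrite lee_fin.
have IN0 : (\int[leb]_x (\1_N x : R)%:E = 0)%E.
  by apply: (etrans (@integral_indic _ (measurableTypeR R) R leb _ measurableT _ mN)); rewrite setIT.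
have := integral_affine 0 k0 mI I0; rewrite IN0 => /esym.
pose pre : set (measurableTypeR R) := (fun s : R => 0 + k * s : measurableTypeR R) @^-1` N.
have -> : (\int[leb]_x (k%:E * (\1_N (0 + k * x) : R)%:E) = k%:E * \int[leb]_x (\1_pre x : R)%:E)%E.
  rewrite ge0_integralZl//; last by rewrite lee_fin ltW.
  by apply/measurable_EFinP; exact: measurable_indic.
rewrite (@integral_indic _ (measurableTypeR R) R leb _ measurableT _ mpre) setIT.
move=> /eqP; rewrite mule_eq0 => /orP[|/eqP//].
by rewrite eqe gt_eqF.
Qed.

Lemma ae_itv_exists (P : R -> Prop) (a b : R) : a < b ->
  {ae leb, forall x, P x} -> exists2 x, a < x < b & P x.
Proof.
move=> ab [N [mN N0 PN]]; apply: contrapT => h.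
have sub : `]a, b[%classic `<=` N.
  move=> x /=; rewrite in_itv/= => xab; apply: PN => /= Px.
  by apply: h; exists x.
have : (leb `]a, b[%classic <= leb N)%E.
  by apply: le_measure => //; rewrite inE//; exact: measurable_itv.
rewrite N0 lebesgue_measure_itv/= lte_fin ab -EFinD lee_fin.
by rewrite subr_le0 leNgt ab.
Qed.

Lemma ae_neq (a : R) : {ae leb, forall x : R, x <> a}.
Proof.
exists [set a]; split => //; first exact: lebesgue_measure_set1.
by move=> x /= /contrapT.
Qed.

Lemma ac_cauchy (F : R -> R) : absolutely_continuous_on 0 1 F -> forall e, 0 < e ->
  exists2 k, 0 < k & forall u v, 0 <= u -> u <= v -> v <= 1 -> v - u < k -> `|F v - F u| < e.
Proof.
move=> acF e /acF[k k0 hk]; exists k => // u v u0 uv v1 uvk.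
have := hk 1%N (fun=> u) (fun=> v) (fun _ _ => And3 u0 uv v1); rewrite !big_ord1; apply => //.
by move=> i j; rewrite /= !ltnS !leqn0 => /eqP -> /eqP ->.
Qed.

(** Two continuous functions that agree on a dense set. *)
Lemma ac_ae_unique (F F' : R -> R) :
  absolutely_continuous_on 0 1 F -> absolutely_continuous_on 0 1 F' ->
  {ae leb, forall t : R, 0 <= t <= 1 -> F t = F' t} ->
  forall t, 0 <= t <= 1 -> F t = F' t.
Proof.
move=> acF acF' FF' t /andP[t0 t1].
apply/eqP; rewrite -subr_eq0 -normr_le0; apply/ler_addgt0Pr => e e0; rewrite add0r.
have e20 : 0 < e / 2 by rewrite divr_gt0.
have [k k0 hk] := ac_cauchy acF e20.
have [k' k'0 hk'] := ac_cauchy acF' e20.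
have close x : 0 <= x <= 1 -> `|x - t| < k -> `|x - t| < k' -> F x = F' x -> `|F t - F' t| <= e.
  move=> /andP[x0 x1] xk xk' E.
  have [h1 h2] : `|F x - F t| < e / 2 /\ `|F' x - F' t| < e / 2.
    rewrite ltr_norml in xk; rewrite ltr_norml in xk'.
    case/andP: xk => xk1 xk2; case/andP: xk' => xk3 xk4.
    have [xt|/ltW tx] := leP x t; last by split; [apply: hk|apply: hk'] => //; lra.
    by rewrite (distrC (F x)) (distrC (F' x)); split; [apply: hk|apply: hk'] => //; lra.
  have -> : F t - F' t = (F' x - F' t) - (F x - F t) by rewrite E; ring.
  by apply: (le_trans (ler_normB _ _)); lra.
(* An interval of length r on one side of t stays inside [0, 1]. *)
pose r := Num.min (1 / 4) (Num.min k k').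
have [r0 r4 rk rk'] : [/\ 0 < r, r <= 1 / 4, r <= k & r <= k'].
  by rewrite /r !lt_min !ge_min !lexx k0 k'0 !orbT andbT; split => //; lra.
clearbody r.
have [th|th] := leP t (1 / 2).
  have ttr : t < t + r by lra.
  have [x /andP[x1 x2] E] := ae_itv_exists ttr FF'.
  have x01 : 0 <= x <= 1 by apply/andP; split; lra.
  have xt : `|x - t| < r by rewrite ltr_norml; apply/andP; split; lra.
  by apply: (close x x01); [exact: lt_le_trans rk|exact: lt_le_trans rk'|exact: E].
have ttr : t - r < t by lra.
have [x /andP[x1 x2] E] := ae_itv_exists ttr FF'.
have x01 : 0 <= x <= 1 by apply/andP; split; lra.
have xt : `|x - t| < r by rewrite ltr_norml; apply/andP; split; lra.
by apply: (close x x01); [exact: lt_le_trans rk|exact: lt_le_trans rk'|exact: E].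
Qed.

End almost_everywhere_line.

(** McShane's formula: the extension is the lower envelope of the cones with vertices
on the graph of phi. *)
Lemma mcshane (T : Type) (R : realType) (S : set T) (s0 : T) (phi rho : T -> R) : S s0 ->
  (forall s t, S s -> S t -> `|phi t - phi s| <= `|rho t - rho s|) ->
  exists F : T -> R, (forall s, S s -> F s = phi s) /\
    forall s t, `|F t - F s| <= `|rho t - rho s|.
Proof.
move=> Ss0 h.
pose V t := [set phi s + `|rho t - rho s| | s in S].
have lbV t : lbound (V t) (phi s0 - `|rho t - rho s0|).
  move=> _ [s Ss <-]; have := h s s0 Ss Ss0; rewrite ler_norml => /andP[_].
  by have := ler_distD (rho t) (rho s0) (rho s); rewrite (distrC (rho s0) (rho t)); lra.
have hV t : has_inf (V t) by split; [exists (phi s0 + `|rho t - rho s0|); exists s0|exists (phi s0 - `|rho t - rho s0|)].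
have one s t : inf (V t) - inf (V s) <= `|rho t - rho s|.
  rewrite lerBlDr -lerBlDl; apply: lb_le_inf; first by case: (hV s).
  move=> _ [u Su <-]; rewrite lerBlDl.
  apply: (@le_trans _ _ (phi u + `|rho t - rho u|)).
    by apply: ge_inf; [case: (hV t)|exists u].
  by have := ler_distD (rho s) (rho t) (rho u); lra.
exists (fun t => inf (V t)); split=> [s Ss|s t].
  apply/eqP; rewrite eq_le; apply/andP; split.
    by apply: ge_inf; [case: (hV s)|exists s; rewrite // subrr normr0 addr0].
  apply: lb_le_inf; first by case: (hV s).
  move=> _ [u Su <-]; have := h u s Su Ss; rewrite ler_norml => /andP[_].
  by lra.
rewrite ler_norml one andbT; have := one t s; rewrite (distrC (rho s)); lra.
Qed.

(** * Absolutely continuous versions from bounds on pieces *)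

Section line.
Context {R : realType}.
Local Notation leb := (@lebesgue_measure R).
Local Notation I01 := (`[0%R, 1%R]%classic : set R).

(** The analogue on the line of [sobolev_version], with phi in place of the values
of f along an arc. *)
Definition line_version (phi F : R -> R) : Prop :=
  [/\ absolutely_continuous_on 0 1 F,
      {ae leb, forall t : R, 0 <= t <= 1 -> phi t = F t},
      F 0 = phi 0 & F 1 = phi 1].

Context (phi : R -> R) (g : R -> \bar R).
Hypothesis mg : measurable_fun setT (g : measurableTypeR R -> \bar R).
Hypothesis g0 : forall x, (0 <= g x)%E.
Hypothesis gfin : (\int[leb]_(x in I01) g x < +oo)%E.
Hypothesis h01 : (`|phi 1 - phi 0|%:E <= \int[leb]_(x in I01) g x)%E.
Hypothesis h0 : {ae leb, forall t : R, 0 <= t <= 1 ->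
  (`|phi t - phi 0|%:E <= \int[leb]_(x in `[0%R, t]) g x)%E}.
Hypothesis h1 : {ae leb, forall t : R, 0 <= t <= 1 ->
  (`|phi 1 - phi t|%:E <= \int[leb]_(x in `[t, 1%R]) g x)%E}.
Hypothesis h2 : {ae leb, forall t : R, 0 < t -> t <= 1 ->
  {ae leb, forall r : R, 0 <= r <= 1 ->
    (`|phi t - phi (r * t)%R|%:E <= \int[leb]_(x in `[(r * t)%R, t]) g x)%E}}.

Let gI := g \_ I01.

Let mI : measurable (I01 : set (measurableTypeR R)).
Proof. exact: measurable_itv. Qed.

Let mgI : measurable_fun setT (gI : measurableTypeR R -> \bar R).
Proof. exact: ((measurable_restrictT _ mI).1 (measurable_funTS mg)). Qed.

Let gI0 x : (0 <= gI x)%E.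
Proof. by apply: erestrict_ge0. Qed.

Let igI : leb.-integrable setT gI.
Proof.
apply/integrableP; split => //; apply: le_lt_trans gfin.
rewrite [leRHS]integral_mkcond -/gI.
by rewrite le_eqVlt; apply/orP; left; apply/eqP/eq_integral => x _; rewrite gee0_abs.
Qed.

Let G x := fine (gI x).

Let G0 x : 0 <= G x. Proof. exact: fine_ge0. Qed.

Let Gle x : ((G x)%:E <= gI x)%E.
Proof. by rewrite /G; have := gI0 x; case: (gI x) => [r| |] //= _; rewrite leey. Qed.

Let mG : measurable_fun setT (EFin \o G : measurableTypeR R -> \bar R).
Proof. by apply/measurable_EFinP; exact: measurableT_comp mgI. Qed.

Let iG : leb.-integrable setT (EFin \o G).
Proof.
apply: (le_integrable measurableT mG _ igI) => x _ /=.
by rewrite ger0_norm// gee0_abs.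
Qed.

Local Notation Gamma := (primitive G).

Let GammaE s t : 0 <= s -> s <= t -> t <= 1 ->
  (\int[leb]_(x in `[s, t]) g x)%E = (Gamma t - Gamma s)%:E.
Proof.
move=> s0 st t1; rewrite primitiveB//.
rewrite integral_itv_obnd_cbnd; last by apply: measurable_funTS; exact: mG.
apply: ae_eq_integral.
- exact: measurable_itv.
- exact: measurable_funTS.
- by apply: measurable_funTS; exact: mG.
have := integrable_ae measurableT igI; apply: filterS => x /(_ I) fx.
rewrite /= in_itv/= => /andP[sx xt]; rewrite /G fineK//.
by rewrite /gI patchE mem_set// /= in_itv/= (le_trans s0)// (le_trans xt).
Qed.

Let h2' : {ae leb, forall t : R, 0 < t -> t <= 1 ->
  {ae leb, forall x : R, 0 <= x <= t -> `|phi t - phi x| <= Gamma t - Gamma x}}.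
Proof.
have := h2; apply: ae_mono => t ht t0 t1.
have ti : 0 < t^-1 by rewrite invr_gt0.
have := ae_scale ti (ht t0 t1); apply: ae_mono => x hx /andP[x0 xt].
have xE : t^-1 * x * t = x by rewrite mulrAC mulVf ?mul1r// gt_eqF.
move: hx; rewrite xE GammaE// lee_fin; apply.
by rewrite mulr_ge0 ?(ltW ti)//= mulrC ler_pdivrMr// mul1r.
Qed.

Let good_time s := 0 < s /\
  {ae leb, forall x : R, 0 <= x <= s -> `|phi s - phi x| <= Gamma s - Gamma x}.

Let S := [set s : R | [/\ 0 <= s <= 1, `|phi s - phi 0| <= Gamma s - Gamma 0,
  `|phi 1 - phi s| <= Gamma 1 - Gamma s & [\/ s = 0, s = 1 | good_time s]]].

Let Gamma01 : `|phi 1 - phi 0| <= Gamma 1 - Gamma 0.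
Proof. by have := h01; rewrite GammaE// lee_fin. Qed.

Let S0 : S 0.
Proof. by split => //; [rewrite lexx ler01|rewrite !subrr normr0|constructor 1]. Qed.

Let S1 : S 1.
Proof. by split => //; [rewrite lexx ler01|rewrite !subrr normr0|constructor 2]. Qed.

Let ae_S : {ae leb, forall t : R, 0 <= t <= 1 -> S t}.
Proof.
have := ae_and (ae_and h2' (ae_neq (0 : R))) (ae_and h0 h1).
apply: ae_mono => t [[ht t0] [ht0 ht1]] /[dup] t01 /andP[t_ge0 t_le1].
have {}t0 : 0 < t by rewrite lt_neqAle eq_sym (introN eqP t0).
split => //.
- by have := ht0 t01; rewrite GammaE// lee_fin.
- by have := ht1 t01; rewrite GammaE// lee_fin.
- by constructor 3; split => //; exact: ht.
Qed.

Let S_le s t : S s -> S t -> s <= t -> `|phi t - phi s| <= Gamma t - Gamma s.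
Proof.
move=> [/andP[s0 s1] s2 s3 s4] [/andP[t0 t1] t2 t3 t4] st.
case: s4 => [->|sE|[s_gt0 gs]] //.
  have -> : t = s by lra.
  by rewrite !subrr normr0.
case: t4 => [tE|->|[t_gt0 gt]] //; first by lra.
apply/ler_addgt0Pr => e e0.
have e20 : 0 < e / 2 by rewrite divr_gt0.
have [k k0 hk] := primitive_cauchy G0 iG e20.
(* A common admissible time x just below s. *)
have rs : Num.max 0 (s - k) < s by rewrite gt_max s_gt0 ltrBlDr ltrDl.
have := ae_itv_exists rs (ae_and gs gt).
move=> [x]; rewrite gt_max => /andP[/andP[x0 xk] xs] [hs ht].
have sx : Gamma s - Gamma x < e / 2 by apply: hk; [exact: ltW|lra].
have := hs ltac:(by rewrite !ltW). have := ht ltac:(by rewrite ltW//= ltW// (lt_le_trans xs)).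
move=> htx hsx.
have -> : phi t - phi s = (phi t - phi x) - (phi s - phi x) by ring.
by apply: (le_trans (ler_normB _ _)); lra.
Qed.

Let S_dist s t : S s -> S t -> `|phi t - phi s| <= `|Gamma t - Gamma s|.
Proof.
have [st Ss St|/ltW ts Ss St] := leP s t.
  by rewrite [leRHS]ger0_norm ?S_le// subr_ge0 primitive_homo.
by rewrite distrC [leRHS]distrC [leRHS]ger0_norm ?S_le// subr_ge0 primitive_homo.
Qed.

(** The hypotheses of this section are the bounds obtained from pieces of an arc. The
set S of times that satisfy them has full measure and contains 0 and 1, and the
increments of phi on S are bounded by those of the primitive of g ([S_le]). *)
Lemma sobolev_of_cuts : (exists F, line_version phi F) /\
  forall F, line_version phi F ->
    {ae leb, forall t : R, 0 <= t <= 1 -> derivable F t 1 /\ (`|derive1 F t|%:E <= g t)%E}.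
Proof.
have [F [FS FG]] := mcshane S0 S_dist.
have FG' s t : s <= t -> `|F t - F s| <= Gamma t - Gamma s.
  move=> st; apply: le_trans (FG s t) _.
  by rewrite ger0_norm// subr_ge0 primitive_homo.
have acF := controlled_ac G0 iG FG'.
have vF : line_version phi F.
  split => //; [|exact: FS|exact: FS].
  by have := ae_S; apply: ae_mono => t St t01; rewrite FS//; exact: St.
split; first by exists F.
move=> F' [acF' aeF' _ _].
have FF' : forall t, 0 <= t <= 1 -> F t = F' t.
  apply: ac_ae_unique => //; have [_ aeF _ _] := vF.
  by have := ae_and aeF aeF'; apply: ae_mono => t [h h'] t01; rewrite -h// h'.
have := controlled_derivable G0 iG FG'.
move=> /(ae_and (ae_and (ae_neq (0 : R)) (ae_neq (1 : R)))).
apply: ae_mono => t [[t0 t1] hd] t01.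
have {}t0 : 0 < t by rewrite lt_neqAle eq_sym (introN eqP t0)//; case/andP: t01.
have {}t1 : t < 1 by rewrite lt_neqAle (introN eqP t1)//; case/andP: t01.
have [dF dFG] := hd t0.
have nFF' : \forall s \near t, F s = F' s.
  near=> s; apply: FF'; apply/andP; split; apply: ltW; near: s;
  [exact: lt_nbhsr|exact: lt_nbhsl].
split; first exact: near_eq_derivable dF.
rewrite derive1E -(near_eq_derive _ nFF') -derive1E.
apply: (@le_trans _ _ (G t)%:E); first by rewrite lee_fin.
apply: le_trans (Gle t) _.
by rewrite /gI patchE mem_set //= in_itv.
Unshelve. all: by end_near. Qed.

End line.

(** * Back to arcs *)

Section conclusion.
Context {R : realType} {X : ptopologicalType} (d : extended_distance R X).
Local Notation RA := (rect_arc d).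
Local Notation I01 := (`[0%R, 1%R]%classic : set R).
Local Notation leb := (@lebesgue_measure R).
Hypothesis emt : emt_space d.
Implicit Types (c : RA).

Section avoid.
Context (q : R) (m : {finite_measure set (borel X) -> \bar R}).

Lemma T_ae_mono (P Q : RA -> Prop) : (forall c, P c -> Q c) -> T_ae q m P -> T_ae q m Q.
Proof.
move=> PQ hP pi tp; apply: filterS (hP pi tp) => //.
exact: (ae_filter_ringOfSetsType pi).
Qed.

Lemma T_ae_and (P Q : RA -> Prop) :
  T_ae q m P -> T_ae q m Q -> T_ae q m (fun c => P c /\ Q c).
Proof.
move=> hP hQ pi tp; apply: filterI (hP pi tp) (hQ pi tp).
exact: (ae_filter_ringOfSetsType pi).
Qed.

(** The total time spent in N, integrated over the plan, is the integral of the
barycenter density over N. *)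
Lemma T_ae_avoid (N : set (borel X)) : measurable N -> m N = 0%E ->
  T_ae q m (fun c => 0 < len c -> {ae leb, forall t : R, 0 <= t <= 1 -> ~ N (arc_param c t)}).
Proof.
move=> mN N0 pi tp; apply: ae_of_regular_compact => //; first exact: T_plan_radon tp.
move=> e K gK; have mK := regular_compact_measurable emt gK.
have [h hd] := Bar_density (T_plan_bar tp).
have mI : measurable_fun setT (EFin \o (\1_N : borel X -> R)) by exact: indic_measurable.
have I0 (x : borel X) : (0 <= (EFin \o (\1_N : X -> R)) x)%E by rewrite lee_fin.
have [mJ _] := arc_integral_fubini emt pi mK (regular_compact_regular gK) mI I0.
have J0 (c : borel RA) : (0 <= arc_integral c (EFin \o (\1_N : X -> R)))%E by exact: arc_integral_ge0.
have JK0 : (\int[pi]_(c in K) arc_integral c (EFin \o (\1_N : X -> R)) = 0)%E.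
  apply/eqP; rewrite eq_le; apply/andP; split; last by apply: integral_ge0 => c _; exact: J0.
  apply: le_trans (arc_integral_indic_le K hd mN) _.
  have mh : measurable_fun setT (h : borel X -> R) by case: hd => /sub_Lfun_mfun; rewrite inE.
  rewrite (@null_set_integral _ _ _ m N _ mN)//.
  by apply/measurable_EFinP; apply: measurable_funTS; exact: measurableT_comp mh.
have := @ge0_integral_eq0_ae _ _ _ pi K _ mK mJ J0 JK0.
apply: filterS => c hc Kc; have [_ e0 eK _] := gK.
have l0 : 0 < len c by exact: lt_le_trans (eK c Kc).
have mc : measurable_fun I01 (fun t : measurableTypeR R => (\1_N (arc_param c t) : R)%:E).
  by apply: measurable_funTS; exact: (measurableT_comp mI (arc_param_measurable c)).
have c0 (t : R) : (0 <= (\1_N (arc_param c t) : R)%:E)%E by rewrite lee_fin.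
have := hc Kc; rewrite arc_integralE => /eqP; rewrite mule_eq0 eqe gt_eqF//= => /eqP Ic.
have := @ge0_integral_eq0_ae _ _ _ leb I01 _ (measurable_itv _) mc c0 Ic.
apply: ae_mono => t ht t01 Nt; have := ht t01.
by rewrite indicE mem_set// => -[] /eqP; rewrite oner_eq0.
Qed.

End avoid.

Definition gradient_bound (f : X -> R) (g : X -> \bar R) c : Prop :=
  (`|f (arc_param c 1) - f (arc_param c 0)|%:E <= arc_integral c g < +oo)%E.

Section one_arc.
Context (f : X -> R) (g : borel X -> \bar R) (c : RA).
Hypothesis mg : measurable_fun setT g.
Hypothesis g0 : forall x, (0 <= g x)%E.

Let phi t := f (arc_param c t).
Let gc t := ((len c)%:E * g (arc_param c t))%E.

Let mgc0 : measurable_fun setT (fun t : measurableTypeR R => g (arc_param c t)).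
Proof. exact: (measurableT_comp mg (arc_param_measurable c)). Qed.

Let mgc : measurable_fun setT (gc : measurableTypeR R -> \bar R).
Proof. by apply: emeasurable_funM. Qed.

Let gc0 t : (0 <= gc t)%E.
Proof. by rewrite mule_ge0// lee_fin len_ge0. Qed.

Let gcZ (A : set (measurableTypeR R)) : measurable A ->
  ((len c)%:E * \int[leb]_(s in A) g (arc_param c s) = \int[leb]_(s in A) gc s)%E.
Proof.
move=> mA; rewrite ge0_integralZl//; first exact: measurable_funTS.
by rewrite lee_fin len_ge0.
Qed.

(** The four hypotheses are the bound on the arc, on its initial pieces, on its final
pieces, and on final pieces of initial pieces. Arcs of length zero are constant,
and then all bounds hold trivially. *)
Lemma line_version_of_bounds : gradient_bound f g c ->
  (0 < len c -> {ae leb, forall t : R, 0 <= t <= 1 ->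
     gradient_bound f g (cutarc (cst 0) id c t)}) ->
  (0 < len c -> {ae leb, forall t : R, 0 <= t <= 1 ->
     gradient_bound f g (cutarc id (cst 1) c t)}) ->
  (0 < len c -> {ae leb, forall t : R, 0 <= t <= 1 ->
     0 < len (cutarc (cst 0) id c t) ->
     {ae leb, forall r : R, 0 <= r <= 1 ->
       gradient_bound f g (cutarc id (cst 1) (cutarc (cst 0) id c t) r)}}) ->
  (exists F, line_version phi F) /\
  forall F, line_version phi F ->
    {ae leb, forall t : R, 0 <= t <= 1 -> derivable F t 1 /\ (`|derive1 F t|%:E <= gc t)%E}.
Proof.
move=> b01 b0 b1 b2.
have mI : measurable (I01 : set (measurableTypeR R)) by exact: measurable_itv.
have [h01 hfin] : (`|phi 1 - phi 0|%:E <= \int[leb]_(x in I01) gc x)%E /\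
    (\int[leb]_(x in I01) gc x < +oo)%E.
  by move: b01 => /andP[]; rewrite arc_integralE gcZ.
have := len_ge0 c; rewrite le_eqVlt => /orP[/eqP/esym l0|l0].
  have phiE s t : phi s = phi t by rewrite /phi (arc_param_const emt s t l0).
  have i0 (A : set (measurableTypeR R)) : (0 <= \int[leb]_(x in A) gc x)%E.
    by apply: integral_ge0.
  apply: sobolev_of_cuts => //; apply: aeW => t.
  - by move=> _; rewrite (phiE t 0) subrr normr0.
  - by move=> _; rewrite (phiE 1 t) subrr normr0.
  - by move=> _ _; apply: aeW => r _; rewrite (phiE t (r * t)) subrr normr0.
apply: sobolev_of_cuts => //.
- have := b0 l0; apply: ae_mono => t ht /[dup] t01 /andP[t0 t1].
  have := ht t01; rewrite /gradient_bound /cutarc /= => /andP[+ _].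
  rewrite arc_integral_subarc// gcZ; last exact: measurable_itv.
  by rewrite !subarc_param// clampRge1// clampRle0// mulr0 mulr1 subr0 !add0r.
- have := b1 l0; apply: ae_mono => t ht /[dup] t01 /andP[t0 t1].
  have := ht t01; rewrite /gradient_bound /cutarc /= => /andP[+ _].
  rewrite arc_integral_subarc// gcZ; last exact: measurable_itv.
  have e1 : t + (1 - t) * 1 = 1 by ring.
  by rewrite !subarc_param// clampRge1// clampRle0// mulr0 addr0 e1.
- have := b2 l0; apply: ae_mono => t ht t0 t1.
  have t01 : 0 <= t <= 1 by rewrite ltW.
  pose c' := cutarc (cst 0) id c t.
  have lc' : len c' = t * len c by rewrite -[c']/(subarc c 0 t) (len_subarc emt c (lexx 0) (ltW t0) t1) subr0.
  have pc' s : 0 <= s <= 1 -> arc_param c' s = arc_param c (t * s).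
    move=> s01; rewrite -[c']/(subarc c 0 t).
    by rewrite (subarc_param emt c s (lexx 0) (ltW t0) t1) clampRE// subr0 add0r.
  have l'0 : 0 < len (cutarc (cst 0) id c t) by rewrite -/c' lc' mulr_gt0.
  have := ht t01 l'0; apply: ae_mono => r hr /[dup] r01 /andP[r0 r1].
  have := hr r01; rewrite /gradient_bound -/c' => /andP[+ _].
  have pcc s : 0 <= s <= 1 ->
      arc_param (cutarc id (cst 1) c' r) s = arc_param c (t * (r + (1 - r) * s)).
    move=> /[dup] s01 /andP[s0 s1]; rewrite /cutarc/= subarc_param// clampRE// pc'//.
    by apply/andP; split; nra.
  rewrite (@arc_integral_affine _ _ d c (cutarc id (cst 1) c' r) g (r * t) t)//; last 3 first.
  + by rewrite ler_piMl// ltW.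
  + by rewrite /cutarc/= len_subarc// lc'; ring.
  + by move=> s s01; rewrite pcc//; congr arc_param; ring.
  rewrite gcZ; last exact: measurable_itv.
  rewrite !pcc ?lexx ?ler01// mulr0 addr0 mulr1 (addrC r) subrK mulr1 (mulrC t).
  by [].
Qed.

End one_arc.

(** The lower integral is insensitive to null sets, even when g is not measurable
along the arc. *)
Lemma arc_integral_off (g g' : X -> \bar R) (N : set X) c :
  (0 < len c -> {ae leb, forall t : R, 0 <= t <= 1 -> ~ N (arc_param c t)}) ->
  (forall x, ~ N x -> g' x = g x) ->
  arc_integral c g' = arc_integral c g.
Proof.
move=> hN gg'; rewrite !arc_integralE.
have := len_ge0 c; rewrite le_eqVlt => /orP[/eqP <-|l0]; first by rewrite !mul0e.
have [M [mM M0 hM]] := hN l0; congr (_ * _)%E.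
apply: (eq_integral_off mM M0) => t; rewrite /= in_itv/= => t01 nM.
apply: gg'; have := contra_not (hM t) nM; rewrite /= => /contrapT; exact.
Qed.

End conclusion.

Theorem theorem10p14 (R : realType) (p q : R) (X : ptopologicalType)
    (d : extended_distance R X) (m : {finite_measure set (borel X) -> \bar R})
    (f : X -> R) (g : X -> \bar R) :
  1 < p -> q = p / (p - 1) ->
  emt_space d -> radon m ->
  @ae_measurable _ _ R (borel X) R m f ->
  weak_upper_gradient d q m f g ->
  T_ae q m (fun c : rect_arc d =>
    strictly_sobolev f c /\
    forall F : R -> R, sobolev_version f c F ->
      {ae @lebesgue_measure R, forall t, 0 <= t <= 1 ->
        derivable F t 1 /\
        (`|derive1 F t|%:E <= arc_length c * g (arc_param c t))%E} /\
      F 0 = f (arc_param c 0) /\ F 1 = f (arc_param c 1)).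
Proof.
move=> p1 qE emt _ _ [g0 mg hg].
have q1 : 1 <= q.
  by rewrite qE ler_pdivlMr ?subr_gt0// mul1r lerBlDr lerDl.
have [g' [N [mg' mN N0 gg' gN]]] := ae_measurable_version mg.
have g'0 x : (0 <= g' x)%E.
  by have [Nx|/gg' ->] := pselect (N x); [rewrite gN|exact: g0].
have avoid := T_ae_avoid emt (q := q) mN N0.
have bound : T_ae q m (@gradient_bound R X d f g').
  apply: T_ae_mono (T_ae_and avoid hg) => c [hc].
  by rewrite /gradient_bound (arc_integral_off hc gg').
have e0 : [\/ cst 0 = cst 0 :> (R -> R), cst 0 = cst 1 :> (R -> R) | cst 0 = id :> (R -> R)] by constructor 1.
have e1 : [\/ cst 1 = cst 0 :> (R -> R), cst 1 = cst 1 :> (R -> R) | cst 1 = id :> (R -> R)] by constructor 2.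
have ei : [\/ id = cst 0 :> (R -> R), id = cst 1 :> (R -> R) | id = id :> (R -> R)] by constructor 3.
have b0 := T_ae_cut emt q1 (@cut_init R) e0 ei bound.
have b1 := T_ae_cut emt q1 (@cut_final R) ei e1 bound.
have b2 := T_ae_cut emt q1 (@cut_init R) e0 ei b1.
apply: T_ae_mono (T_ae_and (T_ae_and b0 b1) (T_ae_and b2 (T_ae_and bound avoid))).
move=> c [[c0 c1] [c2 [cb ca]]].
have [[F vF] hF] := line_version_of_bounds emt mg' g'0 cb c0 c1 c2.
split; first by exists F.
move=> F' vF'; split; last by case: vF'.
have := len_ge0 c; rewrite le_eqVlt => /orP[/eqP l0|l0].
  have := hF F' vF'; apply: ae_mono => t ht t01; have [dF bF] := ht t01; split => //.
  by apply: le_trans bF _; rewrite lenE -l0 !mul0e.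
have := ae_and (hF F' vF') (ca l0); apply: ae_mono => t [ht nN] t01.
have [dF bF] := ht t01; split => //.
by apply: le_trans bF _; rewrite lenE gg'//; exact: nN.
Qed.
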